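(* Consider the trans-log skill formation model described in the context and suppose that conditions (a)--(h) listed there hold. 1. The identified set of the parameters $\{\mu_{\theta,t,m},\lambda_{\theta,t,m}\}_{t=0,\ldots,T,m=1,2}$, $\{\mu_{I,t,m},\lambda_{I,t,m}\}_{t=0,\ldots,T-1,m=1,2}$, $(\rho_0,\rho_1)$, $\{ \beta_{0t}, \beta_{1t}, \beta_{2t}\}^{T-1}_{t=0}$, $\{a_t,\gamma_{1t},\gamma_{2t}, \gamma_{3t}\}^{T-1}_{t=0}$ consists of all vectors that yield the same values of $\{\tilde{\mu}_{\theta,t,m},\tilde{\lambda}_{\theta,t,m}\}_{t=0,\ldots,T,m=1,2}$, $\{\tilde{\mu}_{I,t,m},\tilde{\lambda}_{I,t,m}\}_{t=0,\ldots,T-1,m=1,2}$, $(\tilde{\rho}_0,\tilde{\rho}_1)$, $\{ \tilde{\beta}_{0t}, \tilde{\beta}_{1t}, \tilde{\beta}_{2t}\}^{T-1}_{t=0}$, and $\{\tilde{a}_t,\tilde{\gamma}_{1t},\tilde{\gamma}_{2t}, \tilde{\gamma}_{3t}\}^{T-1}_{t=0}$ (the functions of the parameters defined in the context) as the true parameter vector. 2. Let $\{\bar{\mu}_{\theta,t,1},\bar{\lambda}_{\theta,t,1}\}_{t=0}^{T}$ and $\{\bar{\mu}_{I,t,1},\bar{\lambda}_{I,t,1}\}_{t=0}^{T-1}$ be fixed constants with $\bar{\lambda}_{\theta,t,1},\bar{\lambda}_{I,t,1}\neq0$ for all $t$. If in addition the restrictions $\{\mu_{\theta,t,1},\lambda_{\theta,t,1}\}_{t=0}^{T}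 = \{\bar{\mu}_{\theta,t,1},\bar{\lambda}_{\theta,t,1}\}_{t=0}^{T}$ and $\{\mu_{I,t,1},\lambda_{I,t,1}\}_{t=0}^{T-1} = \{\bar{\mu}_{I,t,1},\bar{\lambda}_{I,t,1}\}_{t=0}^{T-1}$ are imposed, then the identified set is a singleton.
   Context: Model. $\theta_t$ (skills, $t=0,\dots,T$) and $I_t$ (investment, $t=0,\dots,T-1$) are unobserved positive random variables satisfying $$\ln \theta_{t+1} = a_t + \gamma_{1t}\ln \theta_{t} + \gamma_{2t} \ln I_{t} + \gamma_{3t}\ln \theta_{t} \ln I_{t} + \eta_{\theta,t},\quad t=0,\dots,T-1,$$ $$Z_{\theta,t,m} = \mu_{\theta,t,m} + \lambda_{\theta,t,m} \ln \theta_{t} + \varepsilon_{\theta,t,m},\quad t=0,\dots,T,\ m=1,2,$$ $$Z_{I,t,m} = \mu_{I,t,m} + \lambda_{I,t,m} \ln I_{t} + \varepsilon_{I,t,m},\quad t=0,\dots,T-1,\ m=1,2,$$ $$\ln I_t = \beta_{0t} + \beta_{1t} \ln \theta_{t} + \beta_{2t} \ln Y_{t} + \eta_{I,t},\quad t=0,\dots,T-1,$$ $$Q = \rho_{0} + \rho_{1} \ln \theta_{T} + \eta_Q.$$ Observed variables: $\{Y_t\}_{t=0}^{T-1}$ (income, or another exogenous variable that affects investment, i.e. $\beta_{2t}\neq 0$), all $Z_{\theta,t,m}$, all $Z_{I,t,m}$, and $Q$. The errors/shocks $\varepsilon_{\theta,t,m},\varepsilon_{I,t,m},\eta_{\theta,t},\eta_{I,t},\eta_Q$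 are unobserved. Conditions. (a) $\{\{\varepsilon_{\theta,t,m}\}_{t=0,\ldots,T, m= 1,2}, \{\varepsilon_{I,t,m} \}_{t=0,\ldots,T-1, m= 1,2}, \eta_Q\}$ are jointly independent and independent of $\{\{\theta_{t}\}^{T}_{t=0},\{I_t\}_{t=0}^{T-1}\}$ conditional on $\{Y_t\}_{t=0}^{T-1}$. (b) All random variables have bounded first and second moments. (c) $E[\varepsilon_{\theta,t,m}] = E[\varepsilon_{I,t,m}] = E[\eta_Q] = 0$ for all $t$ and $m$. (d) $\lambda_{\theta,t,m}, \lambda_{I,t,m} \neq 0$ for all $t$ and $m$. (e) For all $t \in \{0,\ldots,T\}$, $cov(\ln \theta_t,\ln I_s) \neq 0$ for some $s \in \{0,\ldots, T-1\}$ or $cov(\ln \theta_t,\ln \theta_s) \neq 0$ for some $s \in \{0, \ldots, T\} \setminus \{t\}$. For all $t \in \{0,\ldots,T-1\}$, $cov(\ln I_t,\ln \theta_s) \neq 0$ for some $s \in \{0, \ldots, T\}$ or $cov(\ln I_t,\ln I_s) \neq 0$ for some $s \in \{0, \ldots, T-1\} \setminus \{t\}$. (f) For all $t$ and $m$ the real zeros of the characteristic function of $\varepsilon_{\theta,t,m}$ are isolated and are distinct from those of its derivatives. Identical conditions hold for the characteristic functions of $\varepsilon_{I,t,m}$ and $\eta_{Q}$. (g) The support of $(\theta_{t},I_{t},Y_t)$ includes an open ball in $\mathbb{R}^3$ for all $t$. (h) $E[\eta_{I,t} \mid \theta_{t}, Y_t] = 0$ and $E[\eta_{\theta,t} \mid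 \theta_{t},\eta_{I,t} , Y_t] = \kappa_t \eta_{I,t}$ for all $t$, for some constants $\kappa_t$. Transformed parameters (functions of the primitive parameters): $$\tilde{\gamma}_{1t} = \frac{\lambda_{\theta,t+1,1}}{\lambda_{\theta,t,1}} \left( \gamma_{1t} - \frac{\mu_{I,t,1}}{\lambda_{I,t,1}}\gamma_{3t} \right),\quad \tilde{\gamma}_{2t} = \frac{ \lambda_{\theta,t+1,1} }{\lambda_{I,t,1}} \left( \gamma_{2t} - \frac{\mu_{\theta,t,1}}{\lambda_{\theta,t,1}}\gamma_{3t} \right),\quad \tilde{\gamma}_{3t} = \frac{\lambda_{\theta,t+1,1}}{\lambda_{\theta,t,1} \lambda_{I,t,1}}\gamma_{3t},$$ $$\tilde{a}_t = \lambda_{\theta,t+1,1} a_t + \mu_{\theta,t+1,1} - \frac{\lambda_{\theta,t+1,1}}{\lambda_{\theta,t,1}} \mu_{\theta,t,1} \gamma_{1t} - \frac{\lambda_{\theta,t+1,1}}{\lambda_{I,t,1}} \mu_{I,t,1} \gamma_{2t} + \frac{\lambda_{\theta,t+1,1}}{\lambda_{\theta,t,1} \lambda_{I,t,1}} \mu_{I,t,1} \mu_{\theta,t,1}\gamma_{3t},$$ $$\tilde{\lambda}_{\theta,t,m} = \frac{\lambda_{\theta,t,m}}{\lambda_{\theta,t,1}},\quad \tilde{\mu}_{\theta,t,m} = \mu_{\theta,t,m} - \frac{\lambda_{\theta,t,m}}{\lambda_{\theta,t,1}} \mu_{\theta,t,1},\quad \tilde{\lambda}_{I,t,m} = \frac{\lambda_{I,t,m}}{\lambda_{I,t,1}},\quad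 \tilde{\mu}_{I,t,m} = \mu_{I,t,m} - \frac{\lambda_{I,t,m}}{\lambda_{I,t,1}} \mu_{I,t,1},$$ $$\tilde{\beta}_{0t} = \lambda_{I,t,1} \beta_{0t} + \mu_{I,t,1} - \frac{\lambda_{I,t,1}}{\lambda_{\theta,t,1}} \mu_{\theta,t,1} \beta_{1t},\quad \tilde{\beta}_{1t} = \frac{\lambda_{I,t,1}}{\lambda_{\theta,t,1}} \beta_{1t},\quad \tilde{\beta}_{2t} = \lambda_{I,t,1} \beta_{2t},$$ $$\tilde{\rho}_0 = \rho_0 - \frac{\rho_1 \mu_{\theta,T,1}}{\lambda_{\theta,T,1}},\quad \tilde{\rho}_1 = \frac{ \rho_1}{\lambda_{\theta,T,1}}.$$ Identification. A structure is a parameter vector together with a joint distribution of all (observed and unobserved) random variables satisfying the model and the stated conditions. Two structures are observationally equivalent if they generate the same joint distribution of the observed variables. The identified set of the parameters is the set of all parameter vectors belonging to some structure that is observationally equivalent to the true structure; with additional restrictions, it is the subset of those vectors that satisfy the restrictions.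
   Formalization: Every structure must also have each error ε and η_Q independent of {Y_t}; with (a) alone an error can absorb a multiple of ln Y and the claim fails. The moment condition (b) is imposed on ln θ_t and ln I_t rather than on their levels. *)

(* Defs.v *)
From HB Require Import structures.
From mathcomp Require Import all_boot all_order all_algebra.
From mathcomp Require Import all_classical all_reals all_analysis.

Set Implicit Arguments.
Unset Strict Implicit.
Unset Printing Implicit Defensive.

Import Order.TTheory GRing.Theory Num.Theory.
Import numFieldNormedType.Exports.

Local Open Scope classical_set_scope.
Local Open Scope ring_scope.

(* [W] is a version of the conditional expectation of [X] given the
   sigma-algebra generated by [G]. *)
Definition is_cond_expectation (R : realType) (d : measure_display)
    (Omega : measurableType d) (P : probability Omega R)
    (d' : measure_display) (S : measurableType d')
    (G : Omega -> S) (X W : Omega -> R) : Prop :=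
  [/\ P.-integrable setT (EFin \o X),
      P.-integrable setT (EFin \o W),
      (forall A : set R, measurable A ->
         g_sigma_algebra_preimage G (W @^-1` A)) &
      (forall E : set Omega, g_sigma_algebra_preimage G E ->
         \int[P]_(w in E) (X w)%:E = \int[P]_(w in E) (W w)%:E)%E].

Definition is_cond_probability (R : realType) (d : measure_display)
    (Omega : measurableType d) (P : probability Omega R)
    (d' : measure_display) (S : measurableType d')
    (G : Omega -> S) (E : set Omega) (q : Omega -> R) : Prop :=
  is_cond_expectation P G (\1_E) q.

(* The variables [X j] and the vector [V] are mutually independent given [G].
   Versions of conditional probabilities exist and are almost surely unique, so
   quantifying them existentially or universally is the same. *)
Definition cond_mutually_independent (R : realType) (d : measure_display)
    (Omega : measurableType d) (P : probability Omega R)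
    (J : finType) (X : J -> Omega -> R)
    (d1 : measure_display) (S1 : measurableType d1) (V : Omega -> S1)
    (d2 : measure_display) (S2 : measurableType d2) (G : Omega -> S2) : Prop :=
  forall (A : J -> set R) (B : set S1),
    (forall j, measurable (A j)) -> measurable B ->
  exists (q : J -> Omega -> R) (qV : Omega -> R),
    [/\ (forall j, is_cond_probability P G (X j @^-1` A j) (q j)),
        is_cond_probability P G (V @^-1` B) qV &
        is_cond_probability P G
          ((\bigcap_(j in [set: J]) X j @^-1` A j) `&` V @^-1` B)
          (fun w => (\prod_j q j w) * qV w)].

Definition independent_rv (R : realType) (d : measure_display)
    (Omega : measurableType d) (P : probability Omega R)
    (d1 : measure_display) (S1 : measurableType d1) (X : Omega -> S1)
    (d2 : measure_display) (S2 : measurableType d2) (V : Omega -> S2) : Prop :=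
  forall (A : set S1) (B : set S2), measurable A -> measurable B ->
    (P (X @^-1` A `&` V @^-1` B) = P (X @^-1` A) * P (V @^-1` B))%E.

(* The complex plane is represented by [R * R], so this is
   u |-> E[exp(i u X)] = E[cos(u X)] + i E[sin(u X)]. *)
Definition char_fun (R : realType) (d : measure_display)
    (Omega : measurableType d) (P : probability Omega R)
    (X : Omega -> R) (u : R) : R * R :=
  (\int[P]_w cos (u * X w), \int[P]_w sin (u * X w)).

(* The k-th derivative is only constrained when it exists: [derive1n] is total
   and takes a meaningless value otherwise. *)
Definition char_fun_zeros_regular (R : realType) (d : measure_display)
    (Omega : measurableType d) (P : probability Omega R)
    (X : Omega -> R) : Prop :=
  let phi := char_fun P X in
  (forall u, phi u = 0 -> \forall s \near u^', phi s <> 0) /\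
  (forall k, (0 < k)%N ->
     (forall j, (j < k)%N -> forall s, derivable (derive1n j phi) s 1) ->
     forall u, phi u = 0 -> derive1n k phi u <> 0).

Definition law_support (R : realType) (d : measure_display)
    (Omega : measurableType d) (P : probability Omega R)
    (S : topologicalType) (X : Omega -> S) : set S :=
  [set x | forall U : set S, open U -> U x -> (0 < P (X @^-1` U))%E].

Section Model.
Variables (R : realType) (T : nat).

Definition cur (t : 'I_T) : 'I_T.+1 := widen_ord (leqnSn T) t.
Definition nxt (t : 'I_T) : 'I_T.+1 := lift ord0 t.

(* Measurements m = 1, 2 are indexed by ['I_2], so m = 1 is [m1]. *)
Definition m1 : 'I_2 := ord0.

Record params := Params {
  mu_th : 'I_T.+1 -> 'I_2 -> R;
  la_th : 'I_T.+1 -> 'I_2 -> R;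
  mu_I : 'I_T -> 'I_2 -> R;
  la_I : 'I_T -> 'I_2 -> R;
  rho0 : R;
  rho1 : R;
  beta0 : 'I_T -> R;
  beta1 : 'I_T -> R;
  beta2 : 'I_T -> R;
  a_ : 'I_T -> R;
  gamma1 : 'I_T -> R;
  gamma2 : 'I_T -> R;
  gamma3 : 'I_T -> R }.

Definition admissible (b : params) : Prop :=
  [/\ (forall t m, la_th b t m != 0),
      (forall t m, la_I b t m != 0) &
      (forall t, beta2 b t != 0)].

Definition transform (b : params) : params := {|
  mu_th := fun t m => mu_th b t m - la_th b t m / la_th b t m1 * mu_th b t m1;
  la_th := fun t m => la_th b t m / la_th b t m1;
  mu_I := fun t m => mu_I b t m - la_I b t m / la_I b t m1 * mu_I b t m1;
  la_I := fun t m => la_I b t m / la_I b t m1;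
  rho0 := rho0 b - rho1 b * mu_th b ord_max m1 / la_th b ord_max m1;
  rho1 := rho1 b / la_th b ord_max m1;
  beta0 := fun t => la_I b t m1 * beta0 b t + mu_I b t m1
    - la_I b t m1 / la_th b (cur t) m1 * mu_th b (cur t) m1 * beta1 b t;
  beta1 := fun t => la_I b t m1 / la_th b (cur t) m1 * beta1 b t;
  beta2 := fun t => la_I b t m1 * beta2 b t;
  a_ := fun t => la_th b (nxt t) m1 * a_ b t + mu_th b (nxt t) m1
    - la_th b (nxt t) m1 / la_th b (cur t) m1
        * mu_th b (cur t) m1 * gamma1 b t
    - la_th b (nxt t) m1 / la_I b t m1 * mu_I b t m1 * gamma2 b t
    + la_th b (nxt t) m1 / (la_th b (cur t) m1 * la_I b t m1)
        * mu_I b t m1 * mu_th b (cur t) m1 * gamma3 b t;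
  gamma1 := fun t => la_th b (nxt t) m1 / la_th b (cur t) m1
    * (gamma1 b t - mu_I b t m1 / la_I b t m1 * gamma3 b t);
  gamma2 := fun t => la_th b (nxt t) m1 / la_I b t m1
    * (gamma2 b t - mu_th b (cur t) m1 / la_th b (cur t) m1 * gamma3 b t);
  gamma3 := fun t => la_th b (nxt t) m1
    / (la_th b (cur t) m1 * la_I b t m1) * gamma3 b t |}.

Record variables (d : measure_display) (Omega : measurableType d)
    (P : probability Omega R) := Variables {
  theta : 'I_T.+1 -> {RV P >-> R};
  inv : 'I_T -> {RV P >-> R};
  Y : 'I_T -> {RV P >-> R};
  Z_th : 'I_T.+1 -> 'I_2 -> {RV P >-> R};
  Z_I : 'I_T -> 'I_2 -> {RV P >-> R};
  Q : {RV P >-> R};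
  eps_th : 'I_T.+1 -> 'I_2 -> {RV P >-> R};
  eps_I : 'I_T -> 'I_2 -> {RV P >-> R};
  eta_th : 'I_T -> {RV P >-> R};
  eta_I : 'I_T -> {RV P >-> R};
  eta_Q : {RV P >-> R} }.

Section Structure.
Variables (d : measure_display) (Omega : measurableType d).
Variables (P : probability Omega R) (b : params) (v : variables P).

Definition ln_theta (t : 'I_T.+1) : Omega -> R := fun w => ln (theta v t w).
Definition ln_inv (t : 'I_T) : Omega -> R := fun w => ln (inv v t w).
Definition ln_Y (t : 'I_T) : Omega -> R := fun w => ln (Y v t w).

Definition Y_vec (w : Omega) : T.-tuple R := [tuple Y v t w | t < T].
Definition latent_vec (w : Omega) : T.+1.-tuple R * T.-tuple R :=
  ([tuple theta v t w | t < T.+1], [tuple inv v t w | t < T]).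
Definition observed_vec (w : Omega) :
    T.-tuple R * T.+1.-tuple (2.-tuple R) * T.-tuple (2.-tuple R) * R :=
  (Y_vec w, [tuple [tuple Z_th v t m w | m < 2] | t < T.+1],
   [tuple [tuple Z_I v t m w | m < 2] | t < T], Q v w).

(* The measurement errors together with the shock of the Q equation. *)
Definition error_index : finType :=
  ('I_T.+1 * 'I_2 + 'I_T * 'I_2 + unit)%type.
Definition errors (j : error_index) : Omega -> R :=
  match j with
  | inl (inl (t, m)) => eps_th v t m
  | inl (inr (t, m)) => eps_I v t m
  | inr tt => eta_Q v
  end.

Definition model_equations : Prop :=
  (forall t, {ae P, forall w, 0 < theta v t w}) /\
  (forall t, {ae P, forall w, 0 < inv v t w}) /\
  (forall t, {ae P, forall w, 0 < Y v t w}) /\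
  (forall t, {ae P, forall w, ln_theta (nxt t) w =
     a_ b t + gamma1 b t * ln_theta (cur t) w + gamma2 b t * ln_inv t w
     + gamma3 b t * ln_theta (cur t) w * ln_inv t w + eta_th v t w}) /\
  (forall t m, {ae P, forall w, Z_th v t m w =
     mu_th b t m + la_th b t m * ln_theta t w + eps_th v t m w}) /\
  (forall t m, {ae P, forall w, Z_I v t m w =
     mu_I b t m + la_I b t m * ln_inv t w + eps_I v t m w}) /\
  (forall t, {ae P, forall w, ln_inv t w =
     beta0 b t + beta1 b t * ln_theta (cur t) w + beta2 b t * ln_Y t w
     + eta_I v t w}) /\
  {ae P, forall w, Q v w =
     rho0 b + rho1 b * ln_theta ord_max w + eta_Q v w}.

Definition cond_errors_independent : Prop :=
  cond_mutually_independent P errors latent_vec Y_vec.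

(* The laws of the errors do not depend on Y: this is what makes the
   unconditional mean-zero and characteristic-function conditions below bear on
   the conditional laws given Y. It does not follow from
   [cond_errors_independent], and without it the identified set is larger: a
   measurement error could absorb a multiple of ln Y - E[ln Y]. *)
Definition errors_independent_of_Y : Prop :=
  forall j, independent_rv P (errors j) Y_vec.

Definition has_moments (X : Omega -> R) : Prop :=
  X \in Lfun P 1 /\ X \in Lfun P 2%:E.

(* theta and I enter in logarithms, as they do in every equation: moments of
   their levels are not preserved by theta |-> c theta^p. *)
Definition moment_conditions : Prop :=
  (forall t, has_moments (ln_theta t)) /\
  (forall t, has_moments (ln_inv t)) /\
  (forall t, has_moments (Y v t) /\ has_moments (ln_Y t)) /\
  (forall t m, has_moments (Z_th v t m)) /\
  (forall t m, has_moments (Z_I v t m)) /\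
  has_moments (Q v) /\
  (forall t m, has_moments (eps_th v t m)) /\
  (forall t m, has_moments (eps_I v t m)) /\
  (forall t, has_moments (eta_th v t)) /\
  (forall t, has_moments (eta_I v t)) /\
  has_moments (eta_Q v).

Definition errors_centered : Prop :=
  forall j, ('E_P[errors j] = 0)%E.

Definition relevance : Prop :=
  (forall t : 'I_T.+1,
     (exists s : 'I_T, covariance P (ln_theta t) (ln_inv s) != 0%E) \/
     (exists2 s : 'I_T.+1, s != t &
        covariance P (ln_theta t) (ln_theta s) != 0%E)) /\
  (forall t : 'I_T,
     (exists s : 'I_T.+1, covariance P (ln_inv t) (ln_theta s) != 0%E) \/
     (exists2 s : 'I_T, s != t &
        covariance P (ln_inv t) (ln_inv s) != 0%E)).

Definition errors_char_fun_regular : Prop :=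
  forall j, char_fun_zeros_regular P (errors j).

(* [ball] on [R * R * R] is that of the sup-norm; having one in a set is the
   same as having a Euclidean one. *)
Definition support_contains_ball : Prop :=
  forall t : 'I_T, exists (c : R * R * R) (r : R), 0 < r /\
    ball c r `<=`
      law_support P (fun w => (theta v (cur t) w, inv v t w, Y v t w)).

Definition shocks_conditional_means : Prop :=
  (forall t : 'I_T, is_cond_expectation P
     (fun w => (theta v (cur t) w, Y v t w)) (eta_I v t) (fun=> 0)) /\
  (forall t : 'I_T, exists kappa : R, is_cond_expectation P
     (fun w => (theta v (cur t) w, eta_I v t w, Y v t w))
     (eta_th v t) (fun w => kappa * eta_I v t w)).

Record is_structure : Prop := IsStructure {
  str_admissible : admissible b;
  str_equations : model_equations;
  str_cond_independent : cond_errors_independent;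
  str_independent_of_Y : errors_independent_of_Y;
  str_moments : moment_conditions;
  str_centered : errors_centered;
  str_relevance : relevance;
  str_char_fun : errors_char_fun_regular;
  str_support : support_contains_ball;
  str_cond_means : shocks_conditional_means }.

End Structure.

Definition observationally_equivalent
    (d : measure_display) (Omega : measurableType d) (P : probability Omega R)
    (v : variables P)
    (d' : measure_display) (Omega' : measurableType d')
    (P' : probability Omega' R) (v' : variables P') : Prop :=
  forall S, measurable S ->
    P (observed_vec v @^-1` S) = P' (observed_vec v' @^-1` S).

Definition identified_set
    (d : measure_display) (Omega : measurableType d) (P : probability Omega R)
    (v : variables P) : set params :=
  [set b' | exists (d' : measure_display) (Omega' : measurableType d')
      (P' : probability Omega' R) (v' : variables P'),
      is_structure b' v' /\ observationally_equivalent v v'].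

End Model.

(* Main.v *)
Require Import Defs.
From HB Require Import structures.
From mathcomp Require Import all_boot all_order all_algebra.
From mathcomp Require Import all_classical all_reals all_analysis.
From mathcomp Require Import measurable_realfun ring lra.

Set Implicit Arguments.
Unset Strict Implicit.
Unset Printing Implicit Defensive.

Import Order.TTheory GRing.Theory Num.Theory.
Import numFieldNormedType.Exports.

Local Open Scope classical_set_scope.
Local Open Scope ring_scope.

(** The errors are independent of each other and of the skills, the investments
    and Y, so first and second moments of the measurements identify the
    relative loadings and intercepts, Q being a third measurement of the last
    skill. The other parameters solve linear moment equations in which the
    first measurements stand for the regressors and the second ones, whose errors
    are independent of theirs, for the instruments. Investment: instruments 1, the
    second measurement of skill, and ln Y. Production: conditionally on the
    second measurements and Y, the residual has mean zero; the instruments 1, the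
    second measurements, their product and ln Y then make two solutions differ
    by a translog function q of the latent variables with E[q^2] = 0, hence
    q = 0, as the support contains a ball. The product is an admissible
    instrument when the latent interaction is square-integrable, which the
    production equation gives as soon as its interaction coefficient is nonzero;
    if it is zero in both structures, q has no interaction term.
    Conversely, any parameters with the same transform come from the affine
    change of the log latent variables that preserves the first measurements. *)

(** * Moments and independence *)

(** Investment is endogenous: given skill, investment and Y, the production shock has conditional
    mean kappa eta_I with kappa unknown. It is controlled by kappa times the residual of the
    investment equation, which puts ln Y into the production regression with a coefficient
    proportional to kappa. As beta2 is nonzero and its transform is identified first, that
    coefficient gives kappa back, and then the production parameters.

    Only second moments are available, so the interaction of two measurements is merely integrable
    and an unbounded instrument could destroy integrability. The production moments are therefore
    stated against indicators of events, a form in which they carry over from one structure to the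
    other. The passage to unbounded instruments takes place inside one structure, for the difference
    q of two solutions. *)

Section Moments.
Context (R : realType) (d : measure_display) (Omega : measurableType d).
Variable P : probability Omega R.
Implicit Types X Y : Omega -> R.

Definition L1 X := P.-integrable setT (EFin \o X).
(** Measurability is required separately, since that of the square does not imply it. *)
Definition L2 X := measurable_fun setT X /\ L1 (fun w => X w ^+ 2).
(** A real number in all cases: an infinite integral is sent to 0. This is why the rules below carry
    integrability hypotheses. *)
Definition Ex X : R := \int[P]_w X w.

Lemma L1_meas X : L1 X -> measurable_fun setT X.
Proof. by move=> /measurable_int /measurable_EFinP. Qed.

Lemma L1_dom X Y : measurable_fun setT X -> (forall w, `|X w| <= Y w) ->
  L1 Y -> L1 X.
Proof.
move=> mX XY iY; apply: (le_integrable measurableT _ _ iY).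
  exact/measurable_EFinP.
by move=> w _ /=; rewrite lee_fin (le_trans (XY w))// ler_norm.
Qed.

Lemma L1_cst (c : R) : L1 (fun=> c).
Proof. exact: finite_measure_integrable_cst. Qed.

Lemma L1D X Y : L1 X -> L1 Y -> L1 (fun w => X w + Y w).
Proof. exact: integrableD. Qed.

Lemma L1B X Y : L1 X -> L1 Y -> L1 (fun w => X w - Y w).
Proof. exact: integrableB. Qed.

Lemma L1Z (c : R) X : L1 X -> L1 (fun w => c * X w).
Proof. by move=> iX; exact: (integrableZl measurableT c iX). Qed.

Lemma ExD X Y : L1 X -> L1 Y -> Ex (fun w => X w + Y w) = Ex X + Ex Y.
Proof. exact: RintegralD. Qed.

Lemma ExB X Y : L1 X -> L1 Y -> Ex (fun w => X w - Y w) = Ex X - Ex Y.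
Proof. exact: RintegralB. Qed.

Lemma ExZ (c : R) X : L1 X -> Ex (fun w => c * X w) = c * Ex X.
Proof. exact: RintegralZl. Qed.

Lemma Ex_cst (c : R) : Ex (fun=> c) = c.
Proof.
by have := expectation_cst P c; rewrite unlock /Ex /Rintegral => ->.
Qed.

Lemma eq_Ex X Y : X =1 Y -> Ex X = Ex Y.
Proof. by move=> XY; apply: eq_Rintegral => w _. Qed.

Lemma ae_eq_Ex X Y : measurable_fun setT X -> measurable_fun setT Y ->
  {ae P, forall w, X w = Y w} -> Ex X = Ex Y.
Proof.
move=> mX mY XY; congr fine; apply: ae_eq_integral => //.
- exact/measurable_EFinP.
- exact/measurable_EFinP.
- by apply: filterS XY => w /= ->.
Qed.

Lemma ae_eq_L1 X Y : measurable_fun setT Y ->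
  {ae P, forall w, X w = Y w} -> L1 X -> L1 Y.
Proof.
move=> mY XY iX; apply/integrableP; split; first exact/measurable_EFinP.
move/integrableP : (iX) => [mX]; apply: le_lt_trans.
rewrite le_eqVlt; apply/orP; left; apply/eqP; apply: ae_eq_integral => //.
- by apply: measurableT_comp => //; exact/measurable_EFinP.
- exact: measurableT_comp.
- by apply: filterS XY => w /= ->.
Qed.

Lemma Ex_sqr0 X : L2 X -> Ex (fun w => X w ^+ 2) = 0 ->
  {ae P, forall w, X w = 0}.
Proof.
move=> [mX iX] E0.
have : ae_eq P setT (fun w => (X w ^+ 2)%:E) (cst 0%E).
  apply/ae_eq_integral_abs => //.
    by apply/measurable_EFinP; exact: measurable_funX.
  have := E0; rewrite /Ex /Rintegral => /eqP.
  rewrite fine_eq0; last exact: integrable_fin_num.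
  move=> /eqP; under eq_integral => w _ do
    rewrite -[(X w ^+ 2)%:E]gee0_abs ?lee_fin ?sqr_ge0//.
  by [].
by apply: filterS => w /(_ I) [] /eqP; rewrite sqrf_eq0 => /eqP.
Qed.

Lemma L2_meas X : L2 X -> measurable_fun setT X. Proof. by case. Qed.

Lemma L2_mul X Y : L2 X -> L2 Y -> L1 (fun w => X w * Y w).
Proof.
move=> [mX iX] [mY iY].
apply: (L1_dom _ _ (L1D iX iY)); first exact: measurable_funM.
(* The bound |XY| <= X^2 + Y^2 follows from the two squares (X + Y)^2 and (X - Y)^2 being
   nonnegative. *)
move=> w /=; move: (sqr_ge0 (X w + Y w)) (sqr_ge0 (X w - Y w)).
by rewrite ler_norml => ? ?; apply/andP; split; nra.
Qed.

Lemma L2_L1 X : L2 X -> L1 X.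
Proof.
move=> [mX iX]; apply: (L1_dom _ _ (L1D (L1_cst 1) iX)) => //.
move=> w /=; move: (sqr_ge0 (1 + X w)) (sqr_ge0 (1 - X w)).
by rewrite ler_norml => ? ?; apply/andP; split; nra.
Qed.

Lemma L2_cst (c : R) : L2 (fun=> c).
Proof. by split => //; exact: L1_cst. Qed.

Lemma L2D X Y : L2 X -> L2 Y -> L2 (fun w => X w + Y w).
Proof.
move=> [mX iX] [mY iY].
have mXY : measurable_fun setT (fun w => X w + Y w) by exact: measurable_funD.
split => //; apply: (L1_dom _ _ (L1Z 2 (L1D iX iY))).
  exact: measurable_funX.
move=> w /=; move: (sqr_ge0 (X w - Y w)).
by rewrite (ger0_norm (sqr_ge0 _)) => ?; nra.
Qed.

Lemma L2Z (c : R) X : L2 X -> L2 (fun w => c * X w).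
Proof.
move=> [mX iX]; split; first exact: measurable_funM.
have := L1Z (c ^+ 2) iX; rewrite /L1; congr (_.-integrable _ _).
by apply/funext => w /=; rewrite exprMn.
Qed.

Lemma L2B X Y : L2 X -> L2 Y -> L2 (fun w => X w - Y w).
Proof.
move=> iX /(L2Z (-1)) iY; have := L2D iX iY.
by congr L2; apply/funext => w; rewrite mulN1r.
Qed.

Lemma L2_indic X (E : set Omega) : measurable E -> L2 X ->
  L2 (fun w => X w * \1_E w).
Proof.
move=> mE [mX iX].
have m : measurable_fun setT (fun w => X w * \1_E w) by exact: measurable_funM.
split => //; apply: (L1_dom _ _ iX); first exact: measurable_funX.
by move=> w /=; rewrite indicE; case: (w \in E);
  rewrite ?mulr1 ?mulr0 ?expr0n /= ?normr0 ?sqr_ge0// ger0_norm// sqr_ge0.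
Qed.

Lemma L1_indic X (E : set Omega) : measurable E -> L1 X ->
  L1 (fun w => X w * \1_E w).
Proof.
move=> mE iX; have mX := L1_meas iX.
have iX' : L1 (fun w => `|X w|) by exact: (integrable_abse iX).
apply: (L1_dom _ _ iX'); first exact: measurable_funM.
by move=> w /=; rewrite indicE; case: (w \in E); rewrite ?mulr1 ?mulr0 ?normr0.
Qed.

Lemma ae_eq_L2 X Y : measurable_fun setT Y ->
  {ae P, forall w, X w = Y w} -> L2 X -> L2 Y.
Proof.
move=> mY XY [mX iX]; split => //; apply: ae_eq_L1 iX.
  exact: measurable_funX.
by apply: filterS XY => w ->.
Qed.

End Moments.

(** * Expectations under independence *)

Section Independence.
Context (R : realType) (d : measure_display) (Omega : measurableType d).
Variable P : probability Omega R.
Context (d1 d2 : measure_display).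
Context (S1 : measurableType d1) (S2 : measurableType d2).
Variables (A : Omega -> S1) (B : Omega -> S2).
Hypotheses (mA : measurable_fun setT A) (mB : measurable_fun setT B).
HB.instance Definition _ := isMeasurableFun.Build _ _ _ _ A mA.
HB.instance Definition _ := isMeasurableFun.Build _ _ _ _ B mB.
Hypothesis AB : independent_rv P A B.

Let AxB := (fun w => (A w, B w)).
Let mAxB : measurable_fun setT AxB.
Proof. exact/measurable_fun_pair. Qed.
HB.instance Definition _ := isMeasurableFun.Build _ _ _ _ AxB mAxB.

Let law_pair (X : set (S1 * S2)) : measurable X ->
  (distribution P A \x distribution P B)%E X = distribution P AxB X.
Proof.
apply: product_measure_unique => E F mE mF.
by rewrite /= /distribution /pushforward -AB//; congr (P _).
Qed.

Let integrable_pair (F : S1 * S2 -> R) : measurable_fun setT F ->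
  L1 P (fun w => F (A w, B w)) ->
  (distribution P A \x distribution P B)%E.-integrable setT (EFin \o F).
Proof.
move=> mF iF; have mF' : measurable_fun setT (EFin \o F) by exact/measurable_EFinP.
have /integrableP[_ iF'] : (distribution P AxB).-integrable setT (EFin \o F).
  exact: integrable_pushforward.
apply/integrableP; split => //; apply: le_lt_trans iF'.
rewrite le_eqVlt; apply/orP; left; apply/eqP.
by apply: eq_measure_integral => X mX _; exact: law_pair.
Qed.

(** Fubini for the product law: the inner integral, over [B] with the value of [A] frozen, is 0
    everywhere. *)
Lemma indep_Ex0 (F : S1 * S2 -> R) : measurable_fun setT F ->
  L1 P (fun w => F (A w, B w)) ->
  (forall a, L1 P (fun w => F (a, B w)) /\ Ex P (fun w => F (a, B w)) = 0) ->
  Ex P (fun w => F (A w, B w)) = 0.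
Proof.
move=> mF iF F0; have mF' : measurable_fun setT (EFin \o F) by exact/measurable_EFinP.
have iF2 := integrable_pair mF iF.
suff : (\int[P]_w (F (A w, B w))%:E = 0)%E by rewrite /Ex /Rintegral => ->.
transitivity (\int[distribution P AxB]_z (F z)%:E)%E.
  by rewrite (integral_distribution (X := AxB)).
transitivity (\int[distribution P A \x distribution P B]_z (F z)%:E)%E.
  by apply: eq_measure_integral => X mX _; exact/esym/law_pair.
rewrite -(integral12_prod_meas1 iF2) integral0_eq// => a _.
have [iFa] := F0 a; rewrite /Ex /Rintegral => /eqP.
rewrite fine_eq0; last exact: integrable_fin_num.
move=> /eqP <-; rewrite /fubini_F.
rewrite (integral_distribution (X := B) (f := fun y => (F (a, y))%:E))//.
by apply/measurable_EFinP; apply: measurableT_comp mF _; exact: measurable_pair1.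
Qed.

(** Tonelli splits E|f(A) g(B)| into E|f(A)| E|g(B)|. This handles products of an error with a
    factor that is itself only a product of two square-integrable variables, beyond the reach of
    [L2_mul]. *)
Lemma indep_mul_L1 (f : S1 -> R) (g : S2 -> R) :
  measurable_fun setT f -> measurable_fun setT g ->
  L1 P (fun w => f (A w)) -> L1 P (fun w => g (B w)) ->
  L1 P (fun w => f (A w) * g (B w)).
Proof.
move=> mf mg ifA igB.
pose F := fun z : S1 * S2 => f z.1 * g z.2.
have mF : measurable_fun setT F.
  by apply: measurable_funM; apply: measurableT_comp.
have mF' : measurable_fun setT (EFin \o F) by exact/measurable_EFinP.
have mnF' : measurable_fun setT (abse \o (EFin \o F)) by exact: measurableT_comp.
apply/integrableP; split.
  by apply/measurable_EFinP; apply: measurable_funM; apply: measurableT_comp.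
have -> : (\int[P]_w `|(EFin \o (fun w => f (A w) * g (B w))%R) w| =
           \int[distribution P AxB]_z `|(F z)%:E|)%E.
  by rewrite (@ge0_integral_distribution _ _ _ _ _ P AxB (fun z => `|(F z)%:E|)%E).
have -> : (\int[distribution P AxB]_z `|(F z)%:E| =
           \int[distribution P A \x distribution P B]_z `|(F z)%:E|)%E.
  by apply: eq_measure_integral => X mX _; exact/esym/law_pair.
suff /integrableP[] : (distribution P A \x distribution P B)%E.-integrable setT
  (EFin \o F) by [].
apply/(integrable12ltyP _ _ mF').
have -> : (\int[distribution P A]_x \int[distribution P B]_y `|(EFin \o F) (x, y)| =
  \int[distribution P A]_x (`|(f x)%:E| * \int[distribution P B]_y `|(g y)%:E|))%E.
  apply: eq_integral => x _; rewrite -ge0_integralZl//; last first.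
    by apply: measurableT_comp => //; exact/measurable_EFinP.
  by apply: eq_integral => y _; rewrite /= normrM EFinM.
have iB : (\int[distribution P B]_y `|(g y)%:E| < +oo)%E.
  rewrite (@ge0_integral_distribution _ _ _ _ _ P B (fun y => `|(g y)%:E|%E))//.
    by case/integrableP : igB.
  by apply: measurableT_comp => //; exact/measurable_EFinP.
have iA : (\int[distribution P A]_y `|(f y)%:E| < +oo)%E.
  rewrite (@ge0_integral_distribution _ _ _ _ _ P A (fun y => `|(f y)%:E|%E))//.
    by case/integrableP : ifA.
  by apply: measurableT_comp => //; exact/measurable_EFinP.
have fB : (\int[distribution P B]_y `|(g y)%:E| \is a fin_num)%E.
  by rewrite ge0_fin_numE ?integral_ge0.
rewrite -(fineK fB) ge0_integralZr//.
- by rewrite lte_mul_pinfty// ?integral_ge0// ?ge0_fin_numE ?integral_ge0// ltry.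
- by apply: measurableT_comp => //; exact/measurable_EFinP.
- by rewrite lee_fin fine_ge0// integral_ge0.
Qed.

End Independence.

Section IndependentFactor.
Context (R : realType) (d : measure_display) (Omega : measurableType d).
Variable P : probability Omega R.
Context (d1 : measure_display) (S1 : measurableType d1).
Variables (A : Omega -> S1) (B : Omega -> R).
Hypotheses (mA : measurable_fun setT A) (AB : independent_rv P A B) (iB : L1 P B) (B0 : Ex P B = 0).

Lemma indep_err_L1 (f : S1 -> R) : measurable_fun setT f ->
  L1 P (fun w => f (A w)) -> L1 P (fun w => f (A w) * B w).
Proof. by move=> mf ifA; apply: (indep_mul_L1 mA (L1_meas iB) AB mf _ ifA (g := id)). Qed.

Lemma indep_err_Ex0 (f : S1 -> R) : measurable_fun setT f ->
  L1 P (fun w => f (A w)) -> Ex P (fun w => f (A w) * B w) = 0.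
Proof.
move=> mf ifA; apply: (indep_Ex0 mA (L1_meas iB) AB (F := fun z => f z.1 * z.2)).
- by apply: measurable_funM => //; exact: measurableT_comp.
- exact: indep_err_L1.
- by move=> a; split => /=; [exact: L1Z|rewrite ExZ// B0 mulr0].
Qed.

End IndependentFactor.

(** * Orthogonality to a generated sigma-algebra *)

Section Conditioning.
Context (R : realType) (d : measure_display) (Omega : measurableType d).
Variable P : probability Omega R.
Context (d1 : measure_display) (S : measurableType d1).
Variables (G : Omega -> S) (q : Omega -> R).
Hypotheses (mG : measurable_fun setT G) (iq : L1 P q).
Hypothesis q0 : forall B, measurable B -> Ex P (fun w => q w * \1_(G @^-1` B) w) = 0.

Let measG B : measurable B -> measurable (G @^-1` B).
Proof. by move=> mB; rewrite -[_ @^-1` _]setTI; exact: mG. Qed.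

Import HBNNSimple.

Let sfun_Ex0 (s : {nnsfun S >-> R}) :
  L1 P (fun w => q w * s (G w)) /\ Ex P (fun w => q w * s (G w)) = 0.
Proof.
have [r sE] : exists r : seq R,
    forall x, s x = \sum_(y <- r) (y * \1_(s @^-1` [set y]) x).
  by eexists => x; rewrite fimfunE fsbig_finite.
have -> : (fun w => q w * s (G w)) =
  (fun w => \sum_(y <- r) y * (q w * \1_(G @^-1` (s @^-1` [set y])) w)).
  by apply/funext => w; rewrite sE mulr_sumr; apply: eq_bigr => y _; rewrite mulrCA.
elim: r {sE} => [|y r [IHi IHe]].
  split; under eq_fun do rewrite big_nil.
    exact: L1_cst.
  exact: Ex_cst.
have mB : measurable (s @^-1` [set y]) by exact: measurable_sfunP.
have iB : L1 P (fun w => q w * \1_(G @^-1` (s @^-1` [set y])) w).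
  by apply: L1_indic => //; exact: measG.
split; under eq_fun do rewrite big_cons/=.
  by apply: L1D => //; exact: L1Z.
by rewrite ExD//; [rewrite IHe ExZ// q0// mulr0 addr0|exact: L1Z].
Qed.

Let ge0_Ex0 (g : S -> R) : measurable_fun setT g -> (forall x, 0 <= g x) ->
  L1 P (fun w => q w * g (G w)) -> Ex P (fun w => q w * g (G w)) = 0.
Proof.
move=> mg g0 iqg; have mg' : measurable_fun setT (EFin \o g) by exact/measurable_EFinP.
pose s := nnsfun_approx measurableT mg'.
have s_cvg x : s n x @[n --> \oo] --> g x.
  have g0' y : setT y -> (0 <= (EFin \o g) y)%E by rewrite lee_fin.
  exact: (fine_cvg (cvg_nnsfun_approx measurableT mg' g0' (I : setT x))).
have s_le n x : s n x <= g x.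
  have <- : limn (fun n => s n x) = g x by apply/cvg_lim => //; exact: s_cvg.
  apply: (@nondecreasing_cvgn_le _ (fun n => s n x)).
    by move=> m k mk; have /lefP := nd_nnsfun_approx measurableT mg' mk; exact.
  by apply/cvg_ex; exists (g x); exact: s_cvg.
(* |q g(G)| dominates the approximations, so only the product has to be integrable, not g(G). *)
have iabs : P.-integrable setT (fun w => (`|q w * g (G w)|)%:E).
  exact: (integrable_abse iqg).
have [] := @dominated_convergence _ _ _ P setT measurableT
  (fun n w => (q w * s n (G w))%:E) (fun w => (q w * g (G w))%:E)
  (fun w => (`|q w * g (G w)|)%:E) _ _ _ iabs _.
- by move=> n; exact: (measurable_int _ (sfun_Ex0 (s n)).1).
- exact: measurable_int iqg.
- apply: aeW => w _; apply: cvg_EFin; first exact: nearW.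
  by apply: cvgMl_tmp; exact: s_cvg.
- apply: aeW => w n _; rewrite lee_fin !normrM ler_wpM2l//.
  by rewrite ger0_norm ?ger0_norm// s_le.
- move=> _ _; rewrite (_ : [sequence _]_n = cst 0%E); last first.
    apply/funext => n /=; have [isn] := sfun_Ex0 (s n).
    by rewrite /Ex /Rintegral => /eqP; rewrite fine_eq0 ?integrable_fin_num// => /eqP.
  move=> /cvg_lim; rewrite lim_cst// => /(_ (@ereal_hausdorff R)) h.
  by rewrite /Ex /Rintegral -h.
Qed.

(** Orthogonality to indicators extends to simple functions, by dominated convergence to nonnegative
    ones, and by positive and negative parts to all [g] for which the product with [q] is
    integrable. This is what admits the interaction of two noisy measurements as an instrument. *)
Lemma sigma_orthogonal (g : S -> R) : measurable_fun setT g ->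
  L1 P (fun w => q w * g (G w)) -> Ex P (fun w => q w * g (G w)) = 0.
Proof.
move=> mg iqg; have mq := L1_meas iq.
have mgG (h : S -> R) : measurable_fun setT h -> measurable_fun setT (fun w => q w * h (G w)).
  by move=> mh; apply: measurable_funM => //; exact: measurableT_comp.
have iabs : L1 P (fun w => `|q w * g (G w)|) by exact: (integrable_abse iqg).
pose gp x := Num.max (g x) 0; pose gn x := Num.max (- g x) 0.
have mgp : measurable_fun setT gp by exact: measurable_maxr.
have mgn : measurable_fun setT gn.
  by apply: measurable_maxr => //; exact: measurableT_comp.
have igp : L1 P (fun w => q w * gp (G w)).
  apply: (L1_dom _ _ iabs); first exact: mgG.
  move=> w; rewrite !normrM ler_wpM2l// /gp; case: (leP (g (G w)) 0) => h.
    by rewrite normr0.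
  by [].
have ign : L1 P (fun w => q w * gn (G w)).
  apply: (L1_dom _ _ iabs); first exact: mgG.
  move=> w; rewrite !normrM ler_wpM2l// /gn; case: (leP (- g (G w)) 0) => h.
    by rewrite normr0.
  by rewrite normrN.
have -> : (fun w => q w * g (G w)) = (fun w => q w * gp (G w) - q w * gn (G w)).
  apply/funext => w; rewrite -mulrBr; congr (_ * _); rewrite /gp /gn.
  by case: (leP (g (G w)) 0) => h; case: (leP (- g (G w)) 0) => h'; lra.
rewrite ExB//.
rewrite !ge0_Ex0 ?subr0//.
- by move=> x; rewrite /gn le_max lexx orbT.
- by move=> x; rewrite /gp le_max lexx orbT.
Qed.

End Conditioning.

(** * Joint independence of the errors *)

Section ProductRule.
Context (R : realType) (d : measure_display) (Omega : measurableType d).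
Variable P : probability Omega R.

(** In [E], both sides are finite measures that agree on rectangles, a generating family stable
    under intersection. The event [W] will concern the remaining errors and [c] will be its
    probability. *)
Lemma product_rule_pair (d1 d2 : measure_display) (S1 : measurableType d1)
    (S2 : measurableType d2) (A : Omega -> S1) (B : Omega -> S2)
    (W : set Omega) (c : {nonneg R}) :
  measurable_fun setT A -> measurable_fun setT B -> measurable W ->
  (forall C D, measurable C -> measurable D ->
    P (A @^-1` C `&` B @^-1` D `&` W) =
      c%:num%:E * P (A @^-1` C `&` B @^-1` D))%E ->
  forall E, measurable E ->
    (P ((fun w => (A w, B w)) @^-1` E `&` W) =
      c%:num%:E * P ((fun w => (A w, B w)) @^-1` E))%E.
Proof.
move=> mA mB mW rect E mE.
pose f := fun w => (A w, B w).
have mf : measurable_fun setT f by exact/measurable_fun_pair.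
pose m1 : {measure set (S1 * S2)%type -> \bar R} := pushforward (mrestr P mW) f.
pose m2 : {measure set (S1 * S2)%type -> \bar R} := mscale c (pushforward P f).
rewrite -/f -[LHS]/(m1 mf E) -[RHS]/(m2 mf E).
apply: (measure_unique [set C `*` D | C in measurable & D in measurable]
  (fun=> setT)) => //.
- exact: measurable_prod_measurableType.
- move=> _ _ [C1 mC1 [D1 mD1 <-]] [C2 mC2 [D2 mD2 <-]].
  exists (C1 `&` C2); first exact: measurableI.
  exists (D1 `&` D2); first exact: measurableI.
  by rewrite setXI.
- by move=> _; exists setT => //; exists setT => //; rewrite setXTT.
- by rewrite bigcup_const.
- by move=> _ [C mC [D mD <-]]; exact: rect.
- move=> _; rewrite /m1 /= /pushforward preimage_setT /mrestr setTI.
  by rewrite ltey_eq fin_num_measure.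
Qed.

Section ErrorFamily.
Context (J : finType) (eps : J -> Omega -> R).
Hypothesis meps : forall j, measurable_fun setT (eps j).

Definition error_event (K : {set J}) (A : J -> set R) :=
  \bigcap_(j in [set j | j \in K]) eps j @^-1` A j.

(** The product rule for [M] and the errors indexed by [K] only. Errors outside [K] are
    unrestricted, so that they may be components of [M]: errors will be moved one at a time from [K]
    to [M]. *)
Definition independent_errors (d1 : measure_display) (S : measurableType d1)
    (M : Omega -> S) (K : {set J}) :=
  forall (D : set S) (A : J -> set R), measurable D ->
    (forall j, measurable (A j)) ->
    P (M @^-1` D `&` error_event K A) =
      ((\prod_(j in K) fine (P (eps j @^-1` A j)))%:E * P (M @^-1` D))%E.

Lemma measurable_eps j (A : set R) : measurable A -> measurable (eps j @^-1` A).
Proof. by move=> mA; rewrite -[_ @^-1` _]setTI; exact: meps. Qed.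

Lemma measurable_error_event K A : (forall j, measurable (A j)) ->
  measurable (error_event K A).
Proof.
by move=> mA; apply: fin_bigcap_measurable => // j _; exact: measurable_eps.
Qed.

Context (d1 : measure_display) (S : measurableType d1) (M : Omega -> S).
Hypothesis mM : measurable_fun setT M.

Lemma independent_errors_mem (K : {set J}) (j : J) :
  independent_errors M K -> j \in K ->
  forall D C A, measurable D -> measurable C -> (forall j, measurable (A j)) ->
  P (M @^-1` D `&` eps j @^-1` C `&` error_event (K :\ j) A) =
    ((fine (P (eps j @^-1` C)) *
      \prod_(i in K :\ j) fine (P (eps i @^-1` A i)))%:E * P (M @^-1` D))%E.
Proof.
move=> MK jK D C A mD mC mA.
(* The event on error [j] is put back into the family, so that the product rule over all of [K]
   applies. *)
pose A' i := if i == j then C else A i.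
have mA' i : measurable (A' i) by rewrite /A'; case: ifP.
have -> : M @^-1` D `&` eps j @^-1` C `&` error_event (K :\ j) A =
    M @^-1` D `&` error_event K A'.
  rewrite -setIA; congr (_ `&` _); apply/seteqP; split => w.
    move=> [Cw Aw] i /= iK; rewrite /A'; have [->//|ij] := eqVneq i j.
    by apply: Aw; rewrite /= !inE ij.
  move=> Aw; split.
    by have := Aw j jK; rewrite /A' /= eqxx.
  move=> i /=; rewrite !inE => /andP[ij iK].
  by have := Aw i iK; rewrite /A' /= (negPf ij).
rewrite MK// (big_setD1 j)//= /A' eqxx; congr (_%:E * _)%E; congr (_ * _).
by apply: eq_bigr => i; rewrite !inE => /andP[/negPf ->].
Qed.

Lemma independent_errors_indep (K : {set J}) (j : J) :
  independent_errors M K -> j \in K -> independent_rv P M (eps j).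
Proof.
move=> MK jK D C mD mC.
have := independent_errors_mem MK jK mD mC (fun=> measurableT).
rewrite (_ : error_event _ _ = setT) ?setIT; last first.
  by rewrite -subTset => w _ i _.
move=> ->; rewrite big1 ?mulr1; last by move=> i _; rewrite preimage_setT probability_setT.
by rewrite muleC fineK// fin_num_measure//; exact: measurable_eps.
Qed.

(** One error passes from the family to the conditioning vector. Iteration makes an error
    independent of the primitives and several other errors jointly, as products of errors
    require. *)
Lemma independent_errors_pair (K : {set J}) (j : J) :
  independent_errors M K -> j \in K ->
  independent_errors (fun w => (M w, eps j w)) (K :\ j).
Proof.
move=> MK jK E A mE mA.
have c0 : 0 <= \prod_(i in K :\ j) fine (P (eps i @^-1` A i)).
  by apply: prodr_ge0 => i _; rewrite fine_ge0.
rewrite (product_rule_pair (c := NngNum c0))//.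
  exact: measurable_error_event.
move=> D C mD mC; rewrite (independent_errors_mem MK)//.
rewrite (independent_errors_indep MK jK)//= EFinM -muleA muleCA; congr (_ * _)%E.
by rewrite muleC fineK// fin_num_measure//; exact: measurable_eps.
Qed.

End ErrorFamily.
End ProductRule.

(** * From conditional to unconditional independence *)

Section ConditionalIndependence.
Context (R : realType) (d : measure_display) (Omega : measurableType d).
Variable P : probability Omega R.

Lemma ge0_Ex0_ae (X : Omega -> R) : L1 P X -> (forall w, 0 <= X w) ->
  Ex P X = 0 -> {ae P, forall w, X w = 0}.
Proof.
move=> iX X0 E0.
have : ae_eq P setT (fun w => (X w)%:E) (cst 0%E).
  apply/ae_eq_integral_abs => //; first exact: measurable_int iX.
  move: E0; rewrite /Ex /Rintegral => /eqP.
  rewrite fine_eq0; last exact: integrable_fin_num.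
  move=> /eqP; under eq_integral => w _ do rewrite -[(X w)%:E]gee0_abs ?lee_fin//.
  by [].
by apply: filterS => w /(_ I) [].
Qed.

Context (d2 : measure_display) (S2 : measurableType d2) (G : Omega -> S2).
Hypothesis mG : measurable_fun setT G.

(** The events {q > p} and {q <= p} lie in the sigma-algebra of [G], so by independence q - p
    integrates to 0 over each of them. Their difference is the integral of |q - p|. *)
Lemma cond_prob_indep (X : Omega -> R) (A : set R) (q : Omega -> R) :
  measurable_fun setT X -> measurable A -> independent_rv P X G ->
  is_cond_probability P G (X @^-1` A) q ->
  {ae P, forall w, q w = fine (P (X @^-1` A))}.
Proof.
move=> mX mA XG [_ iq mq qE]; set p := fine _.
have mXA : measurable (X @^-1` A) by rewrite -[_ @^-1` _]setTI; exact: mX.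
have pE : (p%:E = P (X @^-1` A))%E by rewrite fineK// fin_num_measure.
have iq' : L1 P (fun w => q w - p) by apply: L1B => //; exact: L1_cst.
have E0 (I : set R) : measurable I ->
    L1 P (fun w => (q w - p) * \1_(q @^-1` I) w) /\
    Ex P (fun w => (q w - p) * \1_(q @^-1` I) w) = 0.
  move=> mI; have [B mB EB] := mq _ mI; rewrite setTI in EB.
  have mE : measurable (q @^-1` I).
    by rewrite -[_ @^-1` _]setTI; exact: (L1_meas iq).
  split; first exact: L1_indic.
  rewrite (_ : Ex _ _ = \int[P]_(w in q @^-1` I) (q w - p)); last first.
    rewrite [RHS]Rintegral_mkcond; apply: eq_Rintegral => w _.
    by rewrite patchE indicE; case: ifP; rewrite ?mulr1 ?mulr0.
  rewrite RintegralB//.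
  - apply/eqP; rewrite subr_eq0; apply/eqP.
    rewrite /Rintegral -qE; last by exists B => //; rewrite setTI.
    rewrite integral_indic// integral_cst//= pE.
    by rewrite -EB XG.
  - exact: integrableS iq.
  - by apply: integrableS (L1_cst P p).
have [i1 e1] := E0 _ (measurable_itv `]p, +oo[).
have [i2 e2] := E0 _ (measurable_itv `]-oo, p]).
have i3 : L1 P (fun w => `|q w - p|) by exact: (integrable_abse iq').
suff : {ae P, forall w, `|q w - p| = 0}.
  by apply: filterS => w /normr0P; rewrite subr_eq0 => /eqP.
apply: ge0_Ex0_ae => //.
rewrite -[RHS](subrr 0) -{1}e1 -e2 -ExB//; apply: eq_Ex => w.
have -> : \1_(q @^-1` `]p, +oo[) w = (p < q w)%R%:R :> R.
  by rewrite indicE; congr ((nat_of_bool _)%:R); apply/idP/idP; rewrite inE /= in_itv /= andbT.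
have -> : \1_(q @^-1` `]-oo, p]) w = (q w <= p)%R%:R :> R.
  by rewrite indicE; congr ((nat_of_bool _)%:R); apply/idP/idP; rewrite inE /= in_itv /=.
case: (ltP p (q w)) => h /=; rewrite ?mulr1 ?mulr0 ?subr0 ?sub0r.
  by rewrite gtr0_norm// subr_gt0.
by rewrite ler0_norm// subr_le0.
Qed.

Context (J : finType) (X : J -> Omega -> R).
Context (d1 : measure_display) (S1 : measurableType d1) (V : Omega -> S1).
Hypotheses (mX : forall j, measurable_fun setT (X j)) (mV : measurable_fun setT V).

(** Since each error is independent of [G], its conditional probabilities are constants, and the
    product of these leaves the integral over any event on [G]. Rectangles in (V, G) then
    suffice. *)
Lemma cond_indep_independent_errors :
  cond_mutually_independent P X V G -> (forall j, independent_rv P (X j) G) ->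
  independent_errors P X (fun w => (V w, G w)) [set: J].
Proof.
move=> VX XG E A mE mA.
have c0 : 0 <= \prod_(i in [set: J]%SET) fine (P (X i @^-1` A i)).
  by apply: prodr_ge0 => i _; rewrite fine_ge0.
apply: (product_rule_pair (c := NngNum c0)) => //.
  exact: measurable_error_event.
move=> C D mC mD /=.
have [q [qV [qP qVP qqP]]] := VX A C mA mC.
have mVC : measurable (V @^-1` C) by rewrite -[_ @^-1` _]setTI; exact: mV.
have mGD : measurable (G @^-1` D) by rewrite -[_ @^-1` _]setTI; exact: mG.
have mAA : measurable (\bigcap_(j in [set: J]) X j @^-1` A j).
  apply: fin_bigcap_measurable; first exact: finite_finset.
  by move=> j _; exact: measurable_eps.
have sGD : g_sigma_algebra_preimage G (G @^-1` D) by exists D => //; rewrite setTI.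
have [_ iqV _ qVE] := qVP; have [_ iqq _ qqE] := qqP.
have := qqE _ sGD; rewrite integral_indic//; last exact: measurableI.
have -> : ((\bigcap_(j in [set: J]) X j @^-1` A j) `&` V @^-1` C `&` G @^-1` D =
    V @^-1` C `&` G @^-1` D `&` error_event X [set: J]%SET A)%classic.
  rewrite -setIA setIC; congr (_ `&` _); apply/seteqP.
  by split => w Aw j _; apply: Aw => //=; rewrite inE.
move=> ->.
have := qVE _ sGD; rewrite integral_indic// => ->.
rewrite -integralZl//; last exact: integrableS iqV.
apply: ae_eq_integral => //.
- by apply: measurable_funS (measurable_int _ iqq).
- by apply: measurable_funeM; apply: measurable_funS (measurable_int _ iqV).
have : {ae P, forall w j, q j w = fine (P (X j @^-1` A j))}.
  by apply: filter_forall => j; apply: cond_prob_indep (qP j).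
apply: filterS => w qw _; rewrite EFinM; congr (_%:E * _)%E.
by apply: eq_big => [j|j _]; rewrite ?inE.
Qed.

End ConditionalIndependence.

(** Measurability with respect to [M] with an explicit factor function: expectations can then be
    computed under the joint law of [M] and an independent error, and stability under arithmetic is
    immediate. *)
Definition factors (d1 d2 : measure_display) (S1 : measurableType d1)
    (S2 : measurableType d2) (Omega : Type) (M : Omega -> S1) (X : Omega -> S2) :=
  exists2 f : S1 -> S2, measurable_fun setT f & forall w, X w = f (M w).

Section Factors.
Context (R : realType) (d1 : measure_display) (S : measurableType d1).
Context (Omega : Type) (M : Omega -> S).

Lemma factors_comp (d2 d3 : measure_display) (S2 : measurableType d2)
    (S3 : measurableType d3) (X : Omega -> S2) (g : S2 -> S3) :
  measurable_fun setT g -> factors M X -> factors M (fun w => g (X w)).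
Proof.
move=> mg [f mf Xf]; exists (g \o f); first exact: measurableT_comp.
by move=> w; rewrite Xf.
Qed.

Lemma factors_pair (d2 d3 : measure_display) (S2 : measurableType d2)
    (S3 : measurableType d3) (X : Omega -> S2) (Y : Omega -> S3) :
  factors M X -> factors M Y -> factors M (fun w => (X w, Y w)).
Proof.
move=> [f mf Xf] [g mg Yg]; exists (fun m => (f m, g m)).
  exact: measurable_fun_pair.
by move=> w; rewrite Xf Yg.
Qed.

Lemma factors_trans (d2 d3 : measure_display) (S2 : measurableType d2)
    (S3 : measurableType d3) (N : Omega -> S2) (X : Omega -> S3) :
  factors M N -> factors N X -> factors M X.
Proof.
move=> MN [f mf Xf]; have [g mg E] := factors_comp mf MN.
by exists g => // w; rewrite Xf E.
Qed.

Lemma factors_cst (c : R) : factors M (fun=> c).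
Proof. by exists (fun=> c). Qed.

Lemma factorsD (X Y : Omega -> R) :
  factors M X -> factors M Y -> factors M (fun w => X w + Y w).
Proof.
move=> [f mf Xf] [g mg Yg]; exists (fun m => f m + g m); first exact: measurable_funD.
by move=> w; rewrite Xf Yg.
Qed.

Lemma factorsB (X Y : Omega -> R) :
  factors M X -> factors M Y -> factors M (fun w => X w - Y w).
Proof.
move=> [f mf Xf] [g mg Yg]; exists (fun m => f m - g m); first exact: measurable_funB.
by move=> w; rewrite Xf Yg.
Qed.

Lemma factorsM (X Y : Omega -> R) :
  factors M X -> factors M Y -> factors M (fun w => X w * Y w).
Proof.
move=> [f mf Xf] [g mg Yg]; exists (fun m => f m * g m); first exact: measurable_funM.
by move=> w; rewrite Xf Yg.
Qed.

Lemma factors_indic (d2 : measure_display) (S2 : measurableType d2)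
    (G : Omega -> S2) (B : set S2) :
  measurable B -> factors M G -> factors M (\1_(G @^-1` B) : Omega -> R).
Proof.
move=> mB [f mf Gf]; exists (\1_(f @^-1` B)).
  by apply: measurable_indic; rewrite -[_ @^-1` _]setTI; exact: mf.
by move=> w; rewrite !indicE; congr ((nat_of_bool _)%:R);
  apply/idP/idP; rewrite !inE /= Gf.
Qed.

End Factors.

Lemma factors_measurable (d d1 d2 : measure_display) (Omega : measurableType d)
    (S1 : measurableType d1) (S2 : measurableType d2) (M : Omega -> S1)
    (X : Omega -> S2) :
  measurable_fun setT M -> factors M X -> measurable_fun setT X.
Proof.
move=> mM [f mf Xf]; rewrite (_ : X = f \o M); last exact/funext.
exact: measurableT_comp.
Qed.

Lemma measurable_preim (d d2 : measure_display) (Omega : measurableType d)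
    (S2 : measurableType d2) (G : Omega -> S2) (B : set S2) :
  measurable_fun setT G -> measurable B -> measurable (G @^-1` B).
Proof. by move=> mG mB; rewrite -[_ @^-1` _]setTI; exact: mG. Qed.

(** * Independent noise *)

Section Noise.
Context (R : realType) (d : measure_display) (Omega : measurableType d).
Variable P : probability Omega R.
Context (d1 : measure_display) (S : measurableType d1).
Variables (M : Omega -> S) (eps : Omega -> R).
Hypotheses (mM : measurable_fun setT M) (meps : measurable_fun setT eps).
Hypothesis Meps : independent_rv P M eps.

Lemma err_L1 (X : Omega -> R) : L1 P eps ->
  factors M X -> L1 P X -> L1 P (fun w => X w * eps w).
Proof.
move=> ieps [f mf Xf] iX.
have E : X = fun w => f (M w) by exact/funext.
by rewrite E; apply: indep_err_L1 => //; rewrite -E.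
Qed.

Lemma err_Ex0 (X : Omega -> R) : L1 P eps -> Ex P eps = 0 ->
  factors M X -> L1 P X -> Ex P (fun w => X w * eps w) = 0.
Proof.
move=> ieps eps0 [f mf Xf] iX.
have E : X = fun w => f (M w) by exact/funext.
by rewrite E; apply: indep_err_Ex0 => //; rewrite -E.
Qed.

(** Adding independent noise to the conditioning variables preserves orthogonality: at each frozen
    value of the error, the event is one on [G] alone, against which [u] integrates to 0. The
    general [phi] allows the noise to enter one coordinate only. *)
Lemma noisy_instrument (d2 d3 : measure_display) (S2 : measurableType d2)
    (S3 : measurableType d3) (u : Omega -> R) (G : Omega -> S2)
    (phi : S2 * R -> S3) :
  factors M u -> factors M G -> measurable_fun setT phi -> L1 P u ->
  (forall B, measurable B -> Ex P (fun w => u w * \1_(G @^-1` B) w) = 0) ->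
  forall B, measurable B ->
    Ex P (fun w => u w * \1_((fun w => phi (G w, eps w)) @^-1` B) w) = 0.
Proof.
move=> Mu MG mphi iu uG B mB.
have mG := factors_measurable mM MG.
have [fu mfu uE] := Mu; have [fG mfG GE] := MG.
pose F (z : R * S) : R := fu z.2 * \1_(phi @^-1` B) (fG z.2, z.1).
have FE w : u w * \1_((fun w => phi (G w, eps w)) @^-1` B) w = F (eps w, M w).
  by rewrite /F /= -uE -GE.
have Fs s w : F (s, M w) = u w * \1_(G @^-1` ((fun g => phi (g, s)) @^-1` B)) w.
  by rewrite /F /= -uE -GE.
have mphiB : measurable (phi @^-1` B) by rewrite -[_ @^-1` _]setTI; exact: mphi.
have mphis s : measurable_fun setT (fun g => phi (g, s)).
  by apply: measurableT_comp mphi _; exact: pair2_measurable.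
(* The error takes the first place in [indep_Ex0], hence is the variable that is frozen. *)
rewrite (eq_Ex _ FE); apply: (@indep_Ex0 _ _ _ P _ _ _ _ eps M) => //.
- by move=> C D mC mD; rewrite setIC Meps// muleC.
- apply: measurable_funM; first exact: measurableT_comp.
  apply: (measurableT_comp (f := \1_(phi @^-1` B) : S2 * R -> R)
    (g := fun z : R * S => (fG z.2, z.1))) => //.
  by apply/measurable_fun_pair => //; exact: measurableT_comp.
- rewrite -(funext FE); apply: L1_indic => //.
  apply: measurable_preim => //; apply: measurableT_comp => //.
  exact/measurable_fun_pair.
- move=> s; rewrite (funext (Fs s)); split.
    apply: L1_indic => //; apply: measurable_preim => //.
    by rewrite -[_ @^-1` _]setTI; exact: mphis.
  by apply: uG; rewrite -[_ @^-1` _]setTI; exact: mphis.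
Qed.

End Noise.

(** * Consequences of the model *)

Section StructureFacts.
Context (R : realType) (T : nat) (d : measure_display) (Omega : measurableType d).
Variables (P : probability Omega R) (b : params R T) (v : variables T P).

(** The vector of which every measurement error, and the shock of Q, is independent. *)
Definition primitives (w : Omega) := (latent_vec v w, Y_vec v w).

Lemma measurable_mktuple (n : nat) (d1 : measure_display) (S : measurableType d1)
    (f : 'I_n -> Omega -> S) :
  (forall i, measurable_fun setT (f i)) ->
  measurable_fun setT (fun w => [tuple f i w | i < n]).
Proof.
move=> mf; apply/measurable_fun_tnthP => i.
by rewrite (_ : _ \o _ = f i)//; apply/funext => w /=; rewrite tnth_mktuple.
Qed.

Lemma measurable_Y_vec : measurable_fun setT (Y_vec v).
Proof. by apply: measurable_mktuple => t; exact: measurable_funP. Qed.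

Lemma measurable_latent_vec : measurable_fun setT (latent_vec v).
Proof.
apply/measurable_fun_pair; apply: measurable_mktuple => t.
  exact: (measurable_funP (theta v t)).
exact: (measurable_funP (Defs.inv v t)).
Qed.

Lemma measurable_primitives : measurable_fun setT primitives.
Proof.
apply/measurable_fun_pair; [exact: measurable_latent_vec|exact: measurable_Y_vec].
Qed.

Lemma measurable_observed_vec : measurable_fun setT (observed_vec v).
Proof.
apply/measurable_fun_pair; last exact: measurable_funP.
apply/measurable_fun_pair.
  apply/measurable_fun_pair; first exact: measurable_Y_vec.
  by do 2 (apply: measurable_mktuple => ?); exact: measurable_funP.
by do 2 (apply: measurable_mktuple => ?); exact: measurable_funP.
Qed.

Lemma measurable_errors j : measurable_fun setT (errors v j).
Proof.
case: j => [[[t m]|[t m]]|[]] /=.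
- exact: (measurable_funP (eps_th v t m)).
- exact: (measurable_funP (eps_I v t m)).
- exact: (measurable_funP (eta_Q v)).
Qed.

Lemma factors_theta t : factors primitives (theta v t).
Proof.
exists (fun m => tnth m.1.1 t).
  apply: (measurableT_comp (f := fun s => tnth s t) (g := fun m => m.1.1)).
    exact: measurable_tnth.
  by apply: (measurableT_comp (f := fst) (g := fst)).
by move=> w /=; rewrite tnth_mktuple.
Qed.

Lemma factors_inv t : factors primitives (Defs.inv v t).
Proof.
exists (fun m => tnth m.1.2 t).
  apply: (measurableT_comp (f := fun s => tnth s t) (g := fun m => m.1.2)).
    exact: measurable_tnth.
  by apply: (measurableT_comp (f := snd) (g := fst)).
by move=> w /=; rewrite tnth_mktuple.
Qed.

Lemma factors_Y t : factors primitives (Y v t).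
Proof.
exists (fun m => tnth m.2 t).
  apply: (measurableT_comp (f := fun s => tnth s t) (g := snd)) => //.
  exact: measurable_tnth.
by move=> w /=; rewrite tnth_mktuple.
Qed.

Lemma factors_ln_theta t : factors primitives (ln_theta v t).
Proof. by apply: factors_comp (factors_theta t); exact: measurable_ln. Qed.

Lemma factors_ln_inv t : factors primitives (ln_inv v t).
Proof. by apply: factors_comp (factors_inv t); exact: measurable_ln. Qed.

Lemma factors_ln_Y t : factors primitives (ln_Y v t).
Proof. by apply: factors_comp (factors_Y t); exact: measurable_ln. Qed.

(* The Q equation is treated as a third measurement of the last skill. *)
Definition latent (k : error_index T) : Omega -> R :=
  match k with
  | inl (inl (t, _)) => ln_theta v t
  | inl (inr (t, _)) => ln_inv v t
  | inr tt => ln_theta v ord_max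
  end.

Definition intercept (k : error_index T) : R :=
  match k with
  | inl (inl (t, m)) => mu_th b t m
  | inl (inr (t, m)) => mu_I b t m
  | inr tt => rho0 b
  end.

Definition loading (k : error_index T) : R :=
  match k with
  | inl (inl (t, m)) => la_th b t m
  | inl (inr (t, m)) => la_I b t m
  | inr tt => rho1 b
  end.

Definition measurement (k : error_index T) : Omega -> R :=
  match k with
  | inl (inl (t, m)) => Z_th v t m
  | inl (inr (t, m)) => Z_I v t m
  | inr tt => Q v
  end.

Definition signal (k : error_index T) (w : Omega) : R :=
  intercept k + loading k * latent k w.

Lemma factors_latent k : factors primitives (latent k).
Proof.
by case: k => [[[t m]|[t m]]|[]] /=;
  [exact: factors_ln_theta|exact: factors_ln_inv|exact: factors_ln_theta].
Qed.

Lemma factors_signal k : factors primitives (signal k).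
Proof.
apply: factorsD; first exact: factors_cst.
by apply: factorsM; [exact: factors_cst|exact: factors_latent].
Qed.

Lemma measurable_measurement k : measurable_fun setT (measurement k).
Proof.
case: k => [[[t m]|[t m]]|[]] /=.
- exact: (measurable_funP (Z_th v t m)).
- exact: (measurable_funP (Z_I v t m)).
- exact: (measurable_funP (Q v)).
Qed.

Hypothesis hS : is_structure b v.

Lemma errors_independent : independent_errors P (errors v) primitives [set: error_index T].
Proof.
apply: cond_indep_independent_errors.
- exact: measurable_Y_vec.
- exact: measurable_errors.
- exact: measurable_latent_vec.
- exact: str_cond_independent hS.
- exact: str_independent_of_Y hS.
Qed.

Lemma L2_moments (X : Omega -> R) : has_moments P X -> L2 P X.
Proof.
move=> [_ X2]; split; last exact: Lfun2_integrable_sqr.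
by move: X2; rewrite inE => /andP[]; rewrite inE.
Qed.

Lemma L2_latent k : L2 P (latent k).
Proof.
have [mth [mI _]] := str_moments hS.
by case: k => [[[t m]|[t m]]|[]]; apply: L2_moments; [exact: mth|exact: mI|exact: mth].
Qed.

Lemma L2_errors k : L2 P (errors v k).
Proof.
have [_ [_ [_ [_ [_ [_ [eth [eI [_ [_ eQ]]]]]]]]]] := str_moments hS.
by case: k => [[[t m]|[t m]]|[]]; apply: L2_moments; [exact: eth|exact: eI|exact: eQ].
Qed.

Lemma L2_ln_Y t : L2 P (ln_Y v t).
Proof. by have [_ [_ [/(_ t)[_ ?] _]]] := str_moments hS; exact: L2_moments. Qed.

Lemma L2_eta_th t : L2 P (eta_th v t).
Proof.
by have [_ [_ [_ [_ [_ [_ [_ [_ [/(_ t) ? _]]]]]]]]] := str_moments hS; exact: L2_moments.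
Qed.

Lemma Ex_errors k : Ex P (errors v k) = 0.
Proof. by have := str_centered hS k; rewrite unlock /Ex /Rintegral => ->. Qed.

Lemma L2_signal k : L2 P (signal k).
Proof. by apply: L2D; [exact: L2_cst|apply: L2Z; exact: L2_latent]. Qed.

Lemma measurementE k : {ae P, forall w, measurement k w = signal k w + errors v k w}.
Proof.
have [_ [_ [_ [_ [Zth [ZI [_ ZQ]]]]]]] := str_equations hS.
by case: k => [[[t m]|[t m]]|[]]; [exact: Zth|exact: ZI|exact: ZQ].
Qed.

Lemma L2_measurement k : L2 P (measurement k).
Proof.
apply: (ae_eq_L2 (X := fun w => signal k w + errors v k w)).
- exact: measurable_measurement.
- by apply: filterS (measurementE k) => w ->.
- by apply: L2D; [exact: L2_signal|exact: L2_errors].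
Qed.

Lemma primitives_errors k : independent_rv P primitives (errors v k).
Proof.
apply: independent_errors_indep errors_independent _; last by rewrite inE.
exact: measurable_errors.
Qed.

Lemma pair_errors k j : j != k ->
  independent_rv P (fun w => (primitives w, errors v k w)) (errors v j).
Proof.
move=> jk; apply: (@independent_errors_indep _ _ _ _ _ _ measurable_errors _ _ _ ([set: error_index T] :\ k)).
  apply: independent_errors_pair => //.
  - exact: measurable_errors.
  - exact: measurable_primitives.
  - exact: errors_independent.
by rewrite !inE jk.
Qed.

Lemma Ex_latent_errors X k : factors primitives X -> L1 P X ->
  Ex P (fun w => X w * errors v k w) = 0.
Proof.
move=> fX iX; apply: err_Ex0 fX iX.
- exact: measurable_primitives.
- exact: primitives_errors.
- exact: L2_L1 (L2_errors k).
- exact: Ex_errors.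
Qed.

Lemma Ex_errors2 k j : k != j -> Ex P (fun w => errors v k w * errors v j w) = 0.
Proof.
move=> kj; rewrite eq_sym in kj.
apply: (err_Ex0 _ (pair_errors kj)).
- apply/measurable_fun_pair; [exact: measurable_primitives|exact: measurable_errors].
- exact: L2_L1 (L2_errors j).
- exact: Ex_errors.
- by exists snd.
- exact: L2_L1 (L2_errors k).
Qed.

Lemma Ex_measurement k : Ex P (measurement k) = Ex P (signal k).
Proof.
rewrite (ae_eq_Ex _ _ (measurementE k)).
- rewrite ExD ?Ex_errors ?addr0//; first exact: L2_L1 (L2_signal k).
  exact: L2_L1 (L2_errors k).
- exact: measurable_measurement.
- by apply: measurable_funD; [exact: L2_meas (L2_signal k)|exact: measurable_errors].
Qed.

(** Expanding the product, each of the three terms with an error vanishes, because some error in it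
    is independent of the other factor. With [k = j] the error variance would remain. *)
Lemma Ex_measurement2 k j : k != j ->
  Ex P (fun w => measurement k w * measurement j w) =
  Ex P (fun w => signal k w * signal j w).
Proof.
move=> kj.
have sk := L2_signal k; have sj := L2_signal j.
have ek := L2_errors k; have ej := L2_errors j.
transitivity (Ex P (fun w => signal k w * signal j w + signal k w * errors v j w
   + (signal j w * errors v k w + errors v k w * errors v j w))).
  apply: ae_eq_Ex.
  - by apply: measurable_funM; exact: measurable_measurement.
  - by apply: (@L1_meas _ _ _ P); apply: L1D; apply: L1D; apply: L2_mul.
  - apply: filterS2 (measurementE k) (measurementE j) => w -> ->.
    by ring.
rewrite !ExD; try (by repeat apply: L1D; apply: L2_mul).
rewrite (Ex_latent_errors j (factors_signal k) (L2_L1 sk)).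
rewrite (Ex_latent_errors k (factors_signal j) (L2_L1 sj)).
by rewrite Ex_errors2// !addr0.
Qed.

End StructureFacts.

(** One regression function for both equations: investment has c3 = 0, and ln Y enters the
    production regression through the investment residual used as a control. *)
Definition translog (R : realType) (c0 c1 c2 c3 c4 x w y : R) : R :=
  c0 + c1 * x + c2 * w + c3 * (x * w) + c4 * y.

(** * Regressors and instruments measured with error *)

Section NoiseReduction.
Context (R : realType) (T : nat) (d : measure_display) (Omega : measurableType d).
Variables (P : probability Omega R) (b : params R T) (v : variables T P).
Hypothesis hS : is_structure b v.

Local Notation eps := (errors v).
Local Notation prim := (primitives v).
Local Notation sg := (signal b v).
Local Notation Z := (measurement v).

(** A version of the measurement that is everywhere a function of the primitives and its error; the
    measurement equation itself holds only almost surely. *)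
Definition noisy (k : error_index T) (w : Omega) := sg k w + eps k w.

(** [i1] and [j1] index the measurements that stand for the regressors, [i2] and [j2] those that
    serve as instruments. *)
Variables (i1 i2 j1 j2 : error_index T).
Hypothesis ij : [/\ i1 != j1, i1 != i2 & i1 != j2] /\ [/\ j1 != i2, j1 != j2 & i2 != j2].

(** The errors of the instruments join the primitives, so that the instruments are functions of this
    vector while the regressor errors remain independent of it. *)
Definition noisy_prim (w : Omega) := ((prim w, eps i2 w), eps j2 w).

Let mprim := measurable_primitives v.
Let meps := measurable_errors v.

Lemma measurable_noisy_prim : measurable_fun setT noisy_prim.
Proof. by do 2 (apply/measurable_fun_pair => //). Qed.

Lemma noisy_prim_independent :
  independent_errors P eps noisy_prim ([set: error_index T] :\ i2 :\ j2).
Proof.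
have [[i1j1 i12 i1j2] [j1i2 j1j2 i2j2]] := ij.
apply: independent_errors_pair => //.
- by apply/measurable_fun_pair.
- by apply: independent_errors_pair => //; exact: errors_independent hS.
- by rewrite !inE eq_sym i2j2.
Qed.

Lemma noisy_prim_err k : k != i2 -> k != j2 -> independent_rv P noisy_prim (eps k).
Proof.
move=> ki kj; apply: independent_errors_indep noisy_prim_independent _ => //.
by rewrite !inE ki kj.
Qed.

(** The interaction of the two regressors creates the product of their errors; this independence
    gives it mean zero. *)
Lemma noisy_prim_err2 :
  independent_rv P (fun w => (noisy_prim w, eps j1 w)) (eps i1).
Proof.
have [[i1j1 i12 i1j2] [j1i2 j1j2 i2j2]] := ij.
apply: (@independent_errors_indep _ _ _ _ _ _ meps _ _ _
  ([set: error_index T] :\ i2 :\ j2 :\ j1)).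
  apply: independent_errors_pair => //; first exact: measurable_noisy_prim.
    exact: noisy_prim_independent.
  by rewrite !inE j1i2 j1j2.
by rewrite !inE i1j1 i12 i1j2.
Qed.

Lemma factors_prim_noisy (d1 : measure_display) (S : measurableType d1)
    (X : Omega -> S) : factors prim X -> factors noisy_prim X.
Proof.
apply: factors_trans; exists (fun m => m.1.1) => //.
by apply: (measurableT_comp (f := fst) (g := fst)).
Qed.

Lemma factors_noisy_i2 : factors noisy_prim (noisy i2).
Proof.
apply: factorsD; first exact/factors_prim_noisy/factors_signal.
by exists (fun m => m.1.2) => //; apply: (measurableT_comp (f := snd) (g := fst)).
Qed.

Lemma factors_noisy_j2 : factors noisy_prim (noisy j2).
Proof.
apply: factorsD; first exact/factors_prim_noisy/factors_signal.
by exists snd.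
Qed.

Lemma Ex_noisy_err k X : k != i2 -> k != j2 -> factors noisy_prim X -> L1 P X ->
  Ex P (fun w => X w * eps k w) = 0.
Proof.
move=> ki kj fX iX; apply: err_Ex0 fX iX.
- exact: measurable_noisy_prim.
- exact: noisy_prim_err.
- exact: L2_L1 (L2_errors hS k).
- exact: Ex_errors hS k.
Qed.

Lemma L2_noisy k : L2 P (noisy k).
Proof. by apply: L2D; [exact: L2_signal|exact: L2_errors hS k]. Qed.

Lemma noisyE k : {ae P, forall w, Z k w = noisy k w}.
Proof. exact: measurementE. Qed.

Variables (t : 'I_T).

Definition instruments (w : Omega) := (noisy i2 w, noisy j2 w, Y v t w).
Definition obs_instruments (w : Omega) := (Z i2 w, Z j2 w, Y v t w).

Lemma factors_instruments : factors noisy_prim instruments.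
Proof.
apply: factors_pair; last exact/factors_prim_noisy/factors_Y.
by apply: factors_pair; [exact: factors_noisy_i2|exact: factors_noisy_j2].
Qed.

Lemma measurable_instruments : measurable_fun setT instruments.
Proof. exact: factors_measurable measurable_noisy_prim factors_instruments. Qed.

Lemma measurable_obs_instruments : measurable_fun setT obs_instruments.
Proof.
apply/measurable_fun_pair; last exact: (measurable_funP (Y v t)).
by apply/measurable_fun_pair; exact: measurable_measurement.
Qed.

Lemma obs_instrumentsE (B : set (R * R * R)) :
  {ae P, forall w, \1_(obs_instruments @^-1` B) w = \1_(instruments @^-1` B) w :> R}.
Proof.
apply: filterS2 (noisyE i2) (noisyE j2) => w E1 E2.
rewrite !indicE; congr ((nat_of_bool _)%:R).
by apply/idP/idP; rewrite !inE /= /obs_instruments /instruments E1 E2.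
Qed.

Let L2lnY := L2_ln_Y hS t.

Lemma L1_translog c0 c1 c2 c3 c4 (X W : Omega -> R) : L2 P X -> L2 P W ->
  L1 P (fun w => translog c0 c1 c2 c3 c4 (X w) (W w) (ln_Y v t w)).
Proof.
move=> X2 W2; apply: L1D; last exact/L1Z/L2_L1.
apply: L1D; last exact/L1Z/L2_mul.
apply: L2_L1; apply: L2D; last exact: L2Z.
by apply: L2D; [exact: L2_cst|exact: L2Z].
Qed.

(** The indicator depends on the primitives and the instrument errors only. The regressor errors are
    centred and independent of these and of each other, so every term containing one drops out,
    including their product. An indicator keeps all terms integrable although the interaction is
    only integrable. *)
Lemma translog_noise_reduction c0 c1 c2 c3 c4 (B : set (R * R * R)) : measurable B ->
  Ex P (fun w => translog c0 c1 c2 c3 c4 (Z i1 w) (Z j1 w) (ln_Y v t w)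
                 * \1_(obs_instruments @^-1` B) w) =
  Ex P (fun w => translog c0 c1 c2 c3 c4 (sg i1 w) (sg j1 w) (ln_Y v t w)
                 * \1_(instruments @^-1` B) w).
Proof.
move=> mB.
have [[i1j1 i12 i1j2] [j1i2 j1j2 i2j2]] := ij.
pose I : Omega -> R := \1_(instruments @^-1` B).
have mI : measurable (instruments @^-1` B).
  exact: measurable_preim measurable_instruments mB.
have fI : factors noisy_prim I by apply: factors_indic factors_instruments.
have s1 := L2_signal hS i1; have s2 := L2_signal hS j1.
have e1 := L2_errors hS i1; have e2 := L2_errors hS j1.
have fs k : factors noisy_prim (sg k) by apply/factors_prim_noisy/factors_signal.
have I2 : L2 P I.
  by have := L2_indic mI (L2_cst P 1); congr L2; apply/funext => w; rewrite mul1r.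
have sI k : L2 P (fun w => sg k w * I w) by apply: L2_indic => //; exact: L2_signal.
have eI : L2 P (fun w => I w * eps j1 w).
  by have := L2_indic mI e2; congr L2; apply/funext => w; rewrite mulrC.
transitivity (Ex P (fun w => translog c0 c1 c2 c3 c4 (sg i1 w) (sg j1 w) (ln_Y v t w) * I w
   + (c1 * (I w * eps i1 w) + c2 * (I w * eps j1 w)
      + c3 * (sg i1 w * I w * eps j1 w + sg j1 w * I w * eps i1 w
              + I w * eps j1 w * eps i1 w)))).
  apply: ae_eq_Ex.
  - apply: measurable_funM; last first.
      apply: measurable_indic.
      exact: measurable_preim measurable_obs_instruments mB.
    by apply: (@L1_meas _ _ _ P); apply: L1_translog; exact: L2_measurement hS _.
  - apply: (@L1_meas _ _ _ P); apply: L1D.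
      by apply: L1_indic => //; exact: L1_translog.
    by repeat apply: L1D; apply: L1Z; repeat apply: L1D; apply: L2_mul.
  - apply: filterS3 (noisyE i1) (noisyE j1) (obs_instrumentsE B) => w -> -> ->.
    by rewrite /noisy /translog -/I; ring.
have Ie k : k != i2 -> k != j2 -> Ex P (fun w => I w * eps k w) = 0.
  by move=> ki kj; apply: Ex_noisy_err => //; exact: L2_L1.
have sIe k l : l != i2 -> l != j2 -> Ex P (fun w => sg k w * I w * eps l w) = 0.
  by move=> ki kj; apply: Ex_noisy_err => //; [exact: factorsM|exact: L2_L1].
have Iee : Ex P (fun w => I w * eps j1 w * eps i1 w) = 0.
  apply: (err_Ex0 _ noisy_prim_err2).
  - by apply/measurable_fun_pair => //; exact: measurable_noisy_prim.
  - exact: L2_L1.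
  - exact: Ex_errors hS i1.
  - apply: factorsM; last by exists snd.
    by apply: factors_trans fI; exists fst.
  - exact: L2_L1.
have i_I k : L1 P (fun w => I w * eps k w) by apply: L2_mul => //; exact: L2_errors hS k.
have i_s k l : L1 P (fun w => sg k w * I w * eps l w).
  by apply: L2_mul => //; exact: L2_errors hS l.
have i_e : L1 P (fun w => I w * eps j1 w * eps i1 w) by exact: L2_mul.
have i_q : L1 P (fun w => translog c0 c1 c2 c3 c4 (sg i1 w) (sg j1 w) (ln_Y v t w) * I w).
  by apply: L1_indic => //; exact: L1_translog.
have i1' := L1D (L1D (i_s i1 j1) (i_s j1 i1)) i_e.
have i2' := L1D (L1Z c1 (i_I i1)) (L1Z c2 (i_I j1)).
rewrite (ExD i_q (L1D i2' (L1Z c3 i1'))) (ExD i2' (L1Z c3 i1')).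
rewrite (ExD (L1Z c1 (i_I i1)) (L1Z c2 (i_I j1))) (ExZ c1 (i_I i1)) (ExZ c2 (i_I j1)).
rewrite (ExZ c3 i1') (ExD (L1D (i_s i1 j1) (i_s j1 i1)) i_e) (ExD (i_s i1 j1) (i_s j1 i1)).
by rewrite !Ie// !sIe// Iee !(addr0, mulr0).
Qed.

End NoiseReduction.

(** * Residuals of the investment and production equations *)

Section Shocks.
Context (R : realType) (T : nat) (d : measure_display) (Omega : measurableType d).
Variables (P : probability Omega R) (b : params R T) (v : variables T P).
Hypothesis hS : is_structure b v.

(** The residuals agree with the shocks almost surely, but are by construction functions of the
    primitives, and so independent of the errors. *)
Definition shock_I (t : 'I_T) (w : Omega) : R :=
  ln_inv v t w - (beta0 b t + beta1 b t * ln_theta v (cur t) w + beta2 b t * ln_Y v t w).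

Definition shock_th (t : 'I_T) (w : Omega) : R :=
  ln_theta v (nxt t) w - (a_ b t + gamma1 b t * ln_theta v (cur t) w
    + gamma2 b t * ln_inv v t w + gamma3 b t * ln_theta v (cur t) w * ln_inv v t w).

Lemma shock_IE t : {ae P, forall w, shock_I t w = eta_I v t w}.
Proof.
have [_ [_ [_ [_ [_ [_ [/(_ t) E _]]]]]]] := str_equations hS.
by apply: filterS E => w E; rewrite /shock_I E; ring.
Qed.

Lemma shock_thE t : {ae P, forall w, shock_th t w = eta_th v t w}.
Proof.
have [_ [_ [_ [/(_ t) E _]]]] := str_equations hS.
by apply: filterS E => w E; rewrite /shock_th E; ring.
Qed.

Let Lth t : L2 P (ln_theta v t) := L2_latent hS (inl (inl (t, m1))).
Let LI t : L2 P (ln_inv v t) := L2_latent hS (inl (inr (t, m1))).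
Let LY t := L2_ln_Y hS t.

Lemma L2_shock_I t : L2 P (shock_I t).
Proof.
apply: L2B => //; apply: L2D; last exact: L2Z.
by apply: L2D; [exact: L2_cst|exact: L2Z].
Qed.

Lemma factors_shock_I t : factors (primitives v) (shock_I t).
Proof.
apply: factorsB; first exact: factors_ln_inv.
apply: factorsD; last by apply: factorsM; [exact: factors_cst|exact: factors_ln_Y].
apply: factorsD; first exact: factors_cst.
by apply: factorsM; [exact: factors_cst|exact: factors_ln_theta].
Qed.

Lemma factors_shock_th t : factors (primitives v) (shock_th t).
Proof.
have fc c : factors (primitives v) (fun=> c : R) by exact: factors_cst.
have fth := factors_ln_theta v; have fI := factors_ln_inv v.
by apply: factorsB => //; repeat apply: factorsD => //; repeat apply: factorsM => //.
Qed.

Lemma L2_shock_th t : L2 P (shock_th t).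
Proof.
apply: (ae_eq_L2 (X := eta_th v t)).
- exact: factors_measurable (measurable_primitives v) (factors_shock_th t).
- by apply: filterS (shock_thE t) => w ->.
- exact: L2_eta_th hS t.
Qed.

Lemma L2_interaction t : gamma3 b t != 0 ->
  L2 P (fun w => ln_theta v (cur t) w * ln_inv v t w).
Proof.
move=> g0.
have -> : (fun w => ln_theta v (cur t) w * ln_inv v t w) = (fun w => (gamma3 b t)^-1 *
  (ln_theta v (nxt t) w - (a_ b t + gamma1 b t * ln_theta v (cur t) w
    + gamma2 b t * ln_inv v t w) - shock_th t w)).
  by apply/funext => w; rewrite /shock_th; field.
apply: L2Z; apply: L2B; last exact: L2_shock_th.
apply: L2B => //; apply: L2D; last exact: L2Z.
by apply: L2D; [exact: L2_cst|exact: L2Z].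
Qed.

Lemma sigma_Ex0 (d1 : measure_display) (S : measurableType d1) (G : Omega -> S)
    (X W : Omega -> R) :
  measurable_fun setT G -> is_cond_expectation P G X W ->
  forall B, measurable B -> Ex P (fun w => (X w - W w) * \1_(G @^-1` B) w) = 0.
Proof.
move=> mG [iX iW mW XW] B mB.
have mGB := measurable_preim mG mB.
have -> : Ex P (fun w => (X w - W w) * \1_(G @^-1` B) w) =
    \int[P]_(w in G @^-1` B) (X w - W w).
  rewrite [RHS]Rintegral_mkcond; apply: eq_Rintegral => w _.
  by rewrite patchE indicE; case: ifP; rewrite ?mulr1 ?mulr0.
rewrite RintegralB//; last 2 first.
- exact: integrableS iX.
- exact: integrableS iW.
by rewrite /Rintegral XW ?subrr//; exists B => //; rewrite setTI.
Qed.

Lemma shock_I_orthogonal t (g : R * R -> R) : measurable_fun setT g ->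
  L2 P (fun w => g (theta v (cur t) w, Y v t w)) ->
  Ex P (fun w => shock_I t w * g (theta v (cur t) w, Y v t w)) = 0.
Proof.
move=> mg g2.
have mG : measurable_fun setT (fun w => (theta v (cur t) w, Y v t w)).
  apply/measurable_fun_pair; first exact: (measurable_funP (theta v (cur t))).
  exact: (measurable_funP (Y v t)).
have s2 := L2_shock_I t.
apply: (sigma_orthogonal mG) => //; [exact: L2_L1| |exact: L2_mul].
move=> B mB; rewrite -[RHS](sigma_Ex0 mG ((str_cond_means hS).1 t) mB).
have mGB := measurable_preim mG mB.
apply: ae_eq_Ex.
- by apply: measurable_funM; [exact: L2_meas s2|exact: measurable_indic].
- apply: measurable_funM; last exact: measurable_indic.
  by apply: measurable_funB => //; exact: (measurable_funP (eta_I v t)).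
- by apply: filterS (shock_IE t) => w ->; rewrite subr0.
Qed.

(** The investment equation recovers ln I from (theta, eta_I, Y), so events on (ln theta, ln I, Y)
    are, up to null sets, events on the conditioning variables of the production shock. Once kappa
    eta_I is subtracted, the rest is orthogonal even to the endogenous investment. *)
Lemma shocks_orthogonal t : exists kappa : R, forall B : set (R * R * R), measurable B ->
  Ex P (fun w => (shock_th t w - kappa * shock_I t w) *
    \1_((fun w => (ln_theta v (cur t) w, ln_inv v t w, Y v t w)) @^-1` B) w) = 0.
Proof.
have [kappa kE] := (str_cond_means hS).2 t; exists kappa => B mB.
set G := fun w => (ln_theta v (cur t) w, ln_inv v t w, Y v t w).
pose G' w := (theta v (cur t) w, eta_I v t w, Y v t w).
have mY : measurable_fun setT (Y v t) by exact: (measurable_funP (Y v t)).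
have mth : measurable_fun setT (theta v (cur t)).
  exact: (measurable_funP (theta v (cur t))).
have mG' : measurable_fun setT G'.
  by do 2 (apply/measurable_fun_pair => //).
have mG : measurable_fun setT G.
  apply/measurable_fun_pair => //; apply/measurable_fun_pair.
    exact: L2_meas (Lth _).
  exact: L2_meas (LI _).
(* The investment equation as a map from (theta, eta_I, Y) to (ln theta, ln I, Y). *)
pose psi (z : R * R * R) := (ln z.1.1,
  beta0 b t + beta1 b t * ln z.1.1 + beta2 b t * ln z.2 + z.1.2, z.2).
have mpsi : measurable_fun setT psi.
  have m11 : measurable_fun setT (fun z : R * R * R => ln z.1.1).
    apply: (measurableT_comp (measurable_ln (R := R)) (g := fun z => z.1.1)).
    exact: (measurableT_comp (f := fst) (g := fst)).
  have m2 : measurable_fun setT (fun z : R * R * R => ln z.2).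
    exact: (measurableT_comp (measurable_ln (R := R)) (g := snd)).
  have m12 : measurable_fun setT (fun z : R * R * R => z.1.2).
    exact: (measurableT_comp (f := snd) (g := fst)).
  apply/measurable_fun_pair => //; apply/measurable_fun_pair => //.
  apply: measurable_funD => //; apply: measurable_funD; last exact: measurable_funM.
  by apply: measurable_funD => //; exact: measurable_funM.
have mB' : measurable (psi @^-1` B) by exact: measurable_preim.
rewrite -[RHS](sigma_Ex0 mG' kE mB').
have mGB := measurable_preim mG mB; have mGB' := measurable_preim mG' mB'.
apply: ae_eq_Ex.
- apply: measurable_funM; last exact: measurable_indic.
  apply: measurable_funB; first exact: L2_meas (L2_shock_th t).
  by apply: measurable_funM => //; exact: L2_meas (L2_shock_I t).
- apply: measurable_funM; last exact: measurable_indic.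
  apply: measurable_funB; first exact: (measurable_funP (eta_th v t)).
  by apply: measurable_funM => //; exact: (measurable_funP (eta_I v t)).
- apply: filterS2 (shock_IE t) (shock_thE t) => w EI ->; rewrite EI.
  congr (_ * _); rewrite !indicE; congr ((nat_of_bool _)%:R).
  have GE : G w = psi (G' w).
    by rewrite /G /psi /G' /= -EI /shock_I; congr (_, _, _); rewrite /ln_theta /ln_Y; ring.
  by apply/idP/idP; rewrite !inE /= GE.
Qed.

(** The two latent logs are replaced by their second measurements one at a time. The second
    replacement works over the primitives enlarged by the error of the first. *)
Lemma noisy_shocks_orthogonal t : exists kappa : R, forall B : set (R * R * R),
  measurable B ->
  Ex P (fun w => (shock_th t w - kappa * shock_I t w) *
    \1_(instruments b v (inl (inl (cur t, ord_max))) (inl (inr (t, ord_max))) t @^-1` B) w)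
  = 0.
Proof.
have [kappa kE] := shocks_orthogonal t; exists kappa => B mB.
pose i2 : error_index T := inl (inl (cur t, ord_max)).
pose j2 : error_index T := inl (inr (t, ord_max)).
set u := fun w => shock_th t w - kappa * shock_I t w.
have fu : factors (primitives v) u.
  apply: factorsB; first exact: factors_shock_th.
  by apply: factorsM; [exact: factors_cst|exact: factors_shock_I].
have iu : L1 P u.
  by apply: L2_L1; apply: L2B; [exact: L2_shock_th|apply: L2Z; exact: L2_shock_I].
pose phi1 (z : R * R * R * R) := 
  (intercept b i2 + loading b i2 * z.1.1.1 + z.2, z.1.1.2, z.1.2).
have m11 : measurable_fun setT (fun z : R * R * R * R => z.1.1).
  exact: (measurableT_comp (f := fst) (g := fst)).
have m111 : measurable_fun setT (fun z : R * R * R * R => z.1.1.1).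
  exact: (measurableT_comp (f := fst) (g := fun z => z.1.1)).
have m112 : measurable_fun setT (fun z : R * R * R * R => z.1.1.2).
  exact: (measurableT_comp (f := snd) (g := fun z => z.1.1)).
have m12 : measurable_fun setT (fun z : R * R * R * R => z.1.2).
  exact: (measurableT_comp (f := snd) (g := fst)).
have mphi1 : measurable_fun setT phi1.
  apply/measurable_fun_pair => //; apply/measurable_fun_pair => //.
  apply: measurable_funD => //; apply: measurable_funD => //.
  exact: measurable_funM.
pose phi2 (z : R * R * R * R) :=
  (z.1.1.1, intercept b j2 + loading b j2 * z.1.1.2 + z.2, z.1.2).
have mphi2 : measurable_fun setT phi2.
  apply/measurable_fun_pair => //; apply/measurable_fun_pair => //.
  apply: measurable_funD => //; apply: measurable_funD => //.
  exact: measurable_funM.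
have fG : factors (primitives v) (fun w => (ln_theta v (cur t) w, ln_inv v t w, Y v t w)).
  apply: factors_pair; last exact: factors_Y.
  by apply: factors_pair; [exact: factors_ln_theta|exact: factors_ln_inv].
have N1 := noisy_instrument (measurable_primitives v) (measurable_errors v (i2))
  (primitives_errors hS i2) fu fG mphi1 iu kE.
have mN : measurable_fun setT (fun w => (primitives v w, errors v i2 w)).
  by apply/measurable_fun_pair; [exact: measurable_primitives|exact: measurable_errors].
have ij : j2 != i2 by [].
have fN (d1 : measure_display) (S : measurableType d1) (X : Omega -> S) :
    factors (primitives v) X -> factors (fun w => (primitives v w, errors v i2 w)) X.
  by apply: factors_trans; exists fst.
apply: (noisy_instrument mN (measurable_errors v (j2)) (pair_errors hS ij)
  (fN _ _ _ fu) _ mphi2 iu N1 mB).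
apply: factors_comp mphi1 _.
apply: factors_pair; first exact: fN.
by exists snd.
Qed.

End Shocks.

(** * Supports *)

Section Support.
Context (R : realType) (d : measure_display) (Omega : measurableType d).
Variable P : probability Omega R.

Lemma ball3E (x y : R * R * R) (e : R) :
  ball x e y <-> [/\ ball x.1.1 e y.1.1, ball x.1.2 e y.1.2 & ball x.2 e y.2].
Proof.
by case: x y => [[x1 x2] x3] [[y1 y2] y3]; split => [[[]]|[]].
Qed.

Lemma open_box (A B C : set R) : open A -> open B -> open C ->
  open [set y : R * R * R | [/\ A y.1.1, B y.1.2 & C y.2]].
Proof.
rewrite !openE => oA oB oC [[x y] z] /= [Ax By Cz].
exists (A `*` B, C) => /=; last by move=> [[a b] c] /= [[]].
split => /=; last exact: oC.
by exists (A, B) => //=; split; [exact: oA|exact: oB].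
Qed.

Lemma measurable_box (A B C : set R) : measurable A -> measurable B -> measurable C ->
  measurable [set y : R * R * R | [/\ A y.1.1, B y.1.2 & C y.2]].
Proof.
move=> mA mB mC; rewrite (_ : [set _ | _] = A `*` B `*` C).
  by apply: measurableX => //; exact: measurableX.
by apply/seteqP; split => -[[a b] c] /= => [[]|[[]]].
Qed.

(** The sigma-algebra is the product one, so openness has to be reduced to countably many boxes:
    those with rational centres and radii contained in [U], all others being replaced by the empty
    set. *)
Lemma open3_measurable (U : set (R * R * R)) : open U -> measurable U.
Proof.
move=> oU.
pose box (q : (rat * rat) * (rat * rat) * (rat * rat)) : set (R * R * R) :=
  [set y | [/\ ball (ratr q.1.1.1 : R) (ratr q.1.1.2) y.1.1,
     ball (ratr q.1.2.1 : R) (ratr q.1.2.2) y.1.2 & ball (ratr q.2.1 : R) (ratr q.2.2) y.2]].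
have -> : U = \bigcup_q (if pselect (box q `<=` U) then box q else set0).
  apply/seteqP; split => [x Ux|x [q _]]; last first.
    by case: pselect => // qU; exact: qU.
  have /nbhs_ballP[e /= e0 eU] : nbhs x U by exact: open_nbhs_nbhs.
  have rb (a : R) : exists cr : rat * rat,
      ball (ratr cr.1 : R) (ratr cr.2) a /\ ball (ratr cr.1 : R) (ratr cr.2) `<=` ball a e.
    have [c [r [h1 h2]]] := open_subball_rat (ball_open a e) (mem_set (ballxx a e0)).
    by exists (c, r); split => //; exact: set_mem h1.
  have [q1 [x1 h1]] := rb x.1.1; have [q2 [x2 h2]] := rb x.1.2.
  have [q3 [x3 h3]] := rb x.2.
  exists (q1, q2, q3) => //; case: pselect => /= [_|[]]; first by split.
  move=> y [y1 y2 y3].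
  by apply: eU; apply/ball3E; split; [exact: h1|exact: h2|exact: h3].
apply: countable_bigcupT_measurable; first exact: countableP.
move=> q; case: pselect => /= [_|_]; last exact: measurable0.
by apply: measurable_box; exact: measurable_ball.
Qed.

Variables (X : Omega -> R * R * R).
Hypothesis mX : measurable_fun setT X.

(** If f(x) were nonzero, f would be nonzero on an open box around x, an event of positive
    probability. *)
Lemma law_support_zero (f : R * R * R -> R) (x : R * R * R) :
  law_support P X x -> {for x, continuous f} -> {ae P, forall w, f (X w) = 0} ->
  f x = 0.
Proof.
move=> Px cf [N [mN PN Nf]]; apply/eqP/negPn/negP => fx0.
have /nbhs_ballP[e /= e0 ef] : \forall y \near x, f y != 0.
  exact: cvgr_neq0 cf fx0.
pose U := [set y : R * R * R | [/\ ball x.1.1 e y.1.1, ball x.1.2 e y.1.2 & ball x.2 e y.2]].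
have oU : open U by apply: open_box; exact: ball_open.
have Ux : U x by split; exact: ballxx.
have := Px U oU Ux; rewrite lt_neqAle => /andP[/negP + _]; apply.
have mXU : measurable (X @^-1` U).
  by rewrite -[_ @^-1` _]setTI; apply: mX => //; exact: open3_measurable.
rewrite eq_sym -measure_le0 -PN le_measure ?inE//.
by move=> w Uw; apply: Nf => /= /eqP; apply/negP; apply: ef; exact/ball3E.
Qed.

Lemma law_support_ge0 (x : R * R * R) :
  {ae P, forall w, [/\ 0 < (X w).1.1, 0 < (X w).1.2 & 0 < (X w).2]} ->
  law_support P X x -> [/\ 0 <= x.1.1, 0 <= x.1.2 & 0 <= x.2].
Proof.
move=> [N [mN PN NX]] Px.
have neg (U : set (R * R * R)) : open U ->
    (forall y, U y -> ~ [/\ 0 < y.1.1, 0 < y.1.2 & 0 < y.2]) -> ~ U x.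
  move=> oU Uneg /(Px _ oU); rewrite lt_neqAle => /andP[/negP + _]; apply.
  have mXU : measurable (X @^-1` U).
    by rewrite -[_ @^-1` _]setTI; apply: mX => //; exact: open3_measurable.
  rewrite eq_sym -measure_le0 -PN le_measure ?inE//.
  by move=> w Uw; apply: NX => /=; exact: Uneg.
have on : open [set y : R | y < 0] by exact: open_lt.
by split; rewrite leNgt; apply/negP => x0;
  [apply: (neg _ (open_box on openT openT))|apply: (neg _ (open_box openT on openT))
  |apply: (neg _ (open_box openT openT on))] => //= y [] /= y1 y2 y3 [z1 z2 z3];
  [have := lt_trans y1 z1|have := lt_trans y2 z2|have := lt_trans y3 z3]; rewrite ltxx.
Qed.

(** Almost sure positivity puts the support only in the closed orthant. The centre is nevertheless
    strictly positive, because the point lower by r / 2 in every coordinate is still in the support.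
    Strictness matters since [ln] is continuous only at positive arguments. *)
Lemma law_support_ball_pos (c : R * R * R) (r : R) :
  {ae P, forall w, [/\ 0 < (X w).1.1, 0 < (X w).1.2 & 0 < (X w).2]} ->
  0 < r -> ball c r `<=` law_support P X -> [/\ 0 < c.1.1, 0 < c.1.2 & 0 < c.2].
Proof.
move=> X0 r0 cr.
have r2 : 0 < r / 2 by rewrite divr_gt0.
have [h1 h2 h3] : [/\ 0 <= c.1.1 - r / 2, 0 <= c.1.2 - r / 2 & 0 <= c.2 - r / 2].
  apply: (law_support_ge0 (x := (c.1.1 - r / 2, c.1.2 - r / 2, c.2 - r / 2))) => //.
  apply: cr; apply/ball3E => /=; rewrite /ball /= !subKr.
  by split; rewrite gtr0_norm//; lra.
by split; lra.
Qed.

(** Corners of a cube of side r / 2 with lowest corner c; a Boolean selects each coordinate. Finite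
    differences over them will isolate the coefficients of a translog. *)
Lemma law_support_grid (c : R * R * R) (r : R) :
  0 < r -> ball c r `<=` law_support P X -> forall e1 e2 e3 : bool,
  law_support P X (c.1.1 + r / 2 *+ e1, c.1.2 + r / 2 *+ e2, c.2 + r / 2 *+ e3).
Proof.
move=> r0 cr; have r2 : 0 < r / 2 by rewrite divr_gt0.
move=> e1 e2 e3; apply: cr; apply/ball3E => /=.
have h (a : R) (e : bool) : ball a r (a + r / 2 *+ e).
  rewrite /ball /= opprD addNKr normrN.
  by case: e; rewrite ?mulr1n ?mulr0n ?normr0// gtr0_norm//; lra.
by split; exact: h.
Qed.

Lemma law_support_image (h : R * R * R -> R * R * R) (x : R * R * R) :
  measurable_fun setT h -> {for x, continuous h} -> law_support P X x ->
  law_support P (h \o X) (h x).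
Proof.
move=> mh ch Px U oU Uhx.
have /nbhs_ballP[e /= e0 eU] : nbhs x (h @^-1` U) by apply: ch; exact: open_nbhs_nbhs.
pose V := [set y : R * R * R | [/\ ball x.1.1 e y.1.1, ball x.1.2 e y.1.2 & ball x.2 e y.2]].
have oV : open V by apply: open_box; exact: ball_open.
have Vx : V x by split; exact: ballxx.
have mp (f : Omega -> R * R * R) (W : set (R * R * R)) :
    measurable_fun setT f -> open W -> measurable (f @^-1` W).
  by move=> mf oW; rewrite -[_ @^-1` _]setTI; apply: mf => //; exact: open3_measurable.
apply: (lt_le_trans (Px V oV Vx)); apply: le_measure; rewrite ?inE.
- exact: mp.
- by apply: mp => //; exact: measurableT_comp.
- by move=> w Vw; apply: eU; exact/ball3E.
Qed.

End Support.

(** * Identification *)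

Section Regression.
Context (R : realType) (T : nat) (d : measure_display) (Omega : measurableType d).
Variables (P : probability Omega R) (b : params R T) (v : variables T P).
Hypothesis hS : is_structure b v.
Variable (t : 'I_T).

Definition th_ix (m : 'I_2) : error_index T := inl (inl (cur t, m)).
Definition I_ix (m : 'I_2) : error_index T := inl (inr (t, m)).
Definition next_ix : error_index T := inl (inl (nxt t, m1)).

Local Notation lth := (ln_theta v (cur t)).
Local Notation lI := (ln_inv v t).
Local Notation lY := (ln_Y v t).

(** Vanishing almost surely, the translog vanishes by continuity on a grid of support points. Finite
    differences on the grid are single coefficients times products of log increments and loadings,
    all nonzero. *)
Lemma translog_ae_zero c0 c1 c2 c3 c4 :
  {ae P, forall w, translog c0 c1 c2 c3 c4 (signal b v (th_ix m1) w)
    (signal b v (I_ix m1) w) (lY w) = 0} ->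
  [/\ c0 = 0, c1 = 0, c2 = 0, c3 = 0 & c4 = 0].
Proof.
have [la_th0 la_I0 _] := str_admissible hS.
have lx := la_th0 (cur t) m1; have lw := la_I0 t m1.
set mx := mu_th b (cur t) m1; set mw := mu_I b t m1 => q0.
have [posth [posI [posY _]]] := str_equations hS.
pose V w := (theta v (cur t) w, Defs.inv v t w, Y v t w).
have mV : measurable_fun setT V.
  by do 2 (apply/measurable_fun_pair => //).
have V0 : {ae P, forall w, [/\ 0 < (V w).1.1, 0 < (V w).1.2 & 0 < (V w).2]}.
  by apply: filterS3 (posth (cur t)) (posI t) (posY t) => w ? ? ?; split.
have [c [r [r0 cr]]] := str_support hS t.
have [p1 p2 p3] := law_support_ball_pos mV V0 r0 cr.
have grid := law_support_grid r0 cr.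
set s := r / 2 in grid; have s0 : 0 < s by rewrite divr_gt0.
pose f (z : R * R * R) := translog c0 c1 c2 c3 c4
  (mx + la_th b (cur t) m1 * ln z.1.1) (mw + la_I b t m1 * ln z.1.2) (ln z.2).
have fV : {ae P, forall w, f (V w) = 0} by exact: q0.
have fz (e1 e2 e3 : bool) : f (c.1.1 + s *+ e1, c.1.2 + s *+ e2, c.2 + s *+ e3) = 0.
  have pos a (e : bool) : 0 < a -> 0 < a + s *+ e.
    by move=> a0; rewrite ltr_wpDr// mulrn_wge0// ltW.
  apply: (law_support_zero mV (f := f) (grid e1 e2 e3) _ fV).
  set z := (_, _, _).
  have c1' : y.1 @[y --> z] --> z.1 by exact: cvg_fst.
  have c11 : y.1.1 @[y --> z] --> z.1.1 by apply: (cvg_comp _ _ c1'); exact: cvg_fst.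
  have c12 : y.1.2 @[y --> z] --> z.1.2 by apply: (cvg_comp _ _ c1'); exact: cvg_snd.
  have c2' : y.2 @[y --> z] --> z.2 by exact: cvg_snd.
  have l1 : ln y.1.1 @[y --> z] --> ln z.1.1.
    exact: (cvg_comp _ _ c11 (continuous_ln (pos _ e1 p1))).
  have l2 : ln y.1.2 @[y --> z] --> ln z.1.2.
    exact: (cvg_comp _ _ c12 (continuous_ln (pos _ e2 p2))).
  have l3 : ln y.2 @[y --> z] --> ln z.2.
    exact: (cvg_comp _ _ c2' (continuous_ln (pos _ e3 p3))).
  have DM (g h : R * R * R -> R) k : g y @[y --> z] --> g z ->
      h y @[y --> z] --> h z -> (g y + k * h y) @[y --> z] --> g z + k * h z.
    by move=> gz hz; apply: cvgD => //; apply: cvgM => //; exact: cvg_cst.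
  have cc (k : R) : k @[y --> z] --> k by exact: cvg_cst.
  have k1 := DM (fun=> mx) (fun y => ln y.1.1) (la_th b (cur t) m1) (cc _) l1.
  have k2 := DM (fun=> mw) (fun y => ln y.1.2) (la_I b t m1) (cc _) l2.
  pose x1 (y : R * R * R) := mx + la_th b (cur t) m1 * ln y.1.1.
  pose x2 (y : R * R * R) := mw + la_I b t m1 * ln y.1.2.
  have k12 : (x1 y * x2 y) @[y --> z] --> x1 z * x2 z by apply: cvgM.
  have t1 := DM (fun=> c0) x1 c1 (cc _) k1.
  have t2 := DM (fun y => c0 + c1 * x1 y) x2 c2 t1 k2.
  have t3 := DM (fun y => c0 + c1 * x1 y + c2 * x2 y) (fun y => x1 y * x2 y) c3 t2 k12.
  exact: (DM _ (fun y => ln y.2) c4 t3 l3).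
have lnD a : 0 < a -> ln (a + s) - ln a != 0.
  by move=> a0; rewrite subr_eq0 gt_eqF// ltr_ln ?posrE ?ltrDl// addr_gt0.
have d1 := lnD _ p1; have d2 := lnD _ p2; have d3 := lnD _ p3.
move: (fz false false false) (fz false false true) (fz true false false)
  (fz false true false) (fz true true false).
rewrite /f /translog /= !mulr0n !mulr1n !addr0.
set x0 := ln c.1.1 in d1 *; set w0 := ln c.1.2 in d2 *; set y0 := ln c.2 in d3 *.
set x1 := ln (c.1.1 + s) in d1 *; set w1 := ln (c.1.2 + s) in d2 *.
set y1 := ln (c.2 + s) in d3 *.
set l := la_th _ _ _ in lx *; set k := la_I _ _ _ in lw *.
move=> f000 f001 f100 f010 f110.
have nz (a e : R) : a != 0 -> a * e = 0 -> e = 0.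
  by move=> a0 /eqP; rewrite mulf_eq0 (negPf a0) => /eqP.
(* The difference in Y alone gives c4; below, the mixed second difference in theta and I gives c3,
   after which first differences give c1 and c2. *)
have E4 : c4 = 0 by apply: (nz (y1 - y0)) => //; lra.
have E3 : c3 = 0.
  apply: (nz ((l * (x1 - x0)) * (k * (w1 - w0)))); first by rewrite !mulf_neq0.
  by lra.
rewrite E3 in f000 f100 f010.
have E1 : c1 = 0 by apply: (nz (l * (x1 - x0))); [rewrite mulf_neq0|lra].
have E2 : c2 = 0 by apply: (nz (k * (w1 - w0))); [rewrite mulf_neq0|lra].
by split => //; move: f000; rewrite E1 E2 E4 !mul0r !addr0.
Qed.

(** The first alternative admits a term with coefficient 0 whose variable is not known to be
    integrable, as happens for the interaction. *)
Lemma L1_Ex0Z k (X : Omega -> R) : k = 0 \/ L1 P X /\ Ex P X = 0 ->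
  L1 P (fun w => k * X w) /\ Ex P (fun w => k * X w) = 0.
Proof.
move=> [->|[iX X0]]; last by rewrite ExZ// X0 mulr0; split => //; exact: L1Z.
have -> : (fun w => 0 * X w) = (fun=> 0) by apply/funext => w; rewrite mul0r.
by split; [exact: L1_cst|rewrite Ex_cst].
Qed.

(** q is a combination of 1, the latent logs, their interaction and ln Y, so orthogonality to each
    of these yields E[q^2] = 0. The disjunctions waive a condition when its term is absent: the
    investment equation offers no instrument for ln I, and the interaction may fail to be
    square-integrable. *)
Lemma translog_orthogonal c0 c1 c2 c3 c4
  (q := fun w => translog c0 c1 c2 c3 c4 (signal b v (th_ix m1) w)
    (signal b v (I_ix m1) w) (lY w)) :
  c3 = 0 \/ L2 P (fun w => lth w * lI w) ->
  Ex P q = 0 -> Ex P (fun w => q w * lth w) = 0 -> Ex P (fun w => q w * lY w) = 0 ->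
  (c2 = 0 /\ c3 = 0) \/ Ex P (fun w => q w * lI w) = 0 ->
  c3 = 0 \/ Ex P (fun w => q w * (lth w * lI w)) = 0 ->
  [/\ c0 = 0, c1 = 0, c2 = 0, c3 = 0 & c4 = 0].
Proof.
move=> c30 q0 qth qY qI qthI; apply: translog_ae_zero.
have th2 : L2 P lth := L2_latent hS (th_ix m1).
have I2 : L2 P lI := L2_latent hS (I_ix m1).
have Y2 : L2 P lY := L2_ln_Y hS t.
pose mx := mu_th b (cur t) m1; pose lx := la_th b (cur t) m1.
pose mw := mu_I b t m1; pose lw := la_I b t m1.
(* Coefficients of q in the latent logs, after expansion of the two signals. *)
pose k0 := c0 + c1 * mx + c2 * mw + c3 * mx * mw.
pose k1 := c1 * lx + c3 * lx * mw; pose k2 := (c2 + c3 * mx) * lw.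
pose k3 := c3 * lx * lw.
have qE w : q w = k0 + k1 * lth w + k2 * lI w + k3 * (lth w * lI w) + c4 * lY w.
  rewrite /q /translog /signal /= -/mx -/lx -/mw -/lw /k0 /k1 /k2 /k3; ring.
have q2 : L2 P q.
  have -> : q = (fun w => k0 + k1 * lth w + k2 * lI w + k3 * (lth w * lI w) + c4 * lY w).
    exact/funext.
  have thI2 : L2 P (fun w => k3 * (lth w * lI w)).
    case: c30 => [c30|]; last exact: L2Z.
    have -> : (fun w => k3 * (lth w * lI w)) = (fun=> 0).
      by apply/funext => w; rewrite /k3 c30 !mul0r.
    exact: L2_cst.
  apply: L2D; last exact: L2Z.
  apply: L2D => //; apply: L2D; last exact: L2Z.
  by apply: L2D; [exact: L2_cst|exact: L2Z].
apply: Ex_sqr0 => //.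
have i0 := L2_L1 q2; have ith := L2_mul q2 th2; have iI := L2_mul q2 I2.
have iY := L2_mul q2 Y2.
have [h0 e0] : L1 P (fun w => k0 * q w) /\ Ex P (fun w => k0 * q w) = 0.
  by apply: L1_Ex0Z; right.
have [h1 e1] : L1 P (fun w => k1 * (q w * lth w)) /\ Ex P (fun w => k1 * (q w * lth w)) = 0.
  by apply: L1_Ex0Z; right.
have [h2 e2] : L1 P (fun w => k2 * (q w * lI w)) /\ Ex P (fun w => k2 * (q w * lI w)) = 0.
  apply: L1_Ex0Z; case: qI => [[c2E c3E]|]; [left|by right].
  by rewrite /k2 c2E c3E mul0r addr0 mul0r.
have [h3 e3] : L1 P (fun w => k3 * (q w * (lth w * lI w))) /\
    Ex P (fun w => k3 * (q w * (lth w * lI w))) = 0.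
  apply: L1_Ex0Z; case: qthI => [c3E|]; first by left; rewrite /k3 c3E !mul0r.
  case: c30 => [c3E|thI2]; first by left; rewrite /k3 c3E !mul0r.
  by right; split => //; exact: L2_mul.
have [h4 e4] : L1 P (fun w => c4 * (q w * lY w)) /\ Ex P (fun w => c4 * (q w * lY w)) = 0.
  by apply: L1_Ex0Z; right.
transitivity (Ex P (fun w => k0 * q w + k1 * (q w * lth w) + k2 * (q w * lI w)
    + k3 * (q w * (lth w * lI w)) + c4 * (q w * lY w))).
  by apply: eq_Ex => w; rewrite expr2 -/(q w) [X in X * _ = _]qE; ring.
rewrite (ExD (L1D (L1D (L1D h0 h1) h2) h3) h4) (ExD (L1D (L1D h0 h1) h2) h3).
by rewrite (ExD (L1D h0 h1) h2) (ExD h0 h1) e0 e1 e2 e3 e4 !addr0.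
Qed.

End Regression.

(** * Moment equations and uniqueness of their solutions *)

Section Identification.
Context (R : realType) (T : nat) (d : measure_display) (Omega : measurableType d).
Variables (P : probability Omega R) (b : params R T) (v : variables T P).
Variable (t : 'I_T).

Local Notation m2 := (ord_max : 'I_2).
Local Notation sg := (signal b v).
Local Notation Z := (measurement v).
Local Notation eps := (errors v).
Local Notation lY := (ln_Y v t).
Local Notation i1 := (th_ix t m1).
Local Notation i2 := (th_ix t m2).
Local Notation j1 := (I_ix t m1).
Local Notation j2 := (I_ix t m2).

Definition obs_translog c0 c1 c2 c3 c4 (w : Omega) : R :=
  translog c0 c1 c2 c3 c4 (Z i1 w) (Z j1 w) (lY w).

Definition latent_translog c0 c1 c2 c3 c4 (w : Omega) : R :=
  translog c0 c1 c2 c3 c4 (sg i1 w) (sg j1 w) (lY w).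

Local Notation tb := (transform b).

(** The origin of the transformed parameters: they are the coefficients of the equation once each
    latent log is expressed through the signal of its first measurement and the left side is put on
    the scale of its own first measurement. *)
Lemma latent_investment w : admissible b ->
  latent_translog (- beta0 tb t) (- beta1 tb t) 1 0 (- beta2 tb t) w
  = la_I b t m1 * shock_I b v t w.
Proof.
move=> [th0 I0 _].
rewrite /latent_translog /translog /signal /shock_I /=.
by field; rewrite th0.
Qed.

(** The same change of variables, applied to the production residual minus the control. Expressed in
    signals, the control adds multiples of the transformed investment parameters, so kappa is
    visible in the coefficient of ln Y. *)
Lemma latent_production kappa w : admissible b ->
  sg (next_ix t) w - latent_translog
    (a_ tb t - la_th b (nxt t) m1 / la_I b t m1 * kappa * beta0 tb t)
    (gamma1 tb t - la_th b (nxt t) m1 / la_I b t m1 * kappa * beta1 tb t)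
    (gamma2 tb t + la_th b (nxt t) m1 / la_I b t m1 * kappa)
    (gamma3 tb t)
    (- (la_th b (nxt t) m1 / la_I b t m1 * kappa * beta2 tb t)) w =
  la_th b (nxt t) m1 * (shock_th b v t w - kappa * shock_I b v t w).
Proof.
move=> [th0 I0 _].
rewrite /latent_translog /translog /signal /shock_I /shock_th /=.
by field; rewrite th0 I0.
Qed.

Hypothesis hS : is_structure b v.

Let ix_neq : [/\ i1 != j1, i1 != i2 & i1 != j2] /\ [/\ j1 != i2, j1 != j2 & i2 != j2].
Proof. by do ![split]; apply/eqP => -[]. Qed.

Lemma L2_linear c0 c1 c2 c4 (X W V : Omega -> R) : L2 P X -> L2 P W -> L2 P V ->
  L2 P (fun w => translog c0 c1 c2 0 c4 (X w) (W w) (V w)).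
Proof.
move=> X2 W2 V2; apply: L2D; last exact: L2Z.
have -> : (fun w => c0 + c1 * X w + c2 * W w + 0 * (X w * W w)) =
    (fun w => c0 + c1 * X w + c2 * W w).
  by apply/funext => w; rewrite mul0r addr0.
apply: L2D; last exact: L2Z.
by apply: L2D; [exact: L2_cst|exact: L2Z].
Qed.

Lemma obs_linearE c0 c1 c2 c4 : {ae P, forall w, obs_translog c0 c1 c2 0 c4 w =
  latent_translog c0 c1 c2 0 c4 w + (c1 * eps i1 w + c2 * eps j1 w)}.
Proof.
apply: filterS2 (measurementE hS i1) (measurementE hS j1) => w E1 E2.
by rewrite /obs_translog /latent_translog E1 E2 /translog; ring.
Qed.

Lemma Ex_linear_latent c0 c1 c2 c4 (h : Omega -> R) :
  factors (primitives v) h -> L2 P h ->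
  Ex P (fun w => obs_translog c0 c1 c2 0 c4 w * h w) =
  Ex P (fun w => latent_translog c0 c1 c2 0 c4 w * h w).
Proof.
move=> fh h2.
have q2 : L2 P (latent_translog c0 c1 c2 0 c4).
  by apply: L2_linear; [exact: L2_signal|exact: L2_signal|exact: L2_ln_Y hS t].
have e1 := L2_errors hS i1; have e2 := L2_errors hS j1.
transitivity (Ex P (fun w => latent_translog c0 c1 c2 0 c4 w * h w +
    (c1 * (h w * eps i1 w) + c2 * (h w * eps j1 w)))).
  apply: ae_eq_Ex.
  - apply: (@L1_meas _ _ _ P); apply: L2_mul => //.
    by apply: L2_linear; [exact: L2_measurement hS _|exact: L2_measurement hS _|exact: L2_ln_Y hS t].
  - apply: (@L1_meas _ _ _ P); apply: L1D; first exact: L2_mul.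
    by apply: L1D; apply: L1Z; apply: L2_mul.
  - by apply: filterS (obs_linearE c0 c1 c2 c4) => w ->; ring.
have he1 := L2_mul h2 e1; have he2 := L2_mul h2 e2.
rewrite (ExD (L2_mul q2 h2) (L1D (L1Z c1 he1) (L1Z c2 he2))) (ExD (L1Z c1 he1) (L1Z c2 he2)).
rewrite (ExZ c1 he1) (ExZ c2 he2) (Ex_latent_errors hS _ fh (L2_L1 h2)).
by rewrite (Ex_latent_errors hS _ fh (L2_L1 h2)) !mulr0 !addr0.
Qed.

Lemma Ex_linear_error c0 c1 c2 c4 :
  Ex P (fun w => obs_translog c0 c1 c2 0 c4 w * eps i2 w) = 0.
Proof.
have q2 : L2 P (latent_translog c0 c1 c2 0 c4).
  by apply: L2_linear; [exact: L2_signal|exact: L2_signal|exact: L2_ln_Y hS t].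
have e1 := L2_errors hS i1; have e2 := L2_errors hS j1; have e3 := L2_errors hS i2.
have h1 := L2_mul e1 e3; have h2 := L2_mul e2 e3; have h0 := L2_mul q2 e3.
transitivity (Ex P (fun w => latent_translog c0 c1 c2 0 c4 w * eps i2 w +
    (c1 * (eps i1 w * eps i2 w) + c2 * (eps j1 w * eps i2 w)))).
  apply: ae_eq_Ex.
  - apply: (@L1_meas _ _ _ P); apply: L2_mul => //.
    by apply: L2_linear; [exact: L2_measurement hS _|exact: L2_measurement hS _|exact: L2_ln_Y hS t].
  - apply: (@L1_meas _ _ _ P); apply: L1D => //.
    by apply: L1D; apply: L1Z.
  - by apply: filterS (obs_linearE c0 c1 c2 c4) => w ->; ring.
rewrite (ExD h0 (L1D (L1Z c1 h1) (L1Z c2 h2))) (ExD (L1Z c1 h1) (L1Z c2 h2)).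
have [[_ n1 _] [n5 _ _]] := ix_neq.
rewrite (ExZ c1 h1) (ExZ c2 h2) (Ex_errors2 hS n1) (Ex_errors2 hS n5) !mulr0 !addr0.
apply: (Ex_latent_errors hS) => //; last exact: L2_L1.
have fc c : factors (primitives v) (fun=> c : R) by exact: factors_cst.
have fs k : factors (primitives v) (sg k) by exact: factors_signal.
have fY : factors (primitives v) lY by exact: factors_ln_Y.
by apply: factorsD; [repeat apply: factorsD => //; repeat apply: factorsM => //|exact: factorsM].
Qed.

Lemma Ex_linear_measurement c0 c1 c2 c4 :
  Ex P (fun w => obs_translog c0 c1 c2 0 c4 w * Z i2 w) =
  Ex P (fun w => latent_translog c0 c1 c2 0 c4 w * sg i2 w).
Proof.
have q2 : L2 P (obs_translog c0 c1 c2 0 c4).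
  by apply: L2_linear; [exact: L2_measurement hS _|exact: L2_measurement hS _|exact: L2_ln_Y hS t].
have e2 := L2_errors hS i2; have s2 := L2_signal hS i2.
transitivity (Ex P (fun w => obs_translog c0 c1 c2 0 c4 w * sg i2 w +
   obs_translog c0 c1 c2 0 c4 w * eps i2 w)).
  apply: ae_eq_Ex.
  - by apply: (@L1_meas _ _ _ P); apply: L2_mul => //; exact: L2_measurement hS _.
  - by apply: (@L1_meas _ _ _ P); apply: L1D; apply: L2_mul.
  - by apply: filterS (measurementE hS i2) => w ->; rewrite mulrDr.
rewrite (ExD (L2_mul q2 s2) (L2_mul q2 e2)) Ex_linear_error addr0.
by apply: Ex_linear_latent => //; exact: factors_signal.
Qed.

Lemma Ex_signal_orthogonal k (q : Omega -> R) : loading b k != 0 ->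
  L1 P q -> L1 P (fun w => q w * latent v k w) -> Ex P q = 0 ->
  Ex P (fun w => q w * sg k w) = 0 -> Ex P (fun w => q w * latent v k w) = 0.
Proof.
move=> l0 q1 ql1 q0.
have -> : (fun w => q w * sg k w) =
    (fun w => intercept b k * q w + loading b k * (q w * latent v k w)).
  by apply/funext => w; rewrite /signal; ring.
rewrite (ExD (L1Z _ q1) (L1Z _ ql1)) (ExZ _ q1) (ExZ _ ql1) q0 mulr0 add0r => /eqP.
by rewrite mulf_eq0 (negPf l0) => /eqP.
Qed.

Let load_i2 : loading b i2 != 0. Proof. by have [h _ _] := str_admissible hS; exact: h. Qed.
Let load_j2 : loading b j2 != 0. Proof. by have [_ h _] := str_admissible hS; exact: h. Qed.

(** Here c2 = 0 because ln I has coefficient 1 in every solution of the investment moments, so it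
    cancels from the difference of two solutions. *)
Lemma linear_unique c0 c1 c4 (q := obs_translog c0 c1 0 0 c4) :
  Ex P (fun w => q w * 1) = 0 -> Ex P (fun w => q w * Z i2 w) = 0 ->
  Ex P (fun w => q w * lY w) = 0 -> [/\ c0 = 0, c1 = 0 & c4 = 0].
Proof.
have q2 : L2 P (latent_translog c0 c1 0 0 c4).
  by apply: L2_linear; [exact: L2_signal|exact: L2_signal|exact: L2_ln_Y hS t].
have th2 : L2 P (ln_theta v (cur t)) := L2_latent hS i2.
rewrite /q Ex_linear_latent; [|exact: factors_cst|exact: L2_cst].
rewrite Ex_linear_measurement Ex_linear_latent; [|exact: factors_ln_Y|exact: L2_ln_Y hS t].
under eq_Ex do rewrite mulr1.
move=> q0 qth qY.
have [] : [/\ c0 = 0, c1 = 0, 0 = 0 :> R, 0 = 0 :> R & c4 = 0] => //.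
apply: (translog_orthogonal hS (t := t)) => //; try by left.
by apply: (Ex_signal_orthogonal (k := i2)) => //; [exact: L2_L1|exact: L2_mul].
Qed.


Lemma investment_moments
    (q := obs_translog (- beta0 tb t) (- beta1 tb t) 1 0 (- beta2 tb t)) :
  [/\ Ex P (fun w => q w * 1) = 0, Ex P (fun w => q w * Z i2 w) = 0 &
      Ex P (fun w => q w * lY w) = 0].
Proof.
have sh (g : R * R -> R) : measurable_fun setT g ->
    L2 P (fun w => g (theta v (cur t) w, Y v t w)) ->
    Ex P (fun w => latent_translog (- beta0 tb t) (- beta1 tb t) 1 0 (- beta2 tb t) w
      * g (theta v (cur t) w, Y v t w)) = 0.
  move=> mg g2; under eq_Ex do rewrite (latent_investment _ (str_admissible hS)) -mulrA.
  rewrite ExZ; first by rewrite (shock_I_orthogonal hS) ?mulr0.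
  by apply: L2_mul => //; exact: L2_shock_I hS t.
have mln1 : measurable_fun setT (fun z : R * R => ln z.1).
  exact: (measurableT_comp (measurable_ln (R := R)) (g := fst)).
have mln2 : measurable_fun setT (fun z : R * R => ln z.2).
  exact: (measurableT_comp (measurable_ln (R := R)) (g := snd)).
rewrite /q; split.
- rewrite Ex_linear_latent; [|exact: factors_cst|exact: L2_cst].
  by apply: (sh (fun=> 1)) => //; exact: L2_cst.
- rewrite Ex_linear_measurement.
  apply: (sh (fun z => mu_th b (cur t) m2 + la_th b (cur t) m2 * ln z.1)).
    by apply: measurable_funD => //; exact: measurable_funM.
  exact: L2_signal hS i2.
- rewrite Ex_linear_latent; [|exact: factors_ln_Y|exact: L2_ln_Y hS t].
  by apply: (sh (fun z => ln z.2)) => //; exact: L2_ln_Y hS t.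
Qed.

Local Notation instr := (instruments b v i2 j2 t).
Local Notation obs_instr := (obs_instruments v i2 j2 t).

(** [k] is existential because kappa is a nuisance constant of the structure; observationally
    equivalent structures come a priori with different ones. *)
Lemma production_moments : exists k : R, forall B : set (R * R * R), measurable B ->
  Ex P (fun w => (Z (next_ix t) w - obs_translog (a_ tb t - k * beta0 tb t)
    (gamma1 tb t - k * beta1 tb t) (gamma2 tb t + k) (gamma3 tb t)
    (- (k * beta2 tb t)) w) * \1_(obs_instr @^-1` B) w) = 0.
Proof.
have [kappa kE] := noisy_shocks_orthogonal hS t.
(* kappa in the units of the first measurements. *)
set k := la_th b (nxt t) m1 / la_I b t m1 * kappa.
exists k => B mB.
have mI : measurable (instr @^-1` B).
  exact: measurable_preim (measurable_instruments b v i2 j2 t) mB.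
have mO : measurable (obs_instr @^-1` B).
  exact: measurable_preim (measurable_obs_instruments v i2 j2 t) mB.
set c0 := a_ _ _ - _; set c1 := gamma1 _ _ - _; set c2 := gamma2 _ _ + _.
set c3 := gamma3 _ _; set c4 := - _.
have iO : L1 P (obs_translog c0 c1 c2 c3 c4).
  by apply: (L1_translog hS); exact: L2_measurement hS _.
have iL : L1 P (latent_translog c0 c1 c2 c3 c4).
  by apply: (L1_translog hS); exact: L2_signal hS _.
have iZ : L1 P (Z (next_ix t)) by apply: L2_L1; exact: L2_measurement hS _.
have is_ : L1 P (sg (next_ix t)) by apply: L2_L1; exact: L2_signal hS _.
have split1 (A C : Omega -> R) (D : set Omega) : measurable D -> L1 P A -> L1 P C ->
    Ex P (fun w => (A w - C w) * \1_D w) =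
    Ex P (fun w => A w * \1_D w) - Ex P (fun w => C w * \1_D w).
  move=> mD iA iC; rewrite -(ExB (L1_indic mD iA) (L1_indic mD iC)).
  by apply: eq_Ex => w; rewrite mulrBl.
rewrite split1// (translog_noise_reduction hS ix_neq t c0 c1 c2 c3 c4 mB).
have n1 : next_ix t != i2 by rewrite /next_ix /th_ix; apply/eqP => -[].
have ZI : Ex P (fun w => Z (next_ix t) w * \1_(obs_instr @^-1` B) w) =
    Ex P (fun w => sg (next_ix t) w * \1_(instr @^-1` B) w).
  have fI : factors (noisy_prim v i2 j2) (\1_(instr @^-1` B) : Omega -> R).
    by apply: factors_indic (factors_instruments b v i2 j2 t).
  have I2 : L2 P (\1_(instr @^-1` B) : Omega -> R).
    by have := L2_indic mI (L2_cst P 1); congr L2; apply/funext => w; rewrite mul1r.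
  have iIe : L1 P (fun w => \1_(instr @^-1` B) w * eps (next_ix t) w).
    by apply: L2_mul => //; exact: L2_errors hS _.
  transitivity (Ex P (fun w => sg (next_ix t) w * \1_(instr @^-1` B) w +
      \1_(instr @^-1` B) w * eps (next_ix t) w)).
    apply: ae_eq_Ex.
    - exact: (L1_meas (L1_indic mO iZ)).
    - exact: (L1_meas (L1D (L1_indic mI is_) iIe)).
    - apply: filterS2 (measurementE hS (next_ix t)) (obs_instrumentsE hS i2 j2 t B).
      by move=> w -> ->; ring.
  rewrite (ExD (L1_indic mI is_) iIe).
  by rewrite (Ex_noisy_err hS ix_neq n1 _ fI (L2_L1 I2)) ?addr0.
rewrite ZI -[X in _ - X]/(Ex P (fun w => latent_translog c0 c1 c2 c3 c4 w * _)) -split1//.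
under eq_Ex do rewrite (latent_production _ _ (str_admissible hS)) -mulrA.
rewrite ExZ; first by rewrite kE// mulr0.
apply: L1_indic => //; apply: L2_L1; apply: L2B; first exact: L2_shock_th hS t.
by apply: L2Z; exact: L2_shock_I hS t.
Qed.

(** Regressor errors are removed while the instruments are still indicators; only then are unbounded
    instruments used, against the latent q. Their own errors drop out as q is a function of the
    primitives, and the nonzero second loadings turn orthogonality to the signals into orthogonality
    to the latent logs. *)
Lemma translog_unique c0 c1 c2 c3 c4 : c3 = 0 \/ gamma3 b t != 0 ->
  (forall B : set (R * R * R), measurable B ->
    Ex P (fun w => obs_translog c0 c1 c2 c3 c4 w * \1_(obs_instr @^-1` B) w) = 0) ->
  [/\ c0 = 0, c1 = 0, c2 = 0, c3 = 0 & c4 = 0].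
Proof.
move=> c30 obs0; set q := latent_translog c0 c1 c2 c3 c4.
pose th := ln_theta v (cur t); pose I := ln_inv v t.
have th2 : L2 P th := L2_latent hS i2.
have I2 : L2 P I := L2_latent hS j2.
have thI2 : c3 = 0 \/ L2 P (fun w => th w * I w).
  by case: c30 => [|g]; [left|right; exact: (L2_interaction hS g)].
have q0 B : measurable B -> Ex P (fun w => q w * \1_(instr @^-1` B) w) = 0.
  by move=> mB; rewrite -(translog_noise_reduction hS ix_neq t c0 c1 c2 c3 c4 mB) obs0.
have Y2 := L2_ln_Y hS t.
have q2 : L2 P q.
  case: thI2 => [c3E|thI2].
    by rewrite /q c3E; apply: L2_linear; [exact: L2_signal|exact: L2_signal|].
  have -> : q = (fun w => translog c0 c1 c2 0 c4 (sg i1 w) (sg j1 w) (lY w) +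
      c3 * (mu_th b (cur t) m1 * mu_I b t m1 + mu_th b (cur t) m1 * la_I b t m1 * I w +
      la_th b (cur t) m1 * mu_I b t m1 * th w +
      la_th b (cur t) m1 * la_I b t m1 * (th w * I w))).
    by apply/funext => w; rewrite /q /latent_translog /translog /signal /=; rewrite -/th -/I; ring.
  apply: L2D; first by apply: L2_linear; [exact: L2_signal|exact: L2_signal|].
  apply: L2Z; apply: L2D; last exact: L2Z.
  by apply: L2D; [apply: L2D; [exact: L2_cst|exact: L2Z]|exact: L2Z].
have orth (g : R * R * R -> R) : measurable_fun setT g ->
    L1 P (fun w => q w * g (instr w)) -> Ex P (fun w => q w * g (instr w)) = 0.
  by move=> mg; apply: sigma_orthogonal q0 _ mg; [exact: measurable_instruments|exact: L2_L1].
have e2 := L2_errors hS i2; have f2 := L2_errors hS j2.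
have s2 := L2_signal hS i2; have r2 := L2_signal hS j2.
have fq : factors (primitives v) q.
  have fc c : factors (primitives v) (fun=> c : R) by exact: factors_cst.
  have fs k : factors (primitives v) (sg k) by exact: factors_signal.
  have fY : factors (primitives v) lY by exact: factors_ln_Y.
  by apply: factorsD; [repeat apply: factorsD => //; repeat apply: factorsM => //|exact: factorsM].
have mp1 : measurable_fun setT (fun z : R * R * R => z.1.1).
  exact: (measurableT_comp (f := fst) (g := fst)).
have mp2 : measurable_fun setT (fun z : R * R * R => z.1.2).
  exact: (measurableT_comp (f := snd) (g := fst)).
have q1 : Ex P q = 0.
  have := orth (fun=> 1) (measurable_cst _); under eq_Ex do rewrite mulr1.
  by apply; apply: L2_mul => //; exact: L2_cst.
have qY : Ex P (fun w => q w * lY w) = 0.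
  apply: (orth (fun z => ln z.2)); last exact: L2_mul.
  exact: (measurableT_comp (measurable_ln (R := R)) (g := snd)).
have qs k : loading b k != 0 -> Ex P (fun w => q w * noisy b v k w) = 0 ->
    Ex P (fun w => q w * latent v k w) = 0.
  have sk := L2_signal hS k; have ek := L2_errors hS k.
  move=> l0 qn; apply: Ex_signal_orthogonal => //; first exact: L2_L1.
    by apply: L2_mul => //; exact: L2_latent hS k.
  move: qn; have -> : (fun w => q w * noisy b v k w) = (fun w => q w * sg k w + q w * eps k w).
    by apply/funext => w; rewrite /noisy mulrDr.
  rewrite (ExD (L2_mul q2 sk) (L2_mul q2 ek)).
  by rewrite (Ex_latent_errors hS k fq (L2_L1 q2)) addr0.
have qth : Ex P (fun w => q w * th w) = 0.
  apply: (qs i2) => //; apply: (orth (fun z => z.1.1)) => //.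
  by apply: L2_mul => //; exact: L2_noisy hS i2.
have qI : Ex P (fun w => q w * I w) = 0.
  apply: (qs j2) => //; apply: (orth (fun z => z.1.2)) => //.
  by apply: L2_mul => //; exact: L2_noisy hS j2.
apply: (translog_orthogonal hS (t := t)) => //; first by right.
(* What remains is orthogonality to the interaction. The product of the two noisy instruments
   expands into signals and errors; terms with an error have mean zero, and orthogonality to 1 and
   to each latent log leaves the interaction alone. *)
case: thI2 => [|thI2]; [by left|right].
have fs k : factors (primitives v) (sg k) by exact: factors_signal.
have qsr : L1 P (fun w => q w * sg i2 w * sg j2 w).
  have : L1 P (fun w => q w * (mu_th b (cur t) m2 * mu_I b t m2 +
      mu_th b (cur t) m2 * la_I b t m2 * I w + la_th b (cur t) m2 * mu_I b t m2 * th w +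
      la_th b (cur t) m2 * la_I b t m2 * (th w * I w))).
    apply: L2_mul => //; apply: L2D; last exact: L2Z.
    by apply: L2D; [apply: L2D; [exact: L2_cst|exact: L2Z]|exact: L2Z].
  by congr L1; apply/funext => w; rewrite /signal /= -/th -/I; ring.
have ie := L2_L1 e2; have jf := L2_L1 f2.
have qse : L1 P (fun w => q w * sg j2 w * eps i2 w).
  apply: (err_L1 _ (primitives_errors hS i2)) => //; [exact: measurable_primitives|exact: factorsM|exact: L2_mul].
have qsf : L1 P (fun w => q w * sg i2 w * eps j2 w).
  apply: (err_L1 _ (primitives_errors hS j2)) => //; [exact: measurable_primitives|exact: factorsM|exact: L2_mul].
have ji : j2 != i2 by [].
have mpe : measurable_fun setT (fun w => (primitives v w, eps i2 w)).
  by apply/measurable_fun_pair; [exact: measurable_primitives|exact: measurable_errors].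
have fqe : factors (fun w => (primitives v w, eps i2 w)) (fun w => q w * eps i2 w).
  apply: factorsM; last by exists snd.
  by apply: factors_trans fq; exists fst.
have qef : L1 P (fun w => q w * eps i2 w * eps j2 w).
  by apply: (err_L1 mpe (pair_errors hS ji)) => //; exact: L2_mul.
have nE w : q w * (noisy b v i2 w * noisy b v j2 w) =
    q w * sg i2 w * sg j2 w + q w * sg j2 w * eps i2 w
    + (q w * sg i2 w * eps j2 w + q w * eps i2 w * eps j2 w).
  by rewrite /noisy; ring.
have i_n := L1D (L1D qsr qse) (L1D qsf qef).
have nn0 : Ex P (fun w => q w * (noisy b v i2 w * noisy b v j2 w)) = 0.
  apply: (orth (fun z => z.1.1 * z.1.2)); first exact: measurable_funM.
  by move: i_n; congr L1; apply/funext => w; rewrite nE.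
move: nn0; rewrite (eq_Ex P nE).
rewrite (ExD (L1D qsr qse) (L1D qsf qef)) (ExD qsr qse) (ExD qsf qef).
rewrite (Ex_latent_errors hS i2 (factorsM fq (fs j2)) (L2_mul q2 r2)).
rewrite (Ex_latent_errors hS j2 (factorsM fq (fs i2)) (L2_mul q2 s2)).
rewrite (err_Ex0 mpe (pair_errors hS ji) jf (Ex_errors hS j2) fqe (L2_mul q2 e2)) !addr0.
have q1' := L2_L1 q2; have ith := L2_mul q2 th2; have iI := L2_mul q2 I2.
have ithI := L2_mul q2 thI2.
pose a0 := mu_th b (cur t) m2 * mu_I b t m2.
pose a1 := mu_th b (cur t) m2 * la_I b t m2; pose a2 := la_th b (cur t) m2 * mu_I b t m2.
pose a3 := la_th b (cur t) m2 * la_I b t m2.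
have E w : q w * sg i2 w * sg j2 w =
    a0 * q w + a1 * (q w * I w) + a2 * (q w * th w) + a3 * (q w * (th w * I w)).
  by rewrite /signal /= -/th -/I /a0 /a1 /a2 /a3; ring.
rewrite (eq_Ex P E) (ExD (L1D (L1D (L1Z a0 q1') (L1Z a1 iI)) (L1Z a2 ith)) (L1Z a3 ithI)).
rewrite (ExD (L1D (L1Z a0 q1') (L1Z a1 iI)) (L1Z a2 ith)) (ExD (L1Z a0 q1') (L1Z a1 iI)).
rewrite (ExZ a0 q1') (ExZ a1 iI) (ExZ a2 ith) (ExZ a3 ithI) q1 qI qth !mulr0 !add0r.
move=> /eqP; rewrite mulf_eq0 /a3 mulf_eq0.
by rewrite [_ == 0](negPf load_i2) [_ == 0](negPf load_j2) => /eqP.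
Qed.

End Identification.

(** * Moments under observational equivalence *)

Section SameLaw.
Context (R : realType) (d d' d1 : measure_display).
Context (Omega : measurableType d) (Omega' : measurableType d') (S : measurableType d1).
Variables (P : probability Omega R) (P' : probability Omega' R).
Variables (X : Omega -> S) (X' : Omega' -> S).
Hypotheses (mX : measurable_fun setT X) (mX' : measurable_fun setT X').
Hypothesis XX' : forall B, measurable B -> P (X @^-1` B) = P' (X' @^-1` B).
HB.instance Definition _ := isMeasurableFun.Build _ _ _ _ X mX.
HB.instance Definition _ := isMeasurableFun.Build _ _ _ _ X' mX'.

Lemma same_law_Ex (F : S -> R) : measurable_fun setT F ->
  L1 P (fun w => F (X w)) -> L1 P' (fun w => F (X' w)) ->
  Ex P (fun w => F (X w)) = Ex P' (fun w => F (X' w)).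
Proof.
move=> mF iF iF'; have mF' : measurable_fun setT (EFin \o F) by exact/measurable_EFinP.
congr fine.
transitivity (\int[distribution P X]_o (F o)%:E)%E.
  by rewrite (integral_distribution (f := EFin \o F)).
transitivity (\int[distribution P' X']_o (F o)%:E)%E.
  by apply: eq_measure_integral => B mB _; exact: XX'.
by rewrite (integral_distribution (f := EFin \o F)).
Qed.

End SameLaw.

Section ObservationalEquivalence.
Context (R : realType) (T : nat).

Notation obs_space :=
  (T.-tuple R * T.+1.-tuple (2.-tuple R) * T.-tuple (2.-tuple R) * R)%type.

(** Measurements as functions of the observed vector, the form in which their moments transfer
    between structures. *)
Definition get_measurement (k : error_index T) (o : obs_space) : R :=
  match k with
  | inl (inl (t, m)) => tnth (tnth o.1.1.2 t) m
  | inl (inr (t, m)) => tnth (tnth o.1.2 t) m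
  | inr tt => o.2
  end.

Definition get_Y (t : 'I_T) (o : obs_space) : R := tnth o.1.1.1 t.

Lemma measurable_get_measurement k : measurable_fun setT (get_measurement k).
Proof.
have m1 : measurable_fun setT (fun o : obs_space => o.1.1.2).
  apply: (measurableT_comp (f := snd) (g := fun o : obs_space => o.1.1)) => //.
  exact: (measurableT_comp (f := fst) (g := fst)).
have m2 : measurable_fun setT (fun o : obs_space => o.1.2).
  exact: (measurableT_comp (f := snd) (g := fst)).
case: k => [[[t m]|[t m]]|[]] => //=.
- apply: (measurableT_comp (f := fun s => tnth s m)); first exact: measurable_tnth.
  by apply: (measurableT_comp (f := fun s => tnth s t)) => //; exact: measurable_tnth.
- apply: (measurableT_comp (f := fun s => tnth s m)); first exact: measurable_tnth.
  by apply: (measurableT_comp (f := fun s => tnth s t)) => //; exact: measurable_tnth.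
- exact: measurable_snd.
Qed.

Lemma measurable_get_Y t : measurable_fun setT (get_Y t).
Proof.
apply: (measurableT_comp (f := fun s => tnth s t)); first exact: measurable_tnth.
apply: (measurableT_comp (f := fst) (g := fun o : obs_space => o.1.1)) => //.
exact: (measurableT_comp (f := fst) (g := fst)).
Qed.

Lemma get_measurementE (d : measure_display) (Omega : measurableType d)
  (P : probability Omega R) (v : variables T P) k w :
  measurement v k w = get_measurement k (observed_vec v w).
Proof. by case: k => [[[t m]|[t m]]|[]] //=; rewrite !tnth_mktuple. Qed.

Lemma get_YE (d : measure_display) (Omega : measurableType d)
  (P : probability Omega R) (v : variables T P) t w :
  Y v t w = get_Y t (observed_vec v w).
Proof. by rewrite /get_Y tnth_mktuple. Qed.

Context (d d' : measure_display) (Omega : measurableType d) (Omega' : measurableType d').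
Variables (P : probability Omega R) (P' : probability Omega' R).
Variables (v : variables T P) (v' : variables T P').
Hypothesis vv' : observationally_equivalent v v'.

Lemma observed_Ex (F : obs_space -> R) : measurable_fun setT F ->
  L1 P (fun w => F (observed_vec v w)) -> L1 P' (fun w => F (observed_vec v' w)) ->
  Ex P (fun w => F (observed_vec v w)) = Ex P' (fun w => F (observed_vec v' w)).
Proof.
by apply: same_law_Ex => //; exact: measurable_observed_vec.
Qed.

End ObservationalEquivalence.

Section Pair.
Context (R : realType) (T : nat).
Context (d d' : measure_display) (Omega : measurableType d) (Omega' : measurableType d').
Variables (P : probability Omega R) (P' : probability Omega' R).
Variables (b b' : params R T) (v : variables T P) (v' : variables T P').
Hypotheses (hS : is_structure b v) (hS' : is_structure b' v').
Hypothesis vv' : observationally_equivalent v v'.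

Lemma same_Ex_measurement k : Ex P (measurement v k) = Ex P' (measurement v' k).
Proof.
have E : measurement v k = fun w => get_measurement k (observed_vec v w).
  by apply/funext => w; rewrite get_measurementE.
have E' : measurement v' k = fun w => get_measurement k (observed_vec v' w).
  by apply/funext => w; rewrite get_measurementE.
have i1 := L2_L1 (L2_measurement hS k); have i1' := L2_L1 (L2_measurement hS' k).
rewrite E E' in i1 i1' *; apply: (observed_Ex vv') => //.
exact: measurable_get_measurement.
Qed.

Lemma same_Ex_measurement2 k j :
  Ex P (fun w => measurement v k w * measurement v j w) =
  Ex P' (fun w => measurement v' k w * measurement v' j w).
Proof.
have i1 := L2_mul (L2_measurement hS k) (L2_measurement hS j).
have i1' := L2_mul (L2_measurement hS' k) (L2_measurement hS' j).
under eq_Ex do rewrite !get_measurementE.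
under [RHS]eq_Ex do rewrite !get_measurementE.
apply: (observed_Ex vv' (F := fun o => get_measurement k o * get_measurement j o)).
- by apply: measurable_funM; exact: measurable_get_measurement.
- by move: i1; congr L1; apply/funext => w; rewrite !get_measurementE.
- by move: i1'; congr L1; apply/funext => w; rewrite !get_measurementE.
Qed.

End Pair.

Lemma covarianceEx (R : realType) (d : measure_display) (Omega : measurableType d)
    (P : probability Omega R) (X W : Omega -> R) : L2 P X -> L2 P W ->
  covariance P X W = (Ex P (fun w => X w * W w) - Ex P X * Ex P W)%:E.
Proof.
move=> X2 W2.
have L1fun U : L1 P U -> U \in Lfun P 1 by move=> iU; exact/Lfun1_integrable.
rewrite covarianceE; [|exact/L1fun/L2_L1|exact/L1fun/L2_L1|exact/L1fun/L2_mul].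
have ExE U : L1 P U -> ('E_P[U] = (Ex P U)%:E)%E.
  by move=> iU; rewrite unlock /Ex /Rintegral fineK// integrable_fin_num.
rewrite (ExE _ (L2_L1 X2)) (ExE _ (L2_L1 W2)) (_ : (X * W)%R = (fun w => X w * W w))//.
by rewrite (ExE _ (L2_mul X2 W2)) -EFinM -EFinB.
Qed.

Definition cov_latent (R : realType) (T : nat) (d : measure_display)
    (Omega : measurableType d) (P : probability Omega R) (v : variables T P)
    (k j : error_index T) : R :=
  Ex P (fun w => latent v k w * latent v j w) - Ex P (latent v k) * Ex P (latent v j).

Section Loadings.
Context (R : realType) (T : nat) (d : measure_display) (Omega : measurableType d).
Variables (P : probability Omega R) (b : params R T) (v : variables T P).
Hypothesis hS : is_structure b v.

Lemma cov_measurement k j : k != j ->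
  Ex P (fun w => measurement v k w * measurement v j w)
    - Ex P (measurement v k) * Ex P (measurement v j) =
  loading b k * loading b j * cov_latent v k j.
Proof.
move=> kj; rewrite (Ex_measurement2 hS kj) !(Ex_measurement hS).
have lk := L2_latent hS k; have lj := L2_latent hS j.
have lk1 := L2_L1 lk; have lj1 := L2_L1 lj; have lkj := L2_mul lk lj.
have c1 := L1_cst P.
have sE i : Ex P (signal b v i) = intercept b i + loading b i * Ex P (latent v i).
  have i1 := L2_L1 (L2_latent hS i).
  by rewrite /signal (ExD (c1 _) (L1Z _ i1)) Ex_cst (ExZ _ i1).
have -> : Ex P (fun w => signal b v k w * signal b v j w) =
    Ex P (fun w => intercept b k * intercept b j
      + intercept b k * loading b j * latent v j w
      + intercept b j * loading b k * latent v k w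
      + loading b k * loading b j * (latent v k w * latent v j w)).
  by apply: eq_Ex => w; rewrite /signal; ring.
rewrite (ExD (L1D (L1D (c1 _) (L1Z _ lj1)) (L1Z _ lk1)) (L1Z _ lkj)).
rewrite (ExD (L1D (c1 _) (L1Z _ lj1)) (L1Z _ lk1)) (ExD (c1 _) (L1Z _ lj1)).
by rewrite Ex_cst (ExZ _ lj1) (ExZ _ lk1) (ExZ _ lkj) !sE /cov_latent; ring.
Qed.

Lemma covariance_latent k j :
  covariance P (latent v k) (latent v j) = (cov_latent v k j)%:E.
Proof. exact: covarianceEx (L2_latent hS k) (L2_latent hS j). Qed.

End Loadings.

Lemma measurable_translog (R : realType) (d : measure_display) (S : measurableType d)
    (c0 c1 c2 c3 c4 : R) (f g h : S -> R) :
  measurable_fun setT f -> measurable_fun setT g -> measurable_fun setT h ->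
  measurable_fun setT (fun o => translog c0 c1 c2 c3 c4 (f o) (g o) (h o)).
Proof.
move=> mf mg mh; apply: measurable_funD; last exact: measurable_funM.
apply: measurable_funD; last by apply: measurable_funM => //; exact: measurable_funM.
apply: measurable_funD; last exact: measurable_funM.
by apply: measurable_funD => //; exact: measurable_funM.
Qed.

(** * Equality of the transformed parameters *)

Section Subset.
Context (R : realType) (T : nat).
Context (d d' : measure_display) (Omega : measurableType d) (Omega' : measurableType d').
Variables (P : probability Omega R) (P' : probability Omega' R).
Variables (b b' : params R T) (v : variables T P) (v' : variables T P').
Hypotheses (hS : is_structure b v) (hS' : is_structure b' v').
Hypothesis vv' : observationally_equivalent v v'.

(** The covariances of [k] and [k1] with a third measurement [j] are in the ratio of their loadings,
    as both measure the same latent variable. The comparison is cross-multiplied, since nonvanishing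
    covariance is assumed in the first structure only. Means then give the intercepts. *)
Lemma relative_loading k k1 j : k != j -> k1 != j ->
  latent v k = latent v k1 -> latent v' k = latent v' k1 ->
  loading b k1 != 0 -> loading b' k1 != 0 -> loading b j != 0 ->
  covariance P (latent v k1) (latent v j) != 0%E ->
  loading b k / loading b k1 = loading b' k / loading b' k1 /\
  intercept b k - loading b k / loading b k1 * intercept b k1 =
  intercept b' k - loading b' k / loading b' k1 * intercept b' k1.
Proof.
move=> kj k1j vk vk' l1 l1' lj; rewrite (covariance_latent hS) eqe => c0.
have c' : cov_latent v' k j = cov_latent v' k1 j by rewrite /cov_latent vk'.
have c : cov_latent v k j = cov_latent v k1 j by rewrite /cov_latent vk.
have := cov_measurement hS kj; have := cov_measurement hS k1j.
rewrite !(same_Ex_measurement hS hS' vv') !(same_Ex_measurement2 hS hS' vv').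
rewrite (cov_measurement hS' kj) (cov_measurement hS' k1j) c c'.
set C := cov_latent v k1 j in c0 *; set C' := cov_latent v' k1 j => E1 E.
have ratio : loading b k / loading b k1 = loading b' k / loading b' k1.
  apply/eqP; rewrite eqr_div//; apply/eqP.
  apply: (@mulIf _ (loading b j * C)); first by rewrite mulf_neq0.
  transitivity ((loading b k * loading b j * C) * loading b' k1); first by ring.
  rewrite -E; transitivity ((loading b' k1 * loading b' j * C') * loading b' k); first by ring.
  by rewrite E1; ring.
split => //.
have EZ (e : measure_display) (W : measurableType e) (Q : probability W R)
    (a : params R T) (u : variables T Q) : is_structure a u ->
    latent u k = latent u k1 -> loading a k1 != 0 ->
    intercept a k - loading a k / loading a k1 * intercept a k1 =
    Ex Q (measurement u k) - loading a k / loading a k1 * Ex Q (measurement u k1).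
  move=> hu uk a1; rewrite !(Ex_measurement hu).
  have sE i : Ex Q (signal a u i) = intercept a i + loading a i * Ex Q (latent u i).
    have i1 := L2_L1 (L2_latent hu i).
    by rewrite /signal (ExD (L1_cst Q _) (L1Z _ i1)) Ex_cst (ExZ _ i1).
  by rewrite !sE uk; field.
by rewrite (EZ _ _ _ _ _ hS)// (EZ _ _ _ _ _ hS')// !(same_Ex_measurement hS hS' vv') ratio.
Qed.

(** [k] is general so that it covers the measurements of theta_t and also Q when t = T. The partner
    [j] measures the different variable supplied by relevance, hence has a different error. *)
Lemma relevant_th (t : 'I_T.+1) (k : error_index T) : latent v k = ln_theta v t ->
  (forall s m, s != t -> k != inl (inl (s, m))) -> (forall s m, k != inl (inr (s, m))) ->
  exists j, [/\ k != j, inl (inl (t, m1)) != j, loading b j != 0 &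
    covariance P (ln_theta v t) (latent v j) != 0%E].
Proof.
move=> vk kth kI; have [la0 lI0 _] := str_admissible hS.
have [[s c]|[s st c]] := (str_relevance hS).1 t.
  by exists (inl (inr (s, m1))); split => //; exact: lI0.
exists (inl (inl (s, m1))); split => //; first exact: kth.
  by apply/eqP => -[] ts; rewrite ts eqxx in st.
exact: la0.
Qed.

Lemma relevant_I (t : 'I_T) (m : 'I_2) :
  exists j, [/\ inl (inr (t, m)) != j, inl (inr (t, m1)) != j, loading b j != 0 &
    covariance P (ln_inv v t) (latent v j) != 0%E].
Proof.
have [la0 lI0 _] := str_admissible hS.
have [[s c]|[s st c]] := (str_relevance hS).2 t.
  by exists (inl (inl (s, m1))); split => //; exact: la0.
exists (inl (inr (s, m1))); split => //.
- by apply/eqP => -[] ts; rewrite ts eqxx in st.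
- by apply/eqP => -[] ts; rewrite ts eqxx in st.
- exact: lI0.
Qed.

(** The moments of the second structure depend on the observed law only, so they hold under the
    first one too. There the two solutions are subtracted. *)
Lemma same_investment t :
  [/\ beta0 (transform b) t = beta0 (transform b') t,
      beta1 (transform b) t = beta1 (transform b') t &
      beta2 (transform b) t = beta2 (transform b') t].
Proof.
have [p0 pth pY] := investment_moments t hS.
have [p0' pth' pY'] := investment_moments t hS'.
set c0 := - beta0 (transform b) t in p0 pth pY.
set c1 := - beta1 (transform b) t in p0 pth pY.
set c4 := - beta2 (transform b) t in p0 pth pY.
set c0' := - beta0 (transform b') t in p0' pth' pY'.
set c1' := - beta1 (transform b') t in p0' pth' pY'.
set c4' := - beta2 (transform b') t in p0' pth' pY'.
have q2 (a0 a1 a2 a4 : R) : L2 P (obs_translog v t a0 a1 a2 0 a4).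
  by apply: L2_linear; [exact: L2_measurement hS _|exact: L2_measurement hS _|exact: L2_ln_Y hS t].
have q2' : L2 P' (obs_translog v' t c0' c1' 1 0 c4').
  by apply: L2_linear; [exact: L2_measurement hS' _|exact: L2_measurement hS' _|exact: L2_ln_Y hS' t].
have tr (h : _ -> R) : measurable_fun setT h ->
    L2 P (fun w => h (observed_vec v w)) -> L2 P' (fun w => h (observed_vec v' w)) ->
    Ex P' (fun w => obs_translog v' t c0' c1' 1 0 c4' w * h (observed_vec v' w)) = 0 ->
    Ex P (fun w => obs_translog v t c0 c1 1 0 c4 w * h (observed_vec v w)) = 0 ->
    Ex P (fun w => obs_translog v t (c0 - c0') (c1 - c1') 0 0 (c4 - c4') w * h (observed_vec v w)) = 0.
  move=> mh h2 h2' E' E.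
  pose F o := translog c0' c1' 1 0 c4' (get_measurement (th_ix t m1) o)
    (get_measurement (I_ix t m1) o) (ln (get_Y t o)) * h o.
  have mF : measurable_fun setT F.
    apply: measurable_funM => //; apply: measurable_translog.
    - exact: measurable_get_measurement.
    - exact: measurable_get_measurement.
    - exact: (measurableT_comp (measurable_ln (R := R)) (measurable_get_Y t)).
  have FE : (fun w => F (observed_vec v w)) =
      (fun w => obs_translog v t c0' c1' 1 0 c4' w * h (observed_vec v w)).
    by apply/funext => w; rewrite /obs_translog !get_measurementE /ln_Y get_YE.
  have FE' : (fun w => F (observed_vec v' w)) =
      (fun w => obs_translog v' t c0' c1' 1 0 c4' w * h (observed_vec v' w)).
    by apply/funext => w; rewrite /obs_translog !get_measurementE /ln_Y get_YE.
  have iF : L1 P (fun w => F (observed_vec v w)) by rewrite FE; exact: L2_mul.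
  have iF' : L1 P' (fun w => F (observed_vec v' w)) by rewrite FE'; exact: L2_mul.
  have := observed_Ex vv' mF iF iF'; rewrite FE FE' E' => E0.
  transitivity (Ex P (fun w => obs_translog v t c0 c1 1 0 c4 w * h (observed_vec v w)) -
    Ex P (fun w => obs_translog v t c0' c1' 1 0 c4' w * h (observed_vec v w))); last first.
    by rewrite E E0 subrr.
  rewrite -(ExB (L2_mul (q2 _ _ _ _) h2) (L2_mul (q2 _ _ _ _) h2)).
  by apply: eq_Ex => w; rewrite /obs_translog /translog; ring.
have [] := @linear_unique _ _ _ _ _ _ _ t hS (c0 - c0') (c1 - c1') (c4 - c4').
- by apply: (tr (fun=> 1)) => //; exact: L2_cst.
- under eq_Ex do rewrite (get_measurementE _ (th_ix t ord_max)).
  apply: (tr (get_measurement (th_ix t ord_max))).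
  + exact: measurable_get_measurement.
  + have := L2_measurement hS (th_ix t ord_max).
    by congr L2; apply/funext => w; rewrite get_measurementE.
  + have := L2_measurement hS' (th_ix t ord_max).
    by congr L2; apply/funext => w; rewrite get_measurementE.
  + by move: pth'; under eq_Ex do rewrite (get_measurementE _ (th_ix t ord_max)).
  + by move: pth; under eq_Ex do rewrite (get_measurementE _ (th_ix t ord_max)).
- under eq_Ex do rewrite /ln_Y get_YE.
  apply: (tr (fun o => ln (get_Y t o))).
  + exact: (measurableT_comp (measurable_ln (R := R)) (measurable_get_Y t)).
  + by have := L2_ln_Y hS t; congr L2; apply/funext => w; rewrite /ln_Y get_YE.
  + by have := L2_ln_Y hS' t; congr L2; apply/funext => w; rewrite /ln_Y get_YE.
  + by move: pY'; under eq_Ex do rewrite /ln_Y get_YE.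
  + by move: pY; under eq_Ex do rewrite /ln_Y get_YE.
- rewrite /c0 /c0' /c1 /c1' /c4 /c4' => e0 e1 e4.
  by split; apply/eqP; rewrite -eqr_opp -subr_eq0; apply/eqP.
Qed.

(** The hypothesis ensures that the interaction in the difference of the two solutions either
    cancels or is square-integrable in the first structure, where the comparison takes place. *)
Lemma same_production_if t : gamma3 (transform b) t = gamma3 (transform b') t \/ gamma3 b t != 0 ->
  [/\ a_ (transform b) t = a_ (transform b') t,
      gamma1 (transform b) t = gamma1 (transform b') t,
      gamma2 (transform b) t = gamma2 (transform b') t &
      gamma3 (transform b) t = gamma3 (transform b') t].
Proof.
move=> g3; have [e0 e1 e2] := same_investment t.
have [k kE] := production_moments t hS; have [k' kE'] := production_moments t hS'.
have b20 : beta2 (transform b) t != 0.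
  by have [_ lI b2] := str_admissible hS; rewrite /= mulf_neq0.
move: kE kE'; rewrite -e0 -e1 -e2.
set c0 := a_ _ _ - k * _; set c1 := gamma1 _ _ - k * _; set c2 := gamma2 _ _ + k.
set c3 := gamma3 _ _ in g3 *; set c4 := - (k * _).
set c0' := a_ _ _ - k' * _; set c1' := gamma1 _ _ - k' * _; set c2' := gamma2 _ _ + k'.
set c3' := gamma3 _ _ in g3 *; set c4' := - (k' * _) => kE kE'.
have [] := @translog_unique _ _ _ _ _ _ _ t hS (c0 - c0') (c1 - c1') (c2 - c2') (c3 - c3') (c4 - c4').
- by case: g3 => [->|]; [left; rewrite subrr|right].
- move=> B mB.
  set ii := th_ix t ord_max; set jj := I_ix t ord_max.
  have mO : measurable (obs_instruments v ii jj t @^-1` B).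
    exact: measurable_preim (measurable_obs_instruments v ii jj t) mB.
  have mO' : measurable (obs_instruments v' ii jj t @^-1` B).
    exact: measurable_preim (measurable_obs_instruments v' ii jj t) mB.
  pose g := fun o => (get_measurement ii o, get_measurement jj o, get_Y t o) : R * R * R.
  have mg : measurable_fun setT g.
    apply/measurable_fun_pair; last exact: measurable_get_Y.
    by apply/measurable_fun_pair; exact: measurable_get_measurement.
  pose F o := (get_measurement (next_ix t) o - translog c0' c1' c2' c3' c4'
    (get_measurement (th_ix t m1) o) (get_measurement (I_ix t m1) o) (ln (get_Y t o)))
     * \1_(g @^-1` B) o.
  have mF : measurable_fun setT F.
    apply: measurable_funM; last by apply: measurable_indic; exact: measurable_preim mg mB.
    apply: measurable_funB; first exact: measurable_get_measurement.
    apply: measurable_translog.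
    - exact: measurable_get_measurement.
    - exact: measurable_get_measurement.
    - exact: (measurableT_comp (measurable_ln (R := R)) (measurable_get_Y t)).
  have FE : (fun w => F (observed_vec v w)) =
      (fun w => (measurement v (next_ix t) w - obs_translog v t c0' c1' c2' c3' c4' w) *
        \1_(obs_instruments v ii jj t @^-1` B) w).
    apply/funext => w; rewrite /F /obs_translog !get_measurementE /ln_Y get_YE; congr (_ * _).
    rewrite !indicE; congr ((nat_of_bool _)%:R).
    by apply/idP/idP; rewrite !inE /= /obs_instruments /g !get_measurementE get_YE.
  have FE' : (fun w => F (observed_vec v' w)) =
      (fun w => (measurement v' (next_ix t) w - obs_translog v' t c0' c1' c2' c3' c4' w) *
        \1_(obs_instruments v' ii jj t @^-1` B) w).
    apply/funext => w; rewrite /F /obs_translog !get_measurementE /ln_Y get_YE; congr (_ * _).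
    rewrite !indicE; congr ((nat_of_bool _)%:R).
    by apply/idP/idP; rewrite !inE /= /obs_instruments /g !get_measurementE get_YE.
  have iT a0 a1 a2 a3 a4 : L1 P (obs_translog v t a0 a1 a2 a3 a4).
    by apply: (L1_translog hS); exact: L2_measurement hS _.
  have iT' : L1 P' (obs_translog v' t c0' c1' c2' c3' c4').
    by apply: (L1_translog hS'); exact: L2_measurement hS' _.
  have iZ := L2_L1 (L2_measurement hS (next_ix t)).
  have iZ' := L2_L1 (L2_measurement hS' (next_ix t)).
  have iF : L1 P (fun w => F (observed_vec v w)).
    by rewrite FE; apply: L1_indic => //; exact: L1B.
  have iF' : L1 P' (fun w => F (observed_vec v' w)).
    by rewrite FE'; apply: L1_indic => //; exact: L1B.
  have := observed_Ex vv' mF iF iF'; rewrite FE FE' kE'// => E0.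
  transitivity (Ex P (fun w => (measurement v (next_ix t) w -
        obs_translog v t c0' c1' c2' c3' c4' w) * \1_(obs_instruments v ii jj t @^-1` B) w) -
      Ex P (fun w => (measurement v (next_ix t) w -
        obs_translog v t c0 c1 c2 c3 c4 w) * \1_(obs_instruments v ii jj t @^-1` B) w)); last first.
    by rewrite kE// E0 subrr.
  rewrite -(ExB (L1_indic mO (L1B iZ (iT _ _ _ _ _))) (L1_indic mO (L1B iZ (iT _ _ _ _ _)))).
  by apply: eq_Ex => w; rewrite /obs_translog /translog; ring.
- move=> h0 h1 h2 h3 h4.
  (* The coefficients of ln Y agree and the transformed beta2 is nonzero, so the nuisance constants
     agree; they can then be cancelled from the other coefficients. *)
  have kk : k = k'.
    apply: (mulIf b20); apply/eqP; rewrite -subr_eq0 -oppr_eq0; apply/eqP.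
    by rewrite -h4 /c4 /c4'; ring.
  have sub (x y : R) : x - y = 0 -> x = y by move/eqP; rewrite subr_eq0 => /eqP.
  split; apply: sub => //.
  + by rewrite -h0 /c0 /c0' kk; ring.
  + by rewrite -h1 /c1 /c1' kk; ring.
  + by rewrite -h2 /c2 /c2' kk; ring.
Qed.

End Subset.

Lemma observationally_equivalent_sym (R : realType) (T : nat) (d d' : measure_display)
    (Omega : measurableType d) (Omega' : measurableType d')
    (P : probability Omega R) (P' : probability Omega' R)
    (v : variables T P) (v' : variables T P') :
  observationally_equivalent v v' -> observationally_equivalent v' v.
Proof. by move=> vv' S mS; rewrite vv'. Qed.

Lemma observationally_equivalent_transform (R : realType) (T : nat) (d d' : measure_display)
    (Omega : measurableType d) (Omega' : measurableType d')
    (P : probability Omega R) (P' : probability Omega' R)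
    (b b' : params R T) (v : variables T P) (v' : variables T P') :
  is_structure b v -> is_structure b' v' -> observationally_equivalent v v' ->
  transform b' = transform b.
Proof.
move=> hS hS' vv'; have v'v := observationally_equivalent_sym vv'.
have [th0 I0 _] := str_admissible hS; have [th0' I0' _] := str_admissible hS'.
have th t m := relevant_th hS (t := t) (k := inl (inl (t, m))) erefl.
have Eth t m : la_th b t m / la_th b t m1 = la_th b' t m / la_th b' t m1 /\
    mu_th b t m - la_th b t m / la_th b t m1 * mu_th b t m1 =
    mu_th b' t m - la_th b' t m / la_th b' t m1 * mu_th b' t m1.
  have [|//|j [kj k1j lj c]] := th t m.
    by move=> s n st; apply/eqP => -[] ts; rewrite ts eqxx in st.
  by apply: (relative_loading hS hS' vv' (k := inl (inl (t, m))) (k1 := inl (inl (t, m1))) kj k1j) => //;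
    [exact: th0|exact: th0'].
have EI t m : la_I b t m / la_I b t m1 = la_I b' t m / la_I b' t m1 /\
    mu_I b t m - la_I b t m / la_I b t m1 * mu_I b t m1 =
    mu_I b' t m - la_I b' t m / la_I b' t m1 * mu_I b' t m1.
  have [j [kj k1j lj c]] := relevant_I hS t m.
  by apply: (relative_loading hS hS' vv' (k := inl (inr (t, m))) (k1 := inl (inr (t, m1))) kj k1j) => //;
    [exact: I0|exact: I0'].
have [EQ EQ'] : rho1 b / la_th b ord_max m1 = rho1 b' / la_th b' ord_max m1 /\
    rho0 b - rho1 b / la_th b ord_max m1 * mu_th b ord_max m1 =
    rho0 b' - rho1 b' / la_th b' ord_max m1 * mu_th b' ord_max m1.
  have [//|//|j [kj k1j lj c]] := relevant_th hS (t := ord_max) (k := inr tt) erefl.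
  by apply: (relative_loading hS hS' vv' (k := inr tt) (k1 := inl (inl (ord_max, m1))) kj k1j) => //;
    [exact: th0|exact: th0'].
have Einv := same_investment hS' hS v'v.
have Eprod t : [/\ a_ (transform b') t = a_ (transform b) t,
    gamma1 (transform b') t = gamma1 (transform b) t,
    gamma2 (transform b') t = gamma2 (transform b) t &
    gamma3 (transform b') t = gamma3 (transform b) t].
  (* The comparison runs in whichever structure has a nonzero interaction coefficient; if neither
     has one, the transformed coefficients agree because both are 0. *)
  have [g3|g3] := eqVneq (gamma3 b' t) 0; last by apply: (same_production_if hS' hS v'v); right.
  have [g3'|g3'] := eqVneq (gamma3 b t) 0.
    by apply: (same_production_if hS' hS v'v); left; rewrite /= g3 g3' !mulr0.
  by have [-> -> -> ->] := same_production_if hS hS' vv' (t := t) (or_intror g3').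
rewrite {1}/transform [RHS]/transform; congr Params.
- by apply/funext => t; apply/funext => m; have [_ ->] := Eth t m.
- by apply/funext => t; apply/funext => m; have [-> _] := Eth t m.
- by apply/funext => t; apply/funext => m; have [_ ->] := EI t m.
- by apply/funext => t; apply/funext => m; have [-> _] := EI t m.
- by move: EQ'; rewrite ![_ / _ * _]mulrAC.
- by rewrite EQ.
- by apply/funext => t; have [] := Einv t.
- by apply/funext => t; have [] := Einv t.
- by apply/funext => t; have [] := Einv t.
- by apply/funext => t; have [] := Eprod t.
- by apply/funext => t; have [] := Eprod t.
- by apply/funext => t; have [] := Eprod t.
- by apply/funext => t; have [] := Eprod t.
Qed.

(** * Observationally equivalent structures *)

Lemma measurable_exp_affine (R : realType) (d : measure_display) (S : measurableType d)
    (p q : R) (X : S -> R) : measurable_fun setT X ->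
  measurable_fun setT (fun w => expR (p + q * ln (X w))).
Proof.
move=> mX; apply: (measurableT_comp (measurable_expR (R := R))).
apply: measurable_funD => //; apply: measurable_funM => //.
exact: (measurableT_comp (measurable_ln (R := R))).
Qed.

(** h(G) may generate a smaller sigma-algebra than [G]. The defining integrals restrict to it, but
    measurability of the version does not, hence the [factors] hypothesis. *)
Lemma cond_expectation_scale (R : realType) (d d1 d2 : measure_display)
    (Omega : measurableType d) (S1 : measurableType d1) (S2 : measurableType d2)
    (P : probability Omega R) (G : Omega -> S1) (h : S1 -> S2) (X W : Omega -> R) (s : R) :
  measurable_fun setT G -> measurable_fun setT h -> is_cond_expectation P G X W ->
  factors (fun w => h (G w)) (fun w => s * W w) ->
  is_cond_expectation P (fun w => h (G w)) (fun w => s * X w) (fun w => s * W w).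
Proof.
move=> mG mh [iX iW mW XW] [f mf fW]; split.
- exact: L1Z.
- exact: L1Z.
- move=> A mA; exists (f @^-1` A); first exact: measurable_preim.
  by rewrite setTI; apply/seteqP; split => w; rewrite /preimage /= -fW.
- move=> E [B mB]; rewrite setTI => BE.
  have mhB : measurable (h @^-1` B) by exact: measurable_preim.
  have EG : g_sigma_algebra_preimage G E by exists (h @^-1` B) => //; rewrite setTI.
  have mE : measurable E by case: EG => C mC <-; rewrite setTI; exact: measurable_preim.
  have -> : (\int[P]_(w in E) (s * X w)%:E = s%:E * \int[P]_(w in E) (X w)%:E)%E.
    by rewrite -integralZl//; exact: integrableS iX.
  have -> : (\int[P]_(w in E) (s * W w)%:E = s%:E * \int[P]_(w in E) (W w)%:E)%E.
    by rewrite -integralZl//; exact: integrableS iW.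
  by rewrite XW.
Qed.

(** * The reparametrized structure *)

Section Reparametrization.
Context (R : realType) (T : nat) (d : measure_display) (Omega : measurableType d).
Variables (P : probability Omega R) (b b' : params R T) (v : variables T P).
Hypotheses (hS : is_structure b v) (hb' : admissible b').
Hypothesis bb' : transform b' = transform b.

Definition mfun_of (f : Omega -> R) (mf : measurable_fun setT f) : {RV P >-> R} :=
  HB.pack_for {mfun Omega >-> R} f (isMeasurableFun.Build _ _ _ _ f mf).

(** Shift and scale solve mu' + la' ln theta' = mu + la ln theta for ln theta', at the first
    measurement; likewise for investment. *)
Definition shift_th t : R := (mu_th b t m1 - mu_th b' t m1) / la_th b' t m1.
Definition scale_th t : R := la_th b t m1 / la_th b' t m1.
Definition shift_I t : R := (mu_I b t m1 - mu_I b' t m1) / la_I b' t m1.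
Definition scale_I t : R := la_I b t m1 / la_I b' t m1.

Let hb : admissible b := str_admissible hS.

Lemma measurable_scaled (q : R) (X : {RV P >-> R}) : measurable_fun setT (fun w => q * X w).
Proof. by apply: measurable_funM => //; exact: (measurable_funP X). Qed.

(** The shocks are scaled like the left sides of their equations. The measurement errors are kept,
    because all signals are preserved. *)
Definition new_variables : variables T P := {|
  theta := fun t => mfun_of (measurable_exp_affine (shift_th t) (scale_th t)
    (measurable_funP (theta v t)));
  Defs.inv := fun t => mfun_of (measurable_exp_affine (shift_I t) (scale_I t)
    (measurable_funP (Defs.inv v t)));
  Y := Y v;
  Z_th := Z_th v;
  Z_I := Z_I v;
  Q := Q v;
  eps_th := eps_th v;
  eps_I := eps_I v;
  eta_th := fun t => mfun_of (measurable_scaled (scale_th (nxt t)) (eta_th v t));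
  eta_I := fun t => mfun_of (measurable_scaled (scale_I t) (eta_I v t));
  eta_Q := eta_Q v |}.

Local Notation v' := new_variables.

Lemma new_ln_theta t w : ln_theta v' t w = shift_th t + scale_th t * ln_theta v t w.
Proof. by rewrite /ln_theta /= expRK. Qed.

Lemma new_ln_inv t w : ln_inv v' t w = shift_I t + scale_I t * ln_inv v t w.
Proof. by rewrite /ln_inv /= expRK. Qed.

Lemma new_errors : errors v' = errors v.
Proof. by apply/funext => -[[[t m]|[t m]]|[]]. Qed.

(** For first measurements this is the choice of shift and scale. It extends to the others and to Q
    because relative loadings and intercepts are part of the common transform. *)
Lemma new_signal k w : signal b' v' k w = signal b v k w.
Proof.
have [th0 I0 _] := hb; have [th0' I0' _] := hb'.
case: k => [[[t m]|[t m]]|[]]; rewrite /signal /= ?new_ln_theta ?new_ln_inv.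
- have El := congr1 (fun a => la_th a t m) bb'; have Em := congr1 (fun a => mu_th a t m) bb'.
  rewrite /= in El Em.
  have -> : la_th b' t m = la_th b t m / la_th b t m1 * la_th b' t m1.
    by rewrite -El mulfVK.
  have -> : mu_th b' t m = mu_th b t m - la_th b t m / la_th b t m1 * mu_th b t m1 +
      la_th b t m / la_th b t m1 * mu_th b' t m1.
    by rewrite -Em El subrK.
  by rewrite /shift_th /scale_th; field; rewrite th0 th0'.
- have El := congr1 (fun a => la_I a t m) bb'; have Em := congr1 (fun a => mu_I a t m) bb'.
  rewrite /= in El Em.
  have -> : la_I b' t m = la_I b t m / la_I b t m1 * la_I b' t m1.
    by rewrite -El mulfVK.
  have -> : mu_I b' t m = mu_I b t m - la_I b t m / la_I b t m1 * mu_I b t m1 +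
      la_I b t m / la_I b t m1 * mu_I b' t m1.
    by rewrite -Em El subrK.
  by rewrite /shift_I /scale_I; field; rewrite I0 I0'.
- have El := congr1 (fun a => rho1 a) bb'; have Em := congr1 (fun a => rho0 a) bb'.
  rewrite /= in El Em.
  have E1 : rho1 b' = rho1 b / la_th b ord_max m1 * la_th b' ord_max m1.
    by rewrite -El mulfVK.
  have -> : rho0 b' = rho0 b - rho1 b * mu_th b ord_max m1 / la_th b ord_max m1 +
      rho1 b' * mu_th b' ord_max m1 / la_th b' ord_max m1.
    by rewrite -Em subrK.
  by rewrite E1 /shift_th /scale_th; field; rewrite th0 th0'.
Qed.

Lemma new_latent_translog t c0 c1 c2 c3 c4 w :
  latent_translog b' v' t c0 c1 c2 c3 c4 w = latent_translog b v t c0 c1 c2 c3 c4 w.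
Proof. by rewrite /latent_translog !new_signal. Qed.

(** Times the first loading, each residual is the translog function of the signals with transformed
    coefficients. Signals and coefficients are the same in both structures. *)
Lemma new_shock_I t w : shock_I b' v' t w = scale_I t * shock_I b v t w.
Proof.
have [_ I0' _] := hb'; apply: (mulfI (I0' t m1)).
rewrite -(latent_investment v' t w hb') bb' new_latent_translog (latent_investment v t w hb).
by rewrite /scale_I; field.
Qed.

Lemma new_shock_th t w : shock_th b' v' t w = scale_th (nxt t) * shock_th b v t w.
Proof.
have [th0' _ _] := hb'; apply: (mulfI (th0' (nxt t) m1)).
(* A zero control term is added to make [latent_production] applicable with kappa = 0. *)
have E (a : params R T) (u : variables T P) : shock_th a u t w = shock_th a u t w - 0 * shock_I a u t w.
  by rewrite mul0r subr0.
rewrite E -(latent_production v' t 0 w hb') bb' new_latent_translog !mulr0 !mul0r.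
have := latent_production v t 0 w hb; rewrite !mulr0 !mul0r subr0 => L.
by rewrite new_signal L /scale_th; field.
Qed.

Lemma new_model_equations : model_equations b' v'.
Proof.
have [posth [posI [posY [eth [eZth [eZI [eI eQ]]]]]]] := str_equations hS.
split; first by move=> t; apply: aeW => w /=; exact: expR_gt0.
split; first by move=> t; apply: aeW => w /=; exact: expR_gt0.
split; first exact: posY.
split.
  move=> t; apply: filterS (shock_thE hS t) => w E.
  have := new_shock_th t w; rewrite E {1}/shock_th => /eqP; rewrite subr_eq => /eqP ->.
  by rewrite addrC.
split.
  move=> t m; apply: filterS (eZth t m) => w E.
  have := new_signal (inl (inl (t, m))) w; rewrite /signal /= => ->; exact: E.
split.
  move=> t m; apply: filterS (eZI t m) => w E.
  have := new_signal (inl (inr (t, m))) w; rewrite /signal /= => ->; exact: E.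
split.
  move=> t; apply: filterS (shock_IE hS t) => w E.
  have := new_shock_I t w; rewrite E {1}/shock_I => /eqP; rewrite subr_eq => /eqP ->.
  by rewrite addrC.
apply: filterS eQ => w E.
have := new_signal (inr tt) w; rewrite /signal /= => ->; exact: E.
Qed.

Lemma new_cond_independent : cond_errors_independent v'.
Proof.
move=> A B mA mB; rewrite new_errors.
pose g (m : T.+1.-tuple R * T.-tuple R) :=
  ([tuple expR (shift_th t + scale_th t * ln (tnth m.1 t)) | t < T.+1],
   [tuple expR (shift_I t + scale_I t * ln (tnth m.2 t)) | t < T]).
have mg : measurable_fun setT g.
  apply/measurable_fun_pair; apply: measurable_mktuple => t.
    apply: measurable_exp_affine.
    apply: (measurableT_comp (f := fun s => tnth s t) (g := fst)) => //.
    exact: measurable_tnth.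
  apply: measurable_exp_affine.
  apply: (measurableT_comp (f := fun s => tnth s t) (g := snd)) => //.
  exact: measurable_tnth.
have gE w : latent_vec v' w = g (latent_vec v w).
  by rewrite /g /latent_vec /=; congr (_, _); apply: eq_from_tnth => t; rewrite !tnth_mktuple.
have -> : latent_vec v' @^-1` B = latent_vec v @^-1` (g @^-1` B).
  by apply/seteqP; split => w; rewrite /preimage /= gE.
by apply: (str_cond_independent hS) => //; exact: measurable_preim.
Qed.

Lemma has_moments_affine (p q : R) (X : Omega -> R) :
  has_moments P X -> has_moments P (fun w => p + q * X w).
Proof.
have aff (r : R) : 1 <= r -> X \in Lfun P r%:E -> (fun w => p + q * X w) \in Lfun P r%:E.
  move=> r1 Xr; have r1' : (1 <= r%:E)%E by rewrite lee_fin.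
  have -> : (fun w => p + q * X w) = cst p + (q \o* X).
    by apply/funext => w; rewrite /= mulrC.
  apply: (Lfun_addr_closed P r1').2; first exact: Lfun_cst.
  exact: Lfun_scale.
by move=> [X1 X2]; split; apply: aff => //; rewrite ler1n.
Qed.

Lemma has_moments_scale (q : R) (X : Omega -> R) :
  has_moments P X -> has_moments P (fun w => q * X w).
Proof.
by move=> /(has_moments_affine 0 q); congr has_moments; apply/funext => w; rewrite add0r.
Qed.

Lemma new_moments : moment_conditions v'.
Proof.
have [mth [mI [mY [mZth [mZI [mQ [meth [meI [meth' [meI' meQ]]]]]]]]]] := str_moments hS.
split.
  move=> t; rewrite (funext (new_ln_theta t)); exact: has_moments_affine.
split.
  move=> t; rewrite (funext (new_ln_inv t)); exact: has_moments_affine.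
do 6 (split => //).
split; first by move=> t; exact: has_moments_scale.
by split => // t; exact: has_moments_scale.
Qed.

Lemma covariance_affine (p q p' q' : R) (X W : Omega -> R) : L2 P X -> L2 P W ->
  covariance P (fun w => p + q * X w) (fun w => p' + q' * W w) =
  ((q * q')%:E * covariance P X W)%E.
Proof.
move=> X2 W2; have c1 := L1_cst P.
have X1 := L2_L1 X2; have W1 := L2_L1 W2; have XW := L2_mul X2 W2.
rewrite !covarianceEx//; try by apply: L2D; [exact: L2_cst|exact: L2Z].
rewrite -EFinM; congr (_%:E).
have -> : Ex P (fun w => (p + q * X w) * (p' + q' * W w)) =
    Ex P (fun w => p * p' + p * q' * W w + p' * q * X w + q * q' * (X w * W w)).
  by apply: eq_Ex => w; ring.
rewrite (ExD (L1D (L1D (c1 _) (L1Z _ W1)) (L1Z _ X1)) (L1Z _ XW)).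
rewrite (ExD (L1D (c1 _) (L1Z _ W1)) (L1Z _ X1)) (ExD (c1 _) (L1Z _ W1)).
rewrite (ExD (c1 _) (L1Z _ X1)) (ExD (c1 _) (L1Z _ W1)).
by rewrite !Ex_cst !(ExZ _ X1) !(ExZ _ W1) !(ExZ _ XW); ring.
Qed.

Lemma scale_th_neq0 t : scale_th t != 0.
Proof.
by have [h _ _] := hb; have [h' _ _] := hb'; rewrite mulf_neq0 ?invr_neq0 ?h ?h'.
Qed.

Lemma scale_I_neq0 t : scale_I t != 0.
Proof.
by have [_ h _] := hb; have [_ h' _] := hb'; rewrite mulf_neq0 ?invr_neq0 ?h ?h'.
Qed.

Lemma new_relevance : relevance v'.
Proof.
have [rth rI] := str_relevance hS.
have Lth t : L2 P (ln_theta v t) := L2_latent hS (inl (inl (t, m1))).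
have LI t : L2 P (ln_inv v t) := L2_latent hS (inl (inr (t, m1))).
have nz (x y : R) (c : \bar R) : x != 0 -> y != 0 -> c != 0%E -> ((x * y)%:E * c != 0)%E.
  by move=> x0 y0 c0; rewrite mule_neq0// eqe mulf_neq0.
have E1 t := funext (new_ln_theta t); have E2 t := funext (new_ln_inv t).
split => t.
  have [[s c]|[s st c]] := rth t; [left; exists s|right; exists s => //].
    by rewrite E1 E2 covariance_affine//; apply: nz => //; [exact: scale_th_neq0|exact: scale_I_neq0].
  by rewrite !E1 covariance_affine//; apply: nz => //; exact: scale_th_neq0.
have [[s c]|[s st c]] := rI t; [left; exists s|right; exists s => //].
  by rewrite E1 E2 covariance_affine//; apply: nz => //; [exact: scale_I_neq0|exact: scale_th_neq0].
by rewrite !E2 covariance_affine//; apply: nz => //; exact: scale_I_neq0.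
Qed.

(** The support is carried over by a coordinatewise map h that is invertible on positive arguments.
    The inverse is continuous at h(c), so the points it sends into the old ball form a neighbourhood
    of h(c), and each of them is the image of a support point. *)
Lemma new_support : support_contains_ball v'.
Proof.
move=> t; have [posth [posI [posY _]]] := str_equations hS.
pose V w := (theta v (cur t) w, Defs.inv v t w, Y v t w).
have mV : measurable_fun setT V by do 2 (apply/measurable_fun_pair => //).
have V0 : {ae P, forall w, [/\ 0 < (V w).1.1, 0 < (V w).1.2 & 0 < (V w).2]}.
  by apply: filterS3 (posth (cur t)) (posI t) (posY t) => w ? ? ?; split.
have [c [r [r0 cr]]] := str_support hS t.
have [p1 p2 p3] := law_support_ball_pos mV V0 r0 cr.
pose f p q x : R := expR (p + q * ln x).
pose h (z : R * R * R) := (f (shift_th (cur t)) (scale_th (cur t)) z.1.1,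
  f (shift_I t) (scale_I t) z.1.2, z.2).
(* The inverse of h on positive coordinates. *)
pose k (z : R * R * R) := (
  f (- (shift_th (cur t) / scale_th (cur t))) (scale_th (cur t))^-1 z.1.1,
  f (- (shift_I t / scale_I t)) (scale_I t)^-1 z.1.2, z.2).
have cont (p q x : R) : 0 < x -> f p q y @[y --> x] --> f p q x.
  move=> x0; apply: (@cvg_comp _ _ _ (fun y => p + q * ln y) expR _ (nbhs (p + q * ln x))).
    apply: cvgD; first exact: cvg_cst.
    by apply: cvgM; [exact: cvg_cst|exact: continuous_ln].
  exact: continuous_expR.
have cont3 (p q p' q' : R) (z : R * R * R) : 0 < z.1.1 -> 0 < z.1.2 ->
    (f p q y.1.1, f p' q' y.1.2, y.2) @[y --> z] --> (f p q z.1.1, f p' q' z.1.2, z.2).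
  move=> z1 z2.
  have c1' : y.1 @[y --> z] --> z.1 by exact: cvg_fst.
  have c2' : y.2 @[y --> z] --> z.2 by exact: cvg_snd.
  have c11 : y.1.1 @[y --> z] --> z.1.1 by apply: (cvg_comp _ _ c1'); exact: cvg_fst.
  have c12 : y.1.2 @[y --> z] --> z.1.2 by apply: (cvg_comp _ _ c1'); exact: cvg_snd.
  have d1 := cvg_comp _ _ c11 (cont p q _ z1).
  have d2 := cvg_comp _ _ c12 (cont p' q' _ z2).
  exact: (cvg_pair (cvg_pair d1 d2) c2').
have fK (p q x : R) : q != 0 -> 0 < x -> f p q (f (- (p / q)) q^-1 x) = x.
  by move=> q0 x0; rewrite /f expRK -[RHS]lnK ?posrE//; congr expR; field.
have fK' (p q x : R) : q != 0 -> 0 < x -> f (- (p / q)) q^-1 (f p q x) = x.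
  by move=> q0 x0; rewrite /f expRK -[RHS]lnK ?posrE//; congr expR; field.
have kh : k (h c) = c.
  by case: c p1 p2 p3 {cr} => [[c1 c2] c3] /= p1 p2 p3; rewrite /k /h /= !fK'//;
    [exact: scale_I_neq0|exact: scale_th_neq0].
have hc1 : 0 < (h c).1.1 by exact: expR_gt0.
have hc2 : 0 < (h c).1.2 by exact: expR_gt0.
have nk : nbhs (h c) (k @^-1` ball c r).
  have := cont3 (- (shift_th (cur t) / scale_th (cur t))) (scale_th (cur t))^-1
    (- (shift_I t / scale_I t)) (scale_I t)^-1 (h c) hc1 hc2.
  by apply; rewrite -/(k (h c)) kh; exact: nbhsx_ballx.
(* The neighbourhood is cut down to positive coordinates, where h(k(z)) = z holds. *)
have npos : nbhs (h c) [set z : R * R * R | [/\ 0 < z.1.1, 0 < z.1.2 & True]].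
  apply: open_nbhs_nbhs; split; last by split.
  exact: (open_box (@open_gt _ (0 : R)) (@open_gt _ (0 : R)) openT).
have /nbhs_ballP[s /= s0 sk] : nbhs (h c)
    (k @^-1` ball c r `&` [set z : R * R * R | [/\ 0 < z.1.1, 0 < z.1.2 & True]]).
  exact: filterI.
exists (h c), s; split => // z /sk [/= kz [z1 z2 _]].
have hk : h (k z) = z.
  by case: z z1 z2 {kz} => [[z1 z2] z3] /= ? ?; rewrite /k /h /= !fK//;
    [exact: scale_I_neq0|exact: scale_th_neq0].
rewrite -hk.
have -> : (fun w => (theta v' (cur t) w, Defs.inv v' t w, Y v' t w)) = h \o V by [].
apply: law_support_image => //; last exact: cr.
- have m11 : measurable_fun setT (fun z : R * R * R => z.1.1).
    exact: (measurableT_comp (f := fst) (g := fst)).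
  have m12 : measurable_fun setT (fun z : R * R * R => z.1.2).
    exact: (measurableT_comp (f := snd) (g := fst)).
  apply/measurable_fun_pair => //; apply/measurable_fun_pair.
    exact: measurable_exp_affine.
  exact: measurable_exp_affine.
- by apply: cont3; exact: expR_gt0.
Qed.

Lemma new_cond_means : shocks_conditional_means v'.
Proof.
have [cI cth] := str_cond_means hS; split => t.
  pose h (z : R * R) := (expR (shift_th (cur t) + scale_th (cur t) * ln z.1), z.2).
  have mh : measurable_fun setT h.
    by apply/measurable_fun_pair => //; exact: measurable_exp_affine.
  have mG : measurable_fun setT (fun w => (theta v (cur t) w, Y v t w)).
    by apply/measurable_fun_pair => //.
  have := cond_expectation_scale (s := scale_I t) mG mh (cI t) _.
  rewrite (_ : (fun w => scale_I t * 0) = (fun=> 0)); last by apply/funext => w; rewrite mulr0.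
  by apply; exact: factors_cst.
have [kappa ck] := cth t.
(* The production shock is scaled by [scale_th], the investment shock by [scale_I], so kappa changes
   by their ratio. *)
exists (scale_th (nxt t) * kappa / scale_I t).
pose h (z : R * R * R) := (expR (shift_th (cur t) + scale_th (cur t) * ln z.1.1),
  scale_I t * z.1.2, z.2).
have m11 : measurable_fun setT (fun z : R * R * R => z.1.1).
  exact: (measurableT_comp (f := fst) (g := fst)).
have m12 : measurable_fun setT (fun z : R * R * R => z.1.2).
  exact: (measurableT_comp (f := snd) (g := fst)).
have mh : measurable_fun setT h.
  apply/measurable_fun_pair => //; apply/measurable_fun_pair.
    exact: measurable_exp_affine.
  exact: measurable_funM.
have mG : measurable_fun setT (fun w => (theta v (cur t) w, eta_I v t w, Y v t w)).
  by do 2 (apply/measurable_fun_pair => //).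
have := cond_expectation_scale (s := scale_th (nxt t)) mG mh ck _.
have -> : (fun w => scale_th (nxt t) * (kappa * eta_I v t w)) =
    (fun w => scale_th (nxt t) * kappa / scale_I t * eta_I v' t w).
  by apply/funext => w /=; field; exact: scale_I_neq0.
apply; exists (fun z => scale_th (nxt t) * kappa / scale_I t * z.1.2) => //.
exact: measurable_funM.
Qed.

Lemma new_structure : is_structure b' v'.
Proof.
split.
- exact: hb'.
- exact: new_model_equations.
- exact: new_cond_independent.
- by move=> j; rewrite new_errors; exact: (str_independent_of_Y hS).
- exact: new_moments.
- by move=> j; rewrite new_errors; exact: (str_centered hS).
- exact: new_relevance.
- by move=> j; rewrite new_errors; exact: (str_char_fun hS).
- exact: new_support.
- exact: new_cond_means.
Qed.

Lemma new_observationally_equivalent : observationally_equivalent v v'.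
Proof. by []. Qed.

End Reparametrization.

(** * Normalization *)

Section Normalization.
Context (R : realType) (T : nat).
Implicit Types (b : params R T).

(** Inverse of [transform] once the first intercepts and loadings are prescribed. The equations are
    solved from the interaction coefficient downwards, since the other production coefficients
    depend on it. *)
Definition untransform (b : params R T) (mth lth : 'I_T.+1 -> R) (mI lI : 'I_T -> R) :
    params R T :=
  let g3 t := gamma3 b t * (lth (cur t) * lI t) / lth (nxt t) in
  let g1 t := gamma1 b t * lth (cur t) / lth (nxt t) + mI t / lI t * g3 t in
  let g2 t := gamma2 b t * lI t / lth (nxt t) + mth (cur t) / lth (cur t) * g3 t in
  let b1 t := beta1 b t * lth (cur t) / lI t in
  let r1 := rho1 b * lth ord_max in
  {| mu_th := fun t m => mu_th b t m + la_th b t m * mth t;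
     la_th := fun t m => la_th b t m * lth t;
     mu_I := fun t m => mu_I b t m + la_I b t m * mI t;
     la_I := fun t m => la_I b t m * lI t;
     rho0 := rho0 b + rho1 b * mth ord_max;
     rho1 := r1;
     beta0 := fun t => (beta0 b t - mI t) / lI t + mth (cur t) / lth (cur t) * b1 t;
     beta1 := b1;
     beta2 := fun t => beta2 b t / lI t;
     a_ := fun t => (a_ b t - mth (nxt t)) / lth (nxt t)
       + mth (cur t) / lth (cur t) * g1 t + mI t / lI t * g2 t
       - mI t * mth (cur t) / (lth (cur t) * lI t) * g3 t;
     gamma1 := g1;
     gamma2 := g2;
     gamma3 := g3 |}.

(** Uniqueness under the normalization: an admissible vector is determined by its transform and its
    first-measurement parameters. *)
Lemma transformK b : admissible b ->
  untransform (transform b) (fun t => mu_th b t m1) (fun t => la_th b t m1)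
    (fun t => mu_I b t m1) (fun t => la_I b t m1) = b.
Proof.
case: b => [mu la muI laI r0 r1 b0 b1 b2 a g1 g2 g3] [/= th0 I0 b20].
rewrite /untransform /transform /=.
by congr Params; do 2?[apply/funext => ?]; field; rewrite ?th0 ?I0.
Qed.

Section Fixed.
Variables (b : params R T) (mth lth : 'I_T.+1 -> R) (mI lI : 'I_T -> R).
Hypotheses (hb : admissible b) (lth0 : forall t, lth t != 0) (lI0 : forall t, lI t != 0).
Local Notation b0 := (untransform (transform b) mth lth mI lI).

Lemma untransform_normalized :
  (forall t, mu_th b0 t m1 = mth t /\ la_th b0 t m1 = lth t) /\
  (forall t, mu_I b0 t m1 = mI t /\ la_I b0 t m1 = lI t).
Proof.
have [th0 I0 _] := hb.
by split => t; split; rewrite /=; field; rewrite ?th0 ?I0.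
Qed.

Lemma untransform_admissible : admissible b0.
Proof.
have [th0 I0 b20] := hb; split => [t m|t m|t] /=.
- by rewrite !mulf_neq0 ?invr_neq0.
- by rewrite !mulf_neq0 ?invr_neq0.
- by rewrite !mulf_neq0 ?invr_neq0.
Qed.

(** Existence under the normalization: every choice of first intercepts and nonzero first loadings
    is compatible with the given transform. *)
Lemma untransformK : transform b0 = transform b.
Proof.
have [th0 I0 b20] := hb.
rewrite /untransform /transform /=.
by congr Params; do 2?[apply/funext => ?]; field;
  rewrite ?th0 ?I0 ?lth0 ?lI0.
Qed.

End Fixed.
End Normalization.

Theorem theorem1 (R : realType) (T : nat) (d : measure_display)
    (Omega : measurableType d) (P : probability Omega R)
    (b : params R T) (v : variables T P) (hS : is_structure b v) :
  identified_set v
    = [set b' | admissible b' /\ transform b' = transform b] /\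
  (forall (mub_th lab_th : 'I_T.+1 -> R) (mub_I lab_I : 'I_T -> R),
     (forall t, lab_th t != 0) -> (forall t, lab_I t != 0) ->
     exists b0 : params R T,
       identified_set v `&`
         [set b' | (forall t, mu_th b' t m1 = mub_th t /\
                              la_th b' t m1 = lab_th t) /\
                   (forall t, mu_I b' t m1 = mub_I t /\
                              la_I b' t m1 = lab_I t)]
       = [set b0]).
Proof.
have hb := str_admissible hS.
have E : identified_set v = [set b' | admissible b' /\ transform b' = transform b].
  apply/seteqP; split => b' /=.
  move=> [d' [Om' [P' [v' [hS' vv']]]]]; split; first exact: str_admissible hS'.
    exact: observationally_equivalent_transform hS hS' vv'.
  move=> [hb' bb']; exists d, Omega, P, (new_variables b b' v); split.
    exact: new_structure.
  exact: new_observationally_equivalent.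
split => // mth lth mI lI lth0 lI0; exists (untransform (transform b) mth lth mI lI).
rewrite E; apply/seteqP; split => b' /=.
  (* [b'] is rebuilt from its transform and its first-measurement parameters, all of which are
     prescribed. *)
  move=> [[hb' bb'] [nth nI]]; rewrite -(transformK hb') bb'; congr untransform.
  - by apply/funext => t; have [] := nth t.
  - by apply/funext => t; have [] := nth t.
  - by apply/funext => t; have [] := nI t.
  - by apply/funext => t; have [] := nI t.
move=> ->; split; last exact: untransform_normalized.
by split; [exact: untransform_admissible|exact: untransformK].
Qed.
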